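(* Assume the extensionality schemes and the identity extension schema. Let $\alpha\vdash\sigma(\alpha)$ be an inductively constructed type in which $\alpha$ occurs only positively, let $\nu\alpha.\sigma(\alpha)=\Pi\beta.(\Pi\alpha.(!(\alpha\multimap\sigma(\alpha))\otimes\alpha\multimap\beta))\multimap\beta$, and let $\mathit{out}:\nu\alpha.\sigma(\alpha)\multimap\sigma(\nu\alpha.\sigma(\alpha))$ be the term $\mathit{out}=\lambda^\circ x.\ x\,\sigma(\nu\alpha.\sigma(\alpha))\,r$ with $r=\Lambda\alpha.\lambda^\circ y.\ \mathrm{let}\ w\otimes z=y\ \mathrm{in}\ \sigma(\mathit{unfold}\,\alpha\,w)(\mathrm{let}\ !f=w\ \mathrm{in}\ f\,z)$, where $\mathit{unfold}=\Lambda\alpha.\lambda^\circ f{:}!(\alpha\multimap\sigma(\alpha)).\lambda^\circ x{:}\alpha.\ \mathit{pack}\,\alpha\,(f\otimes x)$ and $\mathit{pack}=\Lambda\alpha.\lambda^\circ x.\Lambda\beta.\lambda^\circ g.\ g\,\alpha\,x$. Suppose $R\subset\nu\alpha.\sigma(\alpha)\times\nu\alpha.\sigma(\alpha)$ is any (not necessarily admissible) definable relation such that $(R\multimap\sigma[R])(\mathit{out},\mathit{out})$. Then $\forall x,y:\nu\alpha.\sigma(\alpha).\ R(x,y)\supset x=_{\nu\alpha.\sigma(\alpha)}y$.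
   Context: PILL$_Y$ is the polymorphic intuitionistic/linear lambda calculus with fixed points. Types in a context $\Xi$ of type variables are given by $\sigma ::= \alpha \mid I \mid \sigma\otimes\sigma \mid \sigma\multimap\sigma \mid\ !\sigma \mid \Pi\alpha.\sigma$. Terms are typed in judgements $\Xi\mid\Gamma;\Delta\vdash t:\tau$ with an intuitionistic variable context $\Gamma$ and a linear variable context $\Delta$; the constructs are variables, $\star:I$, linear abstraction $\lambda^\circ x{:}\sigma.t$ and application $t\,u$, $t\otimes s$, $!t$ (allowed only when the linear context is empty), type abstraction $\Lambda\alpha.t$ and type application $t\,\sigma$, the eliminations $\mathrm{let}\ x\otimes y = s\ \mathrm{in}\ t$, $\mathrm{let}\ !x = s\ \mathrm{in}\ t$, $\mathrm{let}\ \star = s\ \mathrm{in}\ t$, and a constant $Y:\Pi\alpha.(\alpha\to\alpha)\to\alpha$. Here $\sigma\to\tau$ abbreviates $!\sigma\multimap\tau$. External equality of terms is generated by the $\beta$- and $\eta$-rules of all constructs, commuting conversions of the let-constructs with linear contexts, congruence, and $f\,(!(Y\,\sigma\,(!f))) = Y\,\sigma\,(!f)$. LAPL is an intuitionistic higher-order predicate logic over PILL$_Y$ with contexts $\Xi\mid\Gamma\mid\Theta$, where $\Theta$ declares relation variables and admissible relation variables $R:\mathrm{AdmRel}(\sigma,\tau)$; propositions include internal equality $t=_\sigma u$ (externally equal terms are internally equal), $\rho(t,u)$ for definable relations, connectives and quantifiers over types, terms, relations and admissible relations. Admissible relations are a designated class of definable relations containing equality relations and graphs of linear terms, closed under reindexing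 along linear terms, conjunction, implication from arbitrary propositions and universal quantification. Constructions on definable relations $\rho\subset\sigma\times\tau$, $\rho'\subset\sigma'\times\tau'$: $(\rho\multimap\rho')(f,g)$ iff $\forall x,y.\ \rho(x,y)\supset\rho'(f\,x,g\,y)$; $(\rho\to\rho')(f,g)$ iff $\forall x,y.\ \rho(x,y)\supset\rho'(f(!x),g(!y))$; $(!\rho)(x,y)$ iff for all types $\alpha,\beta$, all $R:\mathrm{AdmRel}(\alpha,\beta)$ and all $f:\sigma\to\alpha$, $g:\tau\to\beta$ with $(\rho\to R)(f,g)$ we have $R(f\,x,g\,y)$; $(\rho\otimes\rho')(x,y)$ iff for all $\alpha,\beta$, $R:\mathrm{AdmRel}(\alpha,\beta)$ and $t:\sigma\multimap\sigma'\multimap\alpha$, $t':\tau\multimap\tau'\multimap\beta$ with $(\rho\multimap\rho'\multimap R)(t,t')$ we have $R(\mathrm{let}\ x_1\otimes x_2=x\ \mathrm{in}\ t\,x_1\,x_2,\ \mathrm{let}\ y_1\otimes y_2 = y\ \mathrm{in}\ t'\,y_1\,y_2)$; $I_{Rel}(x,y)$ iff for all $\alpha,\beta$, $R:\mathrm{AdmRel}(\alpha,\beta)$ and $z,w$ with $R(z,w)$ we have $R(\mathrm{let}\ \star=x\ \mathrm{in}\ z,\mathrm{let}\ \star=y\ \mathrm{in}\ w)$. Each type $\sigma(\vec\alpha)$ has a relational interpretation $\sigma[\vec\rho]$ at admissible relations satisfying the clauses $\alpha_i[\vec\rho]\equiv\rho_i$, $(\sigma\multimap\sigma')[\vec\rho]\equiv\sigma[\vec\rho]\multimap\sigma'[\vec\rho]$,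 $(\sigma\otimes\sigma')[\vec\rho]\equiv\sigma[\vec\rho]\otimes\sigma'[\vec\rho]$, $(!\sigma)[\vec\rho]\equiv!(\sigma[\vec\rho])$, $I[\vec\rho]\equiv I_{Rel}$, $(\Pi\beta.\sigma)[\vec\rho](t,u)\Leftrightarrow\forall\beta,\beta'.\forall R:\mathrm{AdmRel}(\beta,\beta').\ \sigma[\vec\rho,R](t\,\beta,u\,\beta')$. For an inductively constructed type $\sigma$ and an arbitrary (not necessarily admissible) relation $R$, $\sigma[R]$ is defined by structural induction on $\sigma$ using these same clauses (with $R$ for $\alpha$ and equality relations for closed types). The extensionality schemes are $(\forall x.\ t\,x=u\,x)\supset t=_{\sigma\multimap\tau}u$ and $(\forall\alpha.\ t\,\alpha=u\,\alpha)\supset t=_{\Pi\alpha.\tau}u$; the identity extension schema is $\forall\vec\alpha.\ \sigma[eq_{\vec\alpha}]\equiv eq_{\sigma(\vec\alpha)}$ for every type $\sigma(\vec\alpha)$, $eq$ denoting internal equality. A type is inductively constructed if it is built from type variables and closed types using $\multimap,\otimes,I,!,\Pi$; positive/negative occurrences are as usual ($\multimap$ reverses polarity in its argument). For such $\sigma(\alpha)$ with $\alpha$ only positive, the functorial action $\sigma(f):\sigma(\tau)\multimap\sigma(\tau')$ of $f:\tau\multimap\tau'$ is the term defined by structural induction: $\alpha(f)=f$; closed types act by identity; $(\sigma_1\multimap\sigma_2)(f)=\lambda^\circ h.\ \sigma_2(f)\circ h\circ\sigma_1(f)$ (with $\sigma_1(f)$ going backwards); $\otimes$ componentwise; $(!\sigma_1)(f)=\lambda^\circ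 x.\mathrm{let}\ !y=x\ \mathrm{in}\ !(\sigma_1(f)\,y)$; $(\Pi\omega.\sigma_1)(f)=\lambda^\circ z.\Lambda\omega.\sigma_1(f)(z\,\omega)$.
   Formalization: The printed body of r uses the linear variable w more than once and is not typable (e.g. for σ(α)=α); it is read as let w⊗z=y in let !f=w in σ(unfold α (!f))(f z). *)

(* Defs.v *)
(* Deep embedding of PILL_Y and of the logic LAPL, with de Bruijn indices.
   There are three separate index spaces, for type variables, for term
   variables and for relation variables; index 0 is the innermost binder. *)
From mathcomp Require Import all_boot.

Set Implicit Arguments.
Unset Strict Implicit.
Unset Printing Implicit Defensive.

Definition scons T (x : T) (f : nat -> T) (i : nat) : T :=
  if i is j.+1 then f j else x.

Definition upr (r : nat -> nat) : nat -> nat := scons 0 (fun i => (r i).+1).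

Inductive ty : Type :=
| TVar (i : nat)
| TUnit
| TTens (a b : ty)
| TLolli (a b : ty)
| TBang (a : ty)
| TPi (a : ty).

Definition TArr (a b : ty) : ty := TLolli (TBang a) b.

Fixpoint ty_ren (r : nat -> nat) (a : ty) : ty :=
  match a with
  | TVar i => TVar (r i)
  | TUnit => TUnit
  | TTens a b => TTens (ty_ren r a) (ty_ren r b)
  | TLolli a b => TLolli (ty_ren r a) (ty_ren r b)
  | TBang a => TBang (ty_ren r a)
  | TPi a => TPi (ty_ren (upr r) a)
  end.

Definition upT (s : nat -> ty) : nat -> ty :=
  scons (TVar 0) (fun i => ty_ren succn (s i)).

Fixpoint ty_sub (s : nat -> ty) (a : ty) : ty :=
  match a with
  | TVar i => s i
  | TUnit => TUnit
  | TTens a b => TTens (ty_sub s a) (ty_sub s b)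
  | TLolli a b => TLolli (ty_sub s a) (ty_sub s b)
  | TBang a => TBang (ty_sub s a)
  | TPi a => TPi (ty_sub (upT s) a)
  end.

(* [wkT m a] weakens [a] by [m] type variables; [tinst a b] is a[b/0]. *)
Definition wkT (m : nat) : ty -> ty := ty_ren (addn m).
Definition tinst (a b : ty) : ty := ty_sub (scons b TVar) a.

Fixpoint wf_ty (Xi : nat) (a : ty) : bool :=
  match a with
  | TVar i => i < Xi
  | TUnit => true
  | TTens a b | TLolli a b => wf_ty Xi a && wf_ty Xi b
  | TBang a => wf_ty Xi a
  | TPi a => wf_ty Xi.+1 a
  end.

(* [polar p i a]: every occurrence of the variable [i] in [a] has polarity [p],
   [true] standing for positive. *)
Fixpoint polar (p : bool) (i : nat) (a : ty) : bool :=
  match a with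
  | TVar j => (j == i) ==> p
  | TUnit => true
  | TTens a b => polar p i a && polar p i b
  | TLolli a b => polar (~~ p) i a && polar p i b
  | TBang a => polar p i a
  | TPi a => polar p i.+1 a
  end.

Definition only_positive : nat -> ty -> bool := polar true.

Inductive tm : Type :=
| Var (i : nat)
| Star
| Y
| Lam (a : ty) (t : tm)
| App (t u : tm)
| Tens (t u : tm)
| Bang (t : tm)
| TLam (t : tm)
| TApp (t : tm) (a : ty)
| LetT (s t : tm)     (* of the two variables bound in t, the first is 1 *)
| LetB (s t : tm)
| LetS (s t : tm).

Fixpoint tm_ren (rt r : nat -> nat) (t : tm) : tm :=
  match t with
  | Var i => Var (r i)
  | Star => Star
  | Y => Y
  | Lam a t => Lam (ty_ren rt a) (tm_ren rt (upr r) t)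
  | App t u => App (tm_ren rt r t) (tm_ren rt r u)
  | Tens t u => Tens (tm_ren rt r t) (tm_ren rt r u)
  | Bang t => Bang (tm_ren rt r t)
  | TLam t => TLam (tm_ren (upr rt) r t)
  | TApp t a => TApp (tm_ren rt r t) (ty_ren rt a)
  | LetT s t => LetT (tm_ren rt r s) (tm_ren rt (upr (upr r)) t)
  | LetB s t => LetB (tm_ren rt r s) (tm_ren rt (upr r) t)
  | LetS s t => LetS (tm_ren rt r s) (tm_ren rt r t)
  end.

Definition wkt (m n : nat) : tm -> tm := tm_ren (addn m) (addn n).

Definition upt (s : nat -> tm) : nat -> tm :=
  scons (Var 0) (fun i => wkt 0 1 (s i)).

Fixpoint tm_sub (st : nat -> ty) (s : nat -> tm) (t : tm) : tm :=
  match t with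
  | Var i => s i
  | Star => Star
  | Y => Y
  | Lam a t => Lam (ty_sub st a) (tm_sub st (upt s) t)
  | App t u => App (tm_sub st s t) (tm_sub st s u)
  | Tens t u => Tens (tm_sub st s t) (tm_sub st s u)
  | Bang t => Bang (tm_sub st s t)
  | TLam t => TLam (tm_sub (upT st) (fun i => wkt 1 0 (s i)) t)
  | TApp t a => TApp (tm_sub st s t) (ty_sub st a)
  | LetT s' t => LetT (tm_sub st s s') (tm_sub st (upt (upt s)) t)
  | LetB s' t => LetB (tm_sub st s s') (tm_sub st (upt s) t)
  | LetS s' t => LetS (tm_sub st s s') (tm_sub st s t)
  end.

(* The two zones Gamma; Delta are interleaved in one list: [Int] marks the
   intuitionistic variables, [Lin] the linear ones, and [Gone] a linear variable
   which was given to another subterm and so is not in Delta. *)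
Inductive mode : Type := Int | Lin | Gone.

Definition ctx := seq (mode * ty).

Definition ctx_wkT (G : ctx) : ctx := [seq (e.1, wkT 1 e.2) | e <- G].

Definition nolin (G : ctx) : Prop :=
  forall i a, onth G i <> Some (Lin, a).

Inductive csplit : ctx -> ctx -> ctx -> Prop :=
| split_nil : csplit [::] [::] [::]
| split_int a G G1 G2 : csplit G G1 G2 ->
    csplit ((Int, a) :: G) ((Int, a) :: G1) ((Int, a) :: G2)
| split_gone a G G1 G2 : csplit G G1 G2 ->
    csplit ((Gone, a) :: G) ((Gone, a) :: G1) ((Gone, a) :: G2)
| split_left a G G1 G2 : csplit G G1 G2 ->
    csplit ((Lin, a) :: G) ((Lin, a) :: G1) ((Gone, a) :: G2)
| split_right a G G1 G2 : csplit G G1 G2 ->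
    csplit ((Lin, a) :: G) ((Gone, a) :: G1) ((Lin, a) :: G2).

Definition Yty : ty := TPi (TArr (TArr (TVar 0) (TVar 0)) (TVar 0)).

Inductive typed : nat -> ctx -> tm -> ty -> Prop :=
| ty_ivar Xi G i a : onth G i = Some (Int, a) -> nolin G ->
    typed Xi G (Var i) a
| ty_lvar Xi G i a : onth G i = Some (Lin, a) ->
    (forall j b, onth G j = Some (Lin, b) -> j = i) ->
    typed Xi G (Var i) a
| ty_star Xi G : nolin G -> typed Xi G Star TUnit
| ty_Y Xi G : nolin G -> typed Xi G Y Yty
| ty_lam Xi G a b t : wf_ty Xi a ->
    typed Xi ((Lin, a) :: G) t b ->
    typed Xi G (Lam a t) (TLolli a b)
| ty_app Xi G G1 G2 a b t u : csplit G G1 G2 ->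
    typed Xi G1 t (TLolli a b) -> typed Xi G2 u a ->
    typed Xi G (App t u) b
| ty_tens Xi G G1 G2 a b t u : csplit G G1 G2 ->
    typed Xi G1 t a -> typed Xi G2 u b ->
    typed Xi G (Tens t u) (TTens a b)
| ty_bang Xi G a t : nolin G ->
    typed Xi G t a -> typed Xi G (Bang t) (TBang a)
| ty_tlam Xi G a t :
    typed Xi.+1 (ctx_wkT G) t a -> typed Xi G (TLam t) (TPi a)
| ty_tapp Xi G a b t : wf_ty Xi b ->
    typed Xi G t (TPi a) -> typed Xi G (TApp t b) (tinst a b)
| ty_letT Xi G G1 G2 a b c s t : csplit G G1 G2 ->
    typed Xi G1 s (TTens a b) ->
    typed Xi ((Lin, b) :: (Lin, a) :: G2) t c ->
    typed Xi G (LetT s t) c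
| ty_letB Xi G G1 G2 a c s t : csplit G G1 G2 ->
    typed Xi G1 s (TBang a) ->
    typed Xi ((Int, a) :: G2) t c ->
    typed Xi G (LetB s t) c
| ty_letS Xi G G1 G2 c s t : csplit G G1 G2 ->
    typed Xi G1 s TUnit -> typed Xi G2 t c ->
    typed Xi G (LetS s t) c.

(* The layers of linear contexts: the hole may be anywhere except under !. *)
Inductive frame : Type :=
| FLam (a : ty)
| FAppL (u : tm)
| FAppR (t : tm)
| FTensL (u : tm)
| FTensR (t : tm)
| FTLam
| FTApp (a : ty)
| FLetT1 (t : tm)
| FLetT2 (s : tm)
| FLetB1 (t : tm)
| FLetB2 (s : tm)
| FLetS1 (t : tm)
| FLetS2 (s : tm).

Definition fplug (F : frame) (h : tm) : tm :=
  match F with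
  | FLam a => Lam a h
  | FAppL u => App h u
  | FAppR t => App t h
  | FTensL u => Tens h u
  | FTensR t => Tens t h
  | FTLam => TLam h
  | FTApp a => TApp h a
  | FLetT1 t => LetT h t
  | FLetT2 s => LetT s h
  | FLetB1 t => LetB h t
  | FLetB2 s => LetB s h
  | FLetS1 t => LetS h t
  | FLetS2 s => LetS s h
  end.

(* The numbers of term and type variables bound at the hole. *)
Definition ftm (F : frame) : nat :=
  match F with FLam _ | FLetB2 _ => 1 | FLetT2 _ => 2 | _ => 0 end.
Definition fty (F : frame) : nat := if F is FTLam then 1 else 0.

Definition fwk (m : nat) (F : frame) : frame :=
  match F with
  | FLam a => FLam a
  | FAppL u => FAppL (wkt 0 m u)
  | FAppR t => FAppR (wkt 0 m t)
  | FTensL u => FTensL (wkt 0 m u)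
  | FTensR t => FTensR (wkt 0 m t)
  | FTLam => FTLam
  | FTApp a => FTApp a
  | FLetT1 t => FLetT1 (tm_ren id (upr (upr (addn m))) t)
  | FLetT2 s => FLetT2 (wkt 0 m s)
  | FLetB1 t => FLetB1 (tm_ren id (upr (addn m)) t)
  | FLetB2 s => FLetB2 (wkt 0 m s)
  | FLetS1 t => FLetS1 (wkt 0 m t)
  | FLetS2 s => FLetS2 (wkt 0 m s)
  end.

Inductive letk : Type := KTens | KBang | KStar.

Definition mklet (k : letk) : tm -> tm -> tm :=
  match k with KTens => LetT | KBang => LetB | KStar => LetS end.
Definition lbinds (k : letk) : nat :=
  match k with KTens => 2 | KBang => 1 | KStar => 0 end.

(* Exchanges the [m] innermost variables with the [k] variables around them. *)
Definition swapr (k m i : nat) : nat :=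
  if i < m then i + k else if i < m + k then i - m else i.

(* Commuting conversions are given for one layer of a linear context; those for
   a whole linear context follow by congruence and transitivity. *)
Inductive eq_ax : tm -> tm -> Prop :=
| beta_lam a t u : eq_ax (App (Lam a t) u) (tm_sub TVar (scons u Var) t)
| beta_tlam a t : eq_ax (TApp (TLam t) a) (tm_sub (scons a TVar) Var t)
| beta_tens s u t :
    eq_ax (LetT (Tens s u) t) (tm_sub TVar (scons u (scons s Var)) t)
| beta_bang u t : eq_ax (LetB (Bang u) t) (tm_sub TVar (scons u Var) t)
| beta_star t : eq_ax (LetS Star t) t
| eta_lam a t : eq_ax (Lam a (App (wkt 0 1 t) (Var 0))) t
| eta_tlam t : eq_ax (TLam (TApp (wkt 1 0 t) (TVar 0))) t
| eta_tens t : eq_ax (LetT t (Tens (Var 1) (Var 0))) t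
| eta_bang t : eq_ax (LetB t (Bang (Var 0))) t
| eta_star t : eq_ax (LetS t Star) t
| fix_Y a f : let y := App (TApp Y a) (Bang f) in eq_ax (App f (Bang y)) y
| comm_let k s F u :
    eq_ax (mklet k s (fplug (fwk (lbinds k) F) u))
          (fplug F (mklet k (wkt (fty F) (ftm F) s)
                          (tm_ren id (swapr (lbinds k) (ftm F)) u))).

Inductive exteq : nat -> ctx -> tm -> tm -> ty -> Prop :=
| ee_ax Xi G t u a : eq_ax t u -> typed Xi G t a -> typed Xi G u a ->
    exteq Xi G t u a
| ee_refl Xi G t a : typed Xi G t a -> exteq Xi G t t a
| ee_sym Xi G t u a : exteq Xi G t u a -> exteq Xi G u t a
| ee_trans Xi G t u v a :
    exteq Xi G t u a -> exteq Xi G u v a -> exteq Xi G t v a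
| ee_lam Xi G a b t t' : wf_ty Xi a ->
    exteq Xi ((Lin, a) :: G) t t' b ->
    exteq Xi G (Lam a t) (Lam a t') (TLolli a b)
| ee_app Xi G G1 G2 a b t t' u u' : csplit G G1 G2 ->
    exteq Xi G1 t t' (TLolli a b) -> exteq Xi G2 u u' a ->
    exteq Xi G (App t u) (App t' u') b
| ee_tens Xi G G1 G2 a b t t' u u' : csplit G G1 G2 ->
    exteq Xi G1 t t' a -> exteq Xi G2 u u' b ->
    exteq Xi G (Tens t u) (Tens t' u') (TTens a b)
| ee_bang Xi G a t t' : nolin G ->
    exteq Xi G t t' a -> exteq Xi G (Bang t) (Bang t') (TBang a)
| ee_tlam Xi G a t t' :
    exteq Xi.+1 (ctx_wkT G) t t' a -> exteq Xi G (TLam t) (TLam t') (TPi a)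
| ee_tapp Xi G a b t t' : wf_ty Xi b ->
    exteq Xi G t t' (TPi a) -> exteq Xi G (TApp t b) (TApp t' b) (tinst a b)
| ee_letT Xi G G1 G2 a b c s s' t t' : csplit G G1 G2 ->
    exteq Xi G1 s s' (TTens a b) ->
    exteq Xi ((Lin, b) :: (Lin, a) :: G2) t t' c ->
    exteq Xi G (LetT s t) (LetT s' t') c
| ee_letB Xi G G1 G2 a c s s' t t' : csplit G G1 G2 ->
    exteq Xi G1 s s' (TBang a) ->
    exteq Xi ((Int, a) :: G2) t t' c ->
    exteq Xi G (LetB s t) (LetB s' t') c
| ee_letS Xi G G1 G2 c s s' t t' : csplit G G1 G2 ->
    exteq Xi G1 s s' TUnit -> exteq Xi G2 t t' c ->
    exteq Xi G (LetS s t) (LetS s' t') c.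

(* [PAllRel b a a' p] and [PExRel b a a' p] quantify over Rel(a, a') if [b] is
   false and over AdmRel(a, a') if [b] is true.
   [RAbs a b p] is (x : a, y : b). p, where x is 1 and y is 0 in [p].
   [RTy a rs] is the relational interpretation a[rs]; the variable [i] of [a] is
   interpreted by the [i]-th relation of [rs], and [a] has no other variable. *)
Inductive lprop : Type :=
| PEq (a : ty) (t u : tm)
| PRel (r : lrel) (t u : tm)
| PTop
| PBot
| PAnd (p q : lprop)
| POr (p q : lprop)
| PImp (p q : lprop)
| PAllTy (p : lprop)
| PExTy (p : lprop)
| PAllTm (a : ty) (p : lprop)
| PExTm (a : ty) (p : lprop)
| PAllRel (b : bool) (a a' : ty) (p : lprop)
| PExRel (b : bool) (a a' : ty) (p : lprop)
with lrel : Type :=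
| RVar (i : nat)
| RAbs (a b : ty) (p : lprop)
| RTy (a : ty) (rs : seq lrel).

Fixpoint pr_ren (rt r rr : nat -> nat) (p : lprop) : lprop :=
  match p with
  | PEq a t u => PEq (ty_ren rt a) (tm_ren rt r t) (tm_ren rt r u)
  | PRel h t u => PRel (rl_ren rt r rr h) (tm_ren rt r t) (tm_ren rt r u)
  | PTop => PTop
  | PBot => PBot
  | PAnd p q => PAnd (pr_ren rt r rr p) (pr_ren rt r rr q)
  | POr p q => POr (pr_ren rt r rr p) (pr_ren rt r rr q)
  | PImp p q => PImp (pr_ren rt r rr p) (pr_ren rt r rr q)
  | PAllTy p => PAllTy (pr_ren (upr rt) r rr p)
  | PExTy p => PExTy (pr_ren (upr rt) r rr p)
  | PAllTm a p => PAllTm (ty_ren rt a) (pr_ren rt (upr r) rr p)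
  | PExTm a p => PExTm (ty_ren rt a) (pr_ren rt (upr r) rr p)
  | PAllRel b a a' p =>
      PAllRel b (ty_ren rt a) (ty_ren rt a') (pr_ren rt r (upr rr) p)
  | PExRel b a a' p =>
      PExRel b (ty_ren rt a) (ty_ren rt a') (pr_ren rt r (upr rr) p)
  end
with rl_ren (rt r rr : nat -> nat) (h : lrel) : lrel :=
  match h with
  | RVar i => RVar (rr i)
  | RAbs a b p =>
      RAbs (ty_ren rt a) (ty_ren rt b) (pr_ren rt (upr (upr r)) rr p)
  | RTy a rs => RTy a (map (rl_ren rt r rr) rs)
  end.

(* Weakening by [l] type variables, [m] term variables, [n] relation variables. *)
Definition wkp (l m n : nat) : lprop -> lprop :=
  pr_ren (addn l) (addn m) (addn n).
Definition wkr (l m n : nat) : lrel -> lrel :=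
  rl_ren (addn l) (addn m) (addn n).

Definition upR (sr : nat -> lrel) : nat -> lrel :=
  scons (RVar 0) (fun i => wkr 0 0 1 (sr i)).

Fixpoint pr_sub (st : nat -> ty) (s : nat -> tm) (sr : nat -> lrel) (p : lprop)
  : lprop :=
  match p with
  | PEq a t u => PEq (ty_sub st a) (tm_sub st s t) (tm_sub st s u)
  | PRel h t u => PRel (rl_sub st s sr h) (tm_sub st s t) (tm_sub st s u)
  | PTop => PTop
  | PBot => PBot
  | PAnd p q => PAnd (pr_sub st s sr p) (pr_sub st s sr q)
  | POr p q => POr (pr_sub st s sr p) (pr_sub st s sr q)
  | PImp p q => PImp (pr_sub st s sr p) (pr_sub st s sr q)
  | PAllTy p => PAllTy
      (pr_sub (upT st) (fun i => wkt 1 0 (s i)) (fun i => wkr 1 0 0 (sr i)) p)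
  | PExTy p => PExTy
      (pr_sub (upT st) (fun i => wkt 1 0 (s i)) (fun i => wkr 1 0 0 (sr i)) p)
  | PAllTm a p =>
      PAllTm (ty_sub st a) (pr_sub st (upt s) (fun i => wkr 0 1 0 (sr i)) p)
  | PExTm a p =>
      PExTm (ty_sub st a) (pr_sub st (upt s) (fun i => wkr 0 1 0 (sr i)) p)
  | PAllRel b a a' p =>
      PAllRel b (ty_sub st a) (ty_sub st a') (pr_sub st s (upR sr) p)
  | PExRel b a a' p =>
      PExRel b (ty_sub st a) (ty_sub st a') (pr_sub st s (upR sr) p)
  end
with rl_sub (st : nat -> ty) (s : nat -> tm) (sr : nat -> lrel) (h : lrel) : lrel :=
  match h with
  | RVar i => sr i
  | RAbs a b p =>
      RAbs (ty_sub st a) (ty_sub st b)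
        (pr_sub st (upt (upt s)) (fun i => wkr 0 2 0 (sr i)) p)
  | RTy a rs => RTy a (map (rl_sub st s sr) rs)
  end.

Definition pinst_ty (p : lprop) (a : ty) := pr_sub (scons a TVar) Var RVar p.
Definition pinst_tm (p : lprop) (t : tm) := pr_sub TVar (scons t Var) RVar p.
Definition pinst_rel (p : lprop) (h : lrel) := pr_sub TVar Var (scons h RVar) p.

(* [p[t/x, u/y]] for x, y the variables bound by [RAbs]. *)
Definition pinst2 (p : lprop) (t u : tm) :=
  pr_sub TVar (scons u (scons t Var)) RVar p.

Definition PIff (p q : lprop) : lprop := PAnd (PImp p q) (PImp q p).

Definition req (a : ty) : lrel := RAbs a a (PEq a (Var 1) (Var 0)).

(* [h] and [k] are relations between [a] and [b]. *)
Definition requiv (a b : ty) (h k : lrel) : lprop :=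
  PAllTm a (PAllTm b
    (PIff (PRel (wkr 0 2 0 h) (Var 1) (Var 0))
          (PRel (wkr 0 2 0 k) (Var 1) (Var 0)))).

(* Below [h] is a relation between [a] and [b], and [h'] between [a'] and [b'];
   [rlolli a b a' b' h h'] is h -o h', and so on. *)

Definition rlolli (a b a' b' : ty) (h h' : lrel) : lrel :=
  RAbs (TLolli a a') (TLolli b b')
    (PAllTm a (PAllTm b
      (PImp (PRel (wkr 0 4 0 h) (Var 1) (Var 0))
            (PRel (wkr 0 4 0 h') (App (Var 3) (Var 1)) (App (Var 2) (Var 0)))))).

Definition rarr (a b a' b' : ty) (h h' : lrel) : lrel :=
  RAbs (TArr a a') (TArr b b')
    (PAllTm a (PAllTm b
      (PImp (PRel (wkr 0 4 0 h) (Var 1) (Var 0))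
            (PRel (wkr 0 4 0 h') (App (Var 3) (Bang (Var 1)))
                                 (App (Var 2) (Bang (Var 0))))))).

(* After the quantifiers over alpha, beta and R : AdmRel(alpha, beta), the type
   variables alpha and beta are 1 and 0. *)
Definition rbang (a b : ty) (h : lrel) : lrel :=
  RAbs (TBang a) (TBang b)
    (PAllTy (PAllTy (PAllRel true (TVar 1) (TVar 0)
      (PAllTm (TArr (wkT 2 a) (TVar 1)) (PAllTm (TArr (wkT 2 b) (TVar 0))
        (PImp
          (PRel (rarr (wkT 2 a) (wkT 2 b) (TVar 1) (TVar 0)
                      (wkr 2 4 1 h) (RVar 0))
                (Var 1) (Var 0))
          (PRel (RVar 0) (App (Var 1) (Var 3)) (App (Var 0) (Var 2))))))))).

Definition rtens (a b a' b' : ty) (h h' : lrel) : lrel :=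
  RAbs (TTens a a') (TTens b b')
    (PAllTy (PAllTy (PAllRel true (TVar 1) (TVar 0)
      (PAllTm (TLolli (wkT 2 a) (TLolli (wkT 2 a') (TVar 1)))
      (PAllTm (TLolli (wkT 2 b) (TLolli (wkT 2 b') (TVar 0)))
        (PImp
          (PRel (rlolli (wkT 2 a) (wkT 2 b)
                        (TLolli (wkT 2 a') (TVar 1)) (TLolli (wkT 2 b') (TVar 0))
                        (wkr 2 4 1 h)
                        (rlolli (wkT 2 a') (wkT 2 b') (TVar 1) (TVar 0)
                                (wkr 2 4 1 h') (RVar 0)))
                (Var 1) (Var 0))
          (PRel (RVar 0)
                (LetT (Var 3) (App (App (Var 3) (Var 1)) (Var 0)))
                (LetT (Var 2) (App (App (Var 2) (Var 1)) (Var 0)))))))))).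

Definition runit : lrel :=
  RAbs TUnit TUnit
    (PAllTy (PAllTy (PAllRel true (TVar 1) (TVar 0)
      (PAllTm (TVar 1) (PAllTm (TVar 0)
        (PImp (PRel (RVar 0) (Var 1) (Var 0))
              (PRel (RVar 0) (LetS (Var 3) (Var 1)) (LetS (Var 2) (Var 0))))))))).

(* [TPi a] and [TPi b] are the types related; [h] lives under the type variables
   beta (1) and beta' (0) and the relation variable R : AdmRel(beta, beta'). *)
Definition rpi (a b : ty) (h : lrel) : lrel :=
  RAbs (TPi a) (TPi b)
    (PAllTy (PAllTy (PAllRel true (TVar 1) (TVar 0)
      (PRel (wkr 0 2 0 h) (TApp (Var 1) (TVar 1)) (TApp (Var 0) (TVar 0)))))).

(* A logical context Xi | Gamma | Theta; the variables of Gamma are all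
   intuitionistic. *)
Record relsort : Type := RelSort { radm : bool; rdom : ty; rcod : ty }.

Definition tctx := seq ty.
Definition rctx := seq relsort.

Definition ictx (G : tctx) : ctx := [seq (Int, a) | a <- G].

Definition tctx_wkT (G : tctx) : tctx := map (wkT 1) G.
Definition rctx_wkT (Th : rctx) : rctx :=
  [seq RelSort (radm e) (wkT 1 (rdom e)) (wkT 1 (rcod e)) | e <- Th].

Definition wf_relsort (Xi : nat) (e : relsort) : bool :=
  wf_ty Xi (rdom e) && wf_ty Xi (rcod e).

Definition tsub_of (ts : seq ty) : nat -> ty := nth TUnit ts.

(* [is_prop Xi G Th p], [is_rel Xi G Th h a b] and [is_adm Xi G Th h a b] are
   the judgements p : Prop, h : Rel(a, b) and h : AdmRel(a, b).
   AdmRel is generated by the rules below; in particular it is not closed under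
   provable equivalence of relations, which gives the smaller logic.
   In [adm_graph] and [adm_reindex] the terms depend linearly on their variable
   0 and intuitionistically on the context. *)
Inductive is_prop : nat -> tctx -> rctx -> lprop -> Prop :=
| ip_eq Xi G Th a t u :
    typed Xi (ictx G) t a -> typed Xi (ictx G) u a ->
    is_prop Xi G Th (PEq a t u)
| ip_rel Xi G Th h a b t u : is_rel Xi G Th h a b ->
    typed Xi (ictx G) t a -> typed Xi (ictx G) u b ->
    is_prop Xi G Th (PRel h t u)
| ip_top Xi G Th : is_prop Xi G Th PTop
| ip_bot Xi G Th : is_prop Xi G Th PBot
| ip_and Xi G Th p q :
    is_prop Xi G Th p -> is_prop Xi G Th q -> is_prop Xi G Th (PAnd p q)
| ip_or Xi G Th p q :
    is_prop Xi G Th p -> is_prop Xi G Th q -> is_prop Xi G Th (POr p q)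
| ip_imp Xi G Th p q :
    is_prop Xi G Th p -> is_prop Xi G Th q -> is_prop Xi G Th (PImp p q)
| ip_allTy Xi G Th p :
    is_prop Xi.+1 (tctx_wkT G) (rctx_wkT Th) p -> is_prop Xi G Th (PAllTy p)
| ip_exTy Xi G Th p :
    is_prop Xi.+1 (tctx_wkT G) (rctx_wkT Th) p -> is_prop Xi G Th (PExTy p)
| ip_allTm Xi G Th a p : wf_ty Xi a ->
    is_prop Xi (a :: G) Th p -> is_prop Xi G Th (PAllTm a p)
| ip_exTm Xi G Th a p : wf_ty Xi a ->
    is_prop Xi (a :: G) Th p -> is_prop Xi G Th (PExTm a p)
| ip_allRel Xi G Th b a a' p : wf_ty Xi a -> wf_ty Xi a' ->
    is_prop Xi G (RelSort b a a' :: Th) p -> is_prop Xi G Th (PAllRel b a a' p)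
| ip_exRel Xi G Th b a a' p : wf_ty Xi a -> wf_ty Xi a' ->
    is_prop Xi G (RelSort b a a' :: Th) p -> is_prop Xi G Th (PExRel b a a' p)

with is_rel : nat -> tctx -> rctx -> lrel -> ty -> ty -> Prop :=
| ir_var Xi G Th i a a' : onth Th i = Some (RelSort false a a') ->
    is_rel Xi G Th (RVar i) a a'
| ir_abs Xi G Th a b p : wf_ty Xi a -> wf_ty Xi b ->
    is_prop Xi (b :: a :: G) Th p -> is_rel Xi G Th (RAbs a b p) a b
| ir_adm Xi G Th h a b : is_adm Xi G Th h a b -> is_rel Xi G Th h a b

with is_adm : nat -> tctx -> rctx -> lrel -> ty -> ty -> Prop :=
| adm_var Xi G Th i a a' : onth Th i = Some (RelSort true a a') ->
    is_adm Xi G Th (RVar i) a a'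
| adm_eq Xi G Th a : wf_ty Xi a -> is_adm Xi G Th (req a) a a
| adm_graph Xi G Th a b t : wf_ty Xi a -> wf_ty Xi b ->
    typed Xi ((Lin, a) :: ictx G) t b ->
    is_adm Xi G Th (RAbs a b (PEq b (wkt 0 1 t) (Var 0))) a b
| adm_reindex Xi G Th h a b a' b' t u : wf_ty Xi a' -> wf_ty Xi b' ->
    is_adm Xi G Th h a b ->
    typed Xi ((Lin, a') :: ictx G) t a ->
    typed Xi ((Lin, b') :: ictx G) u b ->
    is_adm Xi G Th
      (RAbs a' b' (PRel (wkr 0 2 0 h) (wkt 0 1 t) (tm_ren id (upr succn) u)))
      a' b'
| adm_and Xi G Th h k a b :
    is_adm Xi G Th h a b -> is_adm Xi G Th k a b ->
    is_adm Xi G Th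
      (RAbs a b (PAnd (PRel (wkr 0 2 0 h) (Var 1) (Var 0))
                      (PRel (wkr 0 2 0 k) (Var 1) (Var 0)))) a b
| adm_imp Xi G Th p h a b :
    is_prop Xi G Th p -> is_adm Xi G Th h a b ->
    is_adm Xi G Th
      (RAbs a b (PImp (wkp 0 2 0 p) (PRel (wkr 0 2 0 h) (Var 1) (Var 0)))) a b
| adm_allTy Xi G Th h a b : wf_ty Xi a -> wf_ty Xi b ->
    is_adm Xi.+1 (tctx_wkT G) (rctx_wkT Th) h (wkT 1 a) (wkT 1 b) ->
    is_adm Xi G Th
      (RAbs a b (PAllTy (PRel (wkr 0 2 0 h) (Var 1) (Var 0)))) a b
| adm_allTm Xi G Th c h a b : wf_ty Xi c ->
    is_adm Xi (c :: G) Th h a b ->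
    is_adm Xi G Th
      (RAbs a b (PAllTm c (PRel (rl_ren id (upr (addn 2)) id h)
                                (Var 2) (Var 1)))) a b
| adm_allRel Xi G Th s c c' h a b : wf_ty Xi c -> wf_ty Xi c' ->
    is_adm Xi G (RelSort s c c' :: Th) h a b ->
    is_adm Xi G Th
      (RAbs a b (PAllRel s c c' (PRel (wkr 0 2 0 h) (Var 1) (Var 0)))) a b
| adm_ty Xi G Th a hs ts us : wf_ty (size hs) a ->
    are_adm Xi G Th hs ts us ->
    is_adm Xi G Th (RTy a hs) (ty_sub (tsub_of ts) a) (ty_sub (tsub_of us) a)

with are_adm : nat -> tctx -> rctx -> seq lrel -> seq ty -> seq ty -> Prop :=
| aa_nil Xi G Th : are_adm Xi G Th [::] [::] [::]
| aa_cons Xi G Th h hs a ts b us :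
    is_adm Xi G Th h a b -> are_adm Xi G Th hs ts us ->
    are_adm Xi G Th (h :: hs) (a :: ts) (b :: us).

(* The right-hand side of the clause defining a[hs], where the [i]-th relation
   of [hs] is between the [i]-th types of [ts] and of [us]. *)
Definition ty_clause (a : ty) (hs : seq lrel) (ts us : seq ty) : lrel :=
  let T := ty_sub (tsub_of ts) in
  let U := ty_sub (tsub_of us) in
  match a with
  | TVar i => nth (RVar 0) hs i
  | TUnit => runit
  | TTens a b => rtens (T a) (U a) (T b) (U b) (RTy a hs) (RTy b hs)
  | TLolli a b => rlolli (T a) (U a) (T b) (U b) (RTy a hs) (RTy b hs)
  | TBang a => rbang (T a) (U a) (RTy a hs)
  | TPi a => rpi (ty_sub (upT (tsub_of ts)) a) (ty_sub (upT (tsub_of us)) a)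
                 (RTy a (RVar 0 :: map (wkr 2 0 1) hs))
  end.

Definition theory := nat -> tctx -> rctx -> lprop -> Prop.

(* [derives Ax Xi G Th Phi p]: p is derivable from the hypotheses Phi in the
   context Xi | G | Th, using the propositions in [Ax] as axioms. *)
Inductive derives (Ax : theory)
  : nat -> tctx -> rctx -> seq lprop -> lprop -> Prop :=
| d_theory Xi G Th Phi p : Ax Xi G Th p -> derives Ax Xi G Th Phi p
| d_hyp Xi G Th Phi i p : onth Phi i = Some p -> derives Ax Xi G Th Phi p
| d_topI Xi G Th Phi : derives Ax Xi G Th Phi PTop
| d_botE Xi G Th Phi p : is_prop Xi G Th p ->
    derives Ax Xi G Th Phi PBot -> derives Ax Xi G Th Phi p
| d_andI Xi G Th Phi p q :
    derives Ax Xi G Th Phi p -> derives Ax Xi G Th Phi q ->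
    derives Ax Xi G Th Phi (PAnd p q)
| d_andE1 Xi G Th Phi p q :
    derives Ax Xi G Th Phi (PAnd p q) -> derives Ax Xi G Th Phi p
| d_andE2 Xi G Th Phi p q :
    derives Ax Xi G Th Phi (PAnd p q) -> derives Ax Xi G Th Phi q
| d_orI1 Xi G Th Phi p q : is_prop Xi G Th q ->
    derives Ax Xi G Th Phi p -> derives Ax Xi G Th Phi (POr p q)
| d_orI2 Xi G Th Phi p q : is_prop Xi G Th p ->
    derives Ax Xi G Th Phi q -> derives Ax Xi G Th Phi (POr p q)
| d_orE Xi G Th Phi p q c : derives Ax Xi G Th Phi (POr p q) ->
    derives Ax Xi G Th (p :: Phi) c -> derives Ax Xi G Th (q :: Phi) c ->
    derives Ax Xi G Th Phi c
| d_impI Xi G Th Phi p q : is_prop Xi G Th p ->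
    derives Ax Xi G Th (p :: Phi) q -> derives Ax Xi G Th Phi (PImp p q)
| d_impE Xi G Th Phi p q :
    derives Ax Xi G Th Phi (PImp p q) -> derives Ax Xi G Th Phi p ->
    derives Ax Xi G Th Phi q
| d_allTyI Xi G Th Phi p :
    derives Ax Xi.+1 (tctx_wkT G) (rctx_wkT Th) (map (wkp 1 0 0) Phi) p ->
    derives Ax Xi G Th Phi (PAllTy p)
| d_allTyE Xi G Th Phi p a : wf_ty Xi a ->
    derives Ax Xi G Th Phi (PAllTy p) -> derives Ax Xi G Th Phi (pinst_ty p a)
| d_exTyI Xi G Th Phi p a : wf_ty Xi a ->
    is_prop Xi G Th (PExTy p) ->
    derives Ax Xi G Th Phi (pinst_ty p a) -> derives Ax Xi G Th Phi (PExTy p)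
| d_exTyE Xi G Th Phi p c : is_prop Xi G Th c ->
    derives Ax Xi G Th Phi (PExTy p) ->
    derives Ax Xi.+1 (tctx_wkT G) (rctx_wkT Th)
      (p :: map (wkp 1 0 0) Phi) (wkp 1 0 0 c) ->
    derives Ax Xi G Th Phi c
| d_allTmI Xi G Th Phi a p : wf_ty Xi a ->
    derives Ax Xi (a :: G) Th (map (wkp 0 1 0) Phi) p ->
    derives Ax Xi G Th Phi (PAllTm a p)
| d_allTmE Xi G Th Phi a p t : typed Xi (ictx G) t a ->
    derives Ax Xi G Th Phi (PAllTm a p) -> derives Ax Xi G Th Phi (pinst_tm p t)
| d_exTmI Xi G Th Phi a p t : typed Xi (ictx G) t a ->
    is_prop Xi G Th (PExTm a p) ->
    derives Ax Xi G Th Phi (pinst_tm p t) -> derives Ax Xi G Th Phi (PExTm a p)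
| d_exTmE Xi G Th Phi a p c : is_prop Xi G Th c ->
    derives Ax Xi G Th Phi (PExTm a p) ->
    derives Ax Xi (a :: G) Th (p :: map (wkp 0 1 0) Phi) (wkp 0 1 0 c) ->
    derives Ax Xi G Th Phi c
| d_allRelI Xi G Th Phi b a a' p : wf_ty Xi a -> wf_ty Xi a' ->
    derives Ax Xi G (RelSort b a a' :: Th) (map (wkp 0 0 1) Phi) p ->
    derives Ax Xi G Th Phi (PAllRel b a a' p)
| d_allRelE Xi G Th Phi b a a' p h :
    (if b then is_adm Xi G Th h a a' else is_rel Xi G Th h a a') ->
    derives Ax Xi G Th Phi (PAllRel b a a' p) ->
    derives Ax Xi G Th Phi (pinst_rel p h)
| d_exRelI Xi G Th Phi b a a' p h :
    (if b then is_adm Xi G Th h a a' else is_rel Xi G Th h a a') ->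
    is_prop Xi G Th (PExRel b a a' p) ->
    derives Ax Xi G Th Phi (pinst_rel p h) ->
    derives Ax Xi G Th Phi (PExRel b a a' p)
| d_exRelE Xi G Th Phi b a a' p c : is_prop Xi G Th c ->
    derives Ax Xi G Th Phi (PExRel b a a' p) ->
    derives Ax Xi G (RelSort b a a' :: Th)
      (p :: map (wkp 0 0 1) Phi) (wkp 0 0 1 c) ->
    derives Ax Xi G Th Phi c
| d_exteq Xi G Th Phi a t u : exteq Xi (ictx G) t u a ->
    derives Ax Xi G Th Phi (PEq a t u)
| d_leibniz Xi G Th Phi a p t u : is_prop Xi (a :: G) Th p ->
    derives Ax Xi G Th Phi (PEq a t u) ->
    derives Ax Xi G Th Phi (pinst_tm p t) ->
    derives Ax Xi G Th Phi (pinst_tm p u)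
| d_relbeta Xi G Th Phi a b p t u : is_rel Xi G Th (RAbs a b p) a b ->
    typed Xi (ictx G) t a -> typed Xi (ictx G) u b ->
    derives Ax Xi G Th Phi (PIff (PRel (RAbs a b p) t u) (pinst2 p t u))
| d_clause Xi G Th Phi a hs ts us : wf_ty (size hs) a ->
    are_adm Xi G Th hs ts us ->
    derives Ax Xi G Th Phi
      (requiv (ty_sub (tsub_of ts) a) (ty_sub (tsub_of us) a)
              (RTy a hs) (ty_clause a hs ts us)).

Inductive extensionality : theory :=
| ext_lolli Xi G Th a b t u :
    typed Xi (ictx G) t (TLolli a b) -> typed Xi (ictx G) u (TLolli a b) ->
    extensionality Xi G Th
      (PImp (PAllTm a (PEq b (App (wkt 0 1 t) (Var 0)) (App (wkt 0 1 u) (Var 0))))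
            (PEq (TLolli a b) t u))
| ext_pi Xi G Th a t u :
    typed Xi (ictx G) t (TPi a) -> typed Xi (ictx G) u (TPi a) ->
    extensionality Xi G Th
      (PImp (PAllTy (PEq a (TApp (wkt 1 0 t) (TVar 0)) (TApp (wkt 1 0 u) (TVar 0))))
            (PEq (TPi a) t u)).

(* forall alpha_1 ... alpha_n, a[eq_alpha] == eq_a, for [a] in [n] variables. *)
Inductive identity_extension : theory :=
| id_ext Xi G Th n a : wf_ty n a ->
    identity_extension Xi G Th
      (iter n PAllTy
        (requiv a a (RTy a (mkseq (fun i => req (TVar i)) n)) (req a))).

Definition parametricity : theory := fun Xi G Th p =>
  extensionality Xi G Th p \/ identity_extension Xi G Th p.

(* A way of building a type from type variables and closed types; a closed type
   may be used as a leaf or be built itself. *)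
Inductive icty : Type :=
| IVar (i : nat)
| IClosed (c : ty)
| IUnit
| ITens (s1 s2 : icty)
| ILolli (s1 s2 : icty)
| IBang (s1 : icty)
| IPi (s1 : icty).

Fixpoint wf_icty (n : nat) (s : icty) : bool :=
  match s with
  | IVar i => i < n
  | IClosed c => wf_ty 0 c
  | IUnit => true
  | ITens s1 s2 | ILolli s1 s2 => wf_icty n s1 && wf_icty n s2
  | IBang s1 => wf_icty n s1
  | IPi s1 => wf_icty n.+1 s1
  end.

Fixpoint ic_ty (s : icty) : ty :=
  match s with
  | IVar i => TVar i
  | IClosed c => c
  | IUnit => TUnit
  | ITens s1 s2 => TTens (ic_ty s1) (ic_ty s2)
  | ILolli s1 s2 => TLolli (ic_ty s1) (ic_ty s2)
  | IBang s1 => TBang (ic_ty s1)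
  | IPi s1 => TPi (ic_ty s1)
  end.

Definition idtm (a : ty) : tm := Lam a (Var 0).

(* The functorial action, as a term from [ty_sub A (ic_ty s)] to
   [ty_sub B (ic_ty s)], where [F i] is the action of the variable [i]: the given
   map for alpha and the identity for the variables bound by Pi. The terms [F i]
   may be duplicated, so they contain no linear variables. At a negative
   subtype the roles of [A] and [B] are exchanged. *)
Fixpoint ic_map (A B : nat -> ty) (F : nat -> tm) (s : icty) : tm :=
  match s with
  | IVar i => F i
  | IClosed c => idtm c
  | IUnit => idtm TUnit
  | ITens s1 s2 =>
      Lam (ty_sub A (ic_ty s))
        (LetT (Var 0) (Tens (App (wkt 0 3 (ic_map A B F s1)) (Var 1))
                            (App (wkt 0 3 (ic_map A B F s2)) (Var 0))))
  | ILolli s1 s2 =>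
      Lam (ty_sub A (ic_ty s)) (Lam (ty_sub B (ic_ty s1))
        (App (wkt 0 2 (ic_map A B F s2))
             (App (Var 1) (App (wkt 0 2 (ic_map B A F s1)) (Var 0)))))
  | IBang s1 =>
      Lam (ty_sub A (ic_ty s))
        (LetB (Var 0) (Bang (App (wkt 0 2 (ic_map A B F s1)) (Var 0))))
  | IPi s1 =>
      Lam (ty_sub A (ic_ty s))
        (TLam (App (wkt 0 1 (ic_map (upT A) (upT B)
                      (scons (idtm (TVar 0)) (fun i => wkt 1 0 (F i))) s1))
                   (TApp (Var 0) (TVar 0))))
  end.

(* s[R] for arbitrary relations [R i] between the types [A i] and [B i]. *)
Fixpoint ic_rel (A B : nat -> ty) (R : nat -> lrel) (s : icty) : lrel :=
  match s with
  | IVar i => R i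
  | IClosed c => req c
  | IUnit => runit
  | ITens s1 s2 =>
      rtens (ty_sub A (ic_ty s1)) (ty_sub B (ic_ty s1))
            (ty_sub A (ic_ty s2)) (ty_sub B (ic_ty s2))
            (ic_rel A B R s1) (ic_rel A B R s2)
  | ILolli s1 s2 =>
      rlolli (ty_sub A (ic_ty s1)) (ty_sub B (ic_ty s1))
             (ty_sub A (ic_ty s2)) (ty_sub B (ic_ty s2))
             (ic_rel A B R s1) (ic_rel A B R s2)
  | IBang s1 =>
      rbang (ty_sub A (ic_ty s1)) (ty_sub B (ic_ty s1)) (ic_rel A B R s1)
  | IPi s1 =>
      rpi (ty_sub (upT A) (ic_ty s1)) (ty_sub (upT B) (ic_ty s1))
          (ic_rel (scons (TVar 1) (fun i => wkT 2 (A i)))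
                  (scons (TVar 0) (fun i => wkT 2 (B i)))
                  (scons (RVar 0) (fun i => wkr 2 0 1 (R i))) s1)
  end.

(* The case of one variable alpha, which is 0: s(a), s(f) for f : a -o b, and
   s[h] for a relation h between a and b. *)
Definition ic_app (s : icty) (a : ty) : ty := tinst (ic_ty s) a.
Definition ic_map1 (s : icty) (a b : ty) (f : tm) : tm :=
  ic_map (scons a TVar) (scons b TVar) (scons f Var) s.
Definition ic_rel1 (s : icty) (a b : ty) (h : lrel) : lrel :=
  ic_rel (scons a TVar) (scons b TVar) (scons h RVar) s.

Definition coalg (s : icty) (a : ty) : ty :=
  TTens (TBang (TLolli a (ic_app s a))) a.

Definition nu (s : icty) : ty :=
  TPi (TLolli (TPi (TLolli (coalg s (TVar 0)) (TVar 1))) (TVar 0)).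

Definition pack (s : icty) : tm :=
  TLam (Lam (coalg s (TVar 0))
    (TLam (Lam (TPi (TLolli (coalg s (TVar 0)) (TVar 1)))
      (App (TApp (Var 0) (TVar 1)) (Var 1))))).

Definition unfold (s : icty) : tm :=
  TLam (Lam (TBang (TLolli (TVar 0) (ic_app s (TVar 0)))) (Lam (TVar 0)
    (App (TApp (pack s) (TVar 0)) (Tens (Var 1) (Var 0))))).

(* The informal body  s(unfold alpha w)(let !f = w in f z)  uses the linear
   variable w : !(alpha -o s(alpha)) twice (or more, depending on s), so it is
   typable only once w is duplicated: w is opened by  let !f = w in -  and its
   occurrences become !f, giving  let !f = w in s(unfold alpha !f)(f z). *)
Definition out_arg (s : icty) : tm :=
  TLam (Lam (coalg s (TVar 0))
    (LetT (Var 0)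
      (LetB (Var 1)
        (App (ic_map1 s (TVar 0) (nu s)
                (App (TApp (unfold s) (TVar 0)) (Bang (Var 0))))
             (App (Var 0) (Var 1)))))).

Definition out (s : icty) : tm :=
  Lam (nu s) (App (TApp (Var 0) (ic_app s (nu s))) (out_arg s)).

(* Main.v *)
(* Derivability of a proposition is replaced by derivability under every renaming
   into a larger context, which makes the connectives and relational constructions
   of the logic behave as in a Kripke semantics, with weakening for free.

   By induction on an inductively constructed type, its functorial action is
   parametric with respect to arbitrary, not only admissible, relations, and by
   extensionality it preserves identities; with identity extension, [x] and
   [sigma(h) x] are therefore related by [sigma] of the graph of [h].  Every
   coalgebra [f] is mapped to [out] by its unfolding; parametricity with graphs of
   unfoldings, and naturality of elements of [nu], show that the unfolding of [out]
   is the identity, that is, [z = pack (out, z)].  If [S] is an admissible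
   bisimulation, [S(x, y)] makes [(out, x)] and [(out, y)] related, so parametricity
   of [pack] gives [x = y].

   An arbitrary bisimulation [R] is contained in its admissible closure [P], the
   intersection of the admissible relations containing it.  The reindexing of
   [sigma[P]] along [out] is admissible and, by monotonicity of [sigma[-]], contains
   [R]; hence it contains [P], so [P] is an admissible bisimulation. *)

Require Import Defs.
From mathcomp Require Import all_boot.
From Stdlib Require Import FunctionalExtensionality.

Set Implicit Arguments.
Unset Strict Implicit.
Unset Printing Implicit Defensive.

(** * Substitution *)

(** Elements of [nu] can be tested only at relations accepted by the syntactic rules for AdmRel,
    while the functor acts on the structural interpretation [ic_rel], whose clauses are in general
    not of the shapes that these rules generate. The gap is bridged by [RTy]: it is admissible by
    rule and provably equivalent to [ic_rel], closed leaves included. Arbitrary relations are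
    harmless in the parametricity of the functorial action because the clauses for ! and for the
    tensor test their elements against admissible relations: only the test relation has to be
    admissible, never the relations being lifted. The equation for the unfolding of [out] can be
    computed only on canonical elements [!f] and [w (x) x] of a coalgebra type, and an arbitrary
    element is not given in that form. The passage to all elements uses eta and a commuting
    conversion at the tensor, but identity extension at !. Splitting linear contexts interacts badly
    with substitution; the variables of the logic are all intuitionistic, so typing is replaced by
    simple typing plus counts of the bound linear variables. *)

Lemma upr_comp r r' : upr r' \o upr r = upr (r' \o r).
Proof. by apply: functional_extensionality; case. Qed.

Lemma ty_ren_ren r r' a : ty_ren r' (ty_ren r a) = ty_ren (r' \o r) a.
Proof.
elim: a r r' => //= [a IHa b IHb|a IHa b IHb|a IHa|a IHa] r r'.
- by rewrite IHa IHb.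
- by rewrite IHa IHb.
- by rewrite IHa.
by rewrite IHa upr_comp.
Qed.

Lemma ty_sub_ren r s a : ty_sub s (ty_ren r a) = ty_sub (s \o r) a.
Proof.
elim: a r s => //= [a IHa b IHb|a IHa b IHb|a IHa|a IHa] r s.
- by rewrite IHa IHb.
- by rewrite IHa IHb.
- by rewrite IHa.
by rewrite IHa; congr (TPi (ty_sub _ _)); apply: functional_extensionality; case.
Qed.

Lemma ty_ren_sub r s a : ty_ren r (ty_sub s a) = ty_sub (ty_ren r \o s) a.
Proof.
elim: a r s => //= [a IHa b IHb|a IHa b IHb|a IHa|a IHa] r s.
- by rewrite IHa IHb.
- by rewrite IHa IHb.
- by rewrite IHa.
rewrite IHa; congr (TPi (ty_sub _ _)); apply: functional_extensionality.
by case=> //= i; rewrite !ty_ren_ren.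
Qed.

Lemma upT_comp s s' : ty_sub (upT s') \o upT s = upT (ty_sub s' \o s).
Proof.
apply: functional_extensionality; case=> //= i.
by rewrite ty_sub_ren ty_ren_sub.
Qed.

Lemma ty_sub_sub s s' a : ty_sub s' (ty_sub s a) = ty_sub (ty_sub s' \o s) a.
Proof.
elim: a s s' => //= [a IHa b IHb|a IHa b IHb|a IHa|a IHa] s s'.
- by rewrite IHa IHb.
- by rewrite IHa IHb.
- by rewrite IHa.
by rewrite IHa upT_comp.
Qed.

Lemma ty_renE r a : ty_ren r a = ty_sub (TVar \o r) a.
Proof.
elim: a r => //= [a IHa b IHb|a IHa b IHb|a IHa|a IHa] r.
- by rewrite IHa IHb.
- by rewrite IHa IHb.
- by rewrite IHa.
by rewrite IHa; congr (TPi (ty_sub _ _)); apply: functional_extensionality; case.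
Qed.

Lemma upT_TVar : upT TVar = TVar.
Proof. by apply: functional_extensionality; case. Qed.

Lemma ty_sub_id a : ty_sub TVar a = a.
Proof.
by elim: a => //= [a -> b ->|a -> b ->|a ->|a IH] //; rewrite upT_TVar IH.
Qed.

Lemma tm_ren_ren rt r rt' r' t :
  tm_ren rt' r' (tm_ren rt r t) = tm_ren (rt' \o rt) (r' \o r) t.
Proof.
elim: t rt r rt' r' => //= [a t IH|t IHt u IHu|t IHt u IHu|t IH|t IH|t IH a|
  t IHt u IHu|t IHt u IHu|t IHt u IHu] rt r rt' r';
  by rewrite ?IH ?IHt ?IHu ?ty_ren_ren ?upr_comp.
Qed.

Lemma tm_sub_ren rt r st s t :
  tm_sub st s (tm_ren rt r t) = tm_sub (st \o rt) (s \o r) t.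
Proof.
have uptE s' r' : upt s' \o upr r' = upt (s' \o r').
  by apply: functional_extensionality; case.
have upTE s' r' : upT s' \o upr r' = upT (s' \o r').
  by apply: functional_extensionality; case.
elim: t rt r st s => //= [a t IH|t IHt u IHu|t IHt u IHu|t IH|t IH|t IH a|
  t IHt u IHu|t IHt u IHu|t IHt u IHu] rt r st s;
  by rewrite ?IH ?IHt ?IHu ?ty_sub_ren ?uptE ?upTE.
Qed.

Lemma wkt_upr n rt r t :
  tm_ren rt (upr r) (wkt n 1 t) = wkt 0 1 (tm_ren (rt \o addn n) r t).
Proof.
rewrite /wkt !tm_ren_ren; congr tm_ren; apply: functional_extensionality => i //=.
Qed.

Lemma wkt_uprT rt r t :
  tm_ren (upr rt) r (wkt 1 0 t) = wkt 1 0 (tm_ren rt r t).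
Proof.
rewrite /wkt !tm_ren_ren; congr tm_ren; apply: functional_extensionality => i //=.
Qed.

Lemma tm_ren_sub rt r st s t :
  tm_ren rt r (tm_sub st s t) = tm_sub (ty_ren rt \o st) (tm_ren rt r \o s) t.
Proof.
have uptE rt' r' s' : tm_ren rt' (upr r') \o upt s' = upt (tm_ren rt' r' \o s').
  by apply: functional_extensionality; case=> //= i; rewrite wkt_upr.
have upTE r' s' : ty_ren (upr r') \o upT s' = upT (ty_ren r' \o s').
  by apply: functional_extensionality; case=> //= i; rewrite !ty_ren_ren.
elim: t rt r st s => //= [a t IH|t IHt u IHu|t IHt u IHu|t IH|t IH|t IH a|
  t IHt u IHu|t IHt u IHu|t IHt u IHu] rt r st s;
  rewrite ?IH ?IHt ?IHu ?ty_ren_sub ?uptE ?upTE //.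
by congr (TLam (tm_sub _ _ _)); apply: functional_extensionality=> i /=;
  rewrite wkt_uprT.
Qed.

Lemma wkt_sub0 st s t : tm_sub st (upt s) (wkt 0 1 t) = wkt 0 1 (tm_sub st s t).
Proof.
rewrite /wkt tm_sub_ren tm_ren_sub; congr tm_sub;
  apply: functional_extensionality => i //=.
by rewrite -/(wkT 0 (st i)) /wkT ty_renE -[LHS]ty_sub_id; congr ty_sub.
Qed.

Lemma wkt_subT st s t :
  tm_sub (upT st) (fun i => wkt 1 0 (s i)) (wkt 1 0 t) = wkt 1 0 (tm_sub st s t).
Proof. by rewrite /wkt tm_sub_ren tm_ren_sub; congr tm_sub. Qed.

Lemma upt_comp st s s' : tm_sub st (upt s') \o upt s = upt (tm_sub st s' \o s).
Proof. by apply: functional_extensionality; case=> //= i; rewrite wkt_sub0. Qed.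

Lemma tm_sub_sub st s st' s' t :
  tm_sub st' s' (tm_sub st s t) = tm_sub (ty_sub st' \o st) (tm_sub st' s' \o s) t.
Proof.
elim: t st s st' s' => //= [a t IH|t IHt u IHu|t IHt u IHu|t IH|t IH|t IH a|
  t IHt u IHu|t IHt u IHu|t IHt u IHu] st s st' s';
  rewrite ?IH ?IHt ?IHu ?ty_sub_sub ?upt_comp ?upT_comp //.
by congr (TLam (tm_sub _ _ _)); apply: functional_extensionality=> i /=;
  rewrite wkt_subT.
Qed.

Lemma tm_renE rt r t : tm_ren rt r t = tm_sub (TVar \o rt) (Var \o r) t.
Proof.
have uptE r' : upt (Var \o r') = Var \o upr r'.
  by apply: functional_extensionality; case.
have upTE r' : upT (TVar \o r') = TVar \o upr r'.
  by apply: functional_extensionality; case.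
elim: t rt r => //= [a t IH|t IHt u IHu|t IHt u IHu|t IH|t IH|t IH a|
  t IHt u IHu|t IHt u IHu|t IHt u IHu] rt r;
  by rewrite ?IH ?IHt ?IHu ?ty_renE ?uptE ?upTE.
Qed.

Lemma upt_Var : upt Var = Var.
Proof. by apply: functional_extensionality; case. Qed.

Lemma tm_sub_id t : tm_sub TVar Var t = t.
Proof.
elim: t => //= [a t IH|t IHt u IHu|t IHt u IHu|t IH|t IH|t IH a|
  t IHt u IHu|t IHt u IHu|t IHt u IHu];
  rewrite ?ty_sub_id ?upt_Var ?upT_TVar ?IH ?IHt ?IHu //.
Qed.

(** * Substitution in propositions and relations *)

Section LogicInduction.

Variables (P : lprop -> Prop) (Q : lrel -> Prop).

(** The generated induction schemes give no hypothesis for the list nested in [RTy]; this predicate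
    carries the one needed for each of its relations. *)
Fixpoint allQ (hs : seq lrel) : Prop :=
  if hs is h :: hs' then Q h /\ allQ hs' else True.

Hypotheses (PEqP : forall a t u, P (PEq a t u))
  (PRelP : forall h t u, Q h -> P (PRel h t u))
  (PTopP : P PTop) (PBotP : P PBot)
  (PAndP : forall p q, P p -> P q -> P (PAnd p q))
  (POrP : forall p q, P p -> P q -> P (POr p q))
  (PImpP : forall p q, P p -> P q -> P (PImp p q))
  (PAllTyP : forall p, P p -> P (PAllTy p))
  (PExTyP : forall p, P p -> P (PExTy p))
  (PAllTmP : forall a p, P p -> P (PAllTm a p))
  (PExTmP : forall a p, P p -> P (PExTm a p))
  (PAllRelP : forall b a a' p, P p -> P (PAllRel b a a' p))
  (PExRelP : forall b a a' p, P p -> P (PExRel b a a' p))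
  (RVarP : forall i, Q (RVar i))
  (RAbsP : forall a b p, P p -> Q (RAbs a b p))
  (RTyP : forall a hs, allQ hs -> Q (RTy a hs)).

Fixpoint lprop_rect2 (p : lprop) : P p :=
  match p with
  | PEq a t u => PEqP a t u
  | PRel h t u => PRelP t u (lrel_rect2 h)
  | PTop => PTopP
  | PBot => PBotP
  | PAnd p q => PAndP (lprop_rect2 p) (lprop_rect2 q)
  | POr p q => POrP (lprop_rect2 p) (lprop_rect2 q)
  | PImp p q => PImpP (lprop_rect2 p) (lprop_rect2 q)
  | PAllTy p => PAllTyP (lprop_rect2 p)
  | PExTy p => PExTyP (lprop_rect2 p)
  | PAllTm a p => PAllTmP a (lprop_rect2 p)
  | PExTm a p => PExTmP a (lprop_rect2 p)
  | PAllRel b a a' p => PAllRelP b a a' (lprop_rect2 p)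
  | PExRel b a a' p => PExRelP b a a' (lprop_rect2 p)
  end
with lrel_rect2 (h : lrel) : Q h :=
  match h with
  | RVar i => RVarP i
  | RAbs a b p => RAbsP a b (lprop_rect2 p)
  | RTy a hs => RTyP a
      ((fix go (hs : seq lrel) : allQ hs :=
         if hs is h :: hs' then conj (lrel_rect2 h) (go hs') else I) hs)
  end.

Lemma lprop_lrel_ind : (forall p, P p) /\ (forall h, Q h).
Proof. by split; [exact: lprop_rect2 | exact: lrel_rect2]. Qed.

End LogicInduction.

Lemma map_allQ (Q : lrel -> Prop) (f g : lrel -> lrel) hs :
  (forall h, Q h -> f h = g h) -> allQ Q hs -> map f hs = map g hs.
Proof. by move=> fg; elim: hs => //= h hs IH [/fg -> /IH ->]. Qed.

Lemma pr_rl_ren_ren :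
  (forall p rt r rr rt' r' rr', pr_ren rt' r' rr' (pr_ren rt r rr p)
     = pr_ren (rt' \o rt) (r' \o r) (rr' \o rr) p) /\
  (forall h rt r rr rt' r' rr', rl_ren rt' r' rr' (rl_ren rt r rr h)
     = rl_ren (rt' \o rt) (r' \o r) (rr' \o rr) h).
Proof.
apply: lprop_lrel_ind => //=; intros; rewrite ?ty_ren_ren ?tm_ren_ren;
  rewrite ?H ?H0 ?upr_comp //.
congr RTy; rewrite -map_comp; apply: map_allQ H => h Qh /=; exact: Qh.
Qed.

Lemma pr_ren_ren rt r rr rt' r' rr' p : pr_ren rt' r' rr' (pr_ren rt r rr p)
  = pr_ren (rt' \o rt) (r' \o r) (rr' \o rr) p.
Proof. exact: pr_rl_ren_ren.1. Qed.

Lemma rl_ren_ren rt r rr rt' r' rr' h : rl_ren rt' r' rr' (rl_ren rt r rr h)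
  = rl_ren (rt' \o rt) (r' \o r) (rr' \o rr) h.
Proof. exact: pr_rl_ren_ren.2. Qed.

Lemma upt_upr s r : upt s \o upr r = upt (s \o r).
Proof. by apply: functional_extensionality; case. Qed.

Lemma upT_upr s r : upT s \o upr r = upT (s \o r).
Proof. by apply: functional_extensionality; case. Qed.

Lemma upR_upr s r : upR s \o upr r = upR (s \o r).
Proof. by apply: functional_extensionality; case. Qed.

Lemma pr_rl_sub_ren :
  (forall p rt r rr st s sr, pr_sub st s sr (pr_ren rt r rr p)
     = pr_sub (st \o rt) (s \o r) (sr \o rr) p) /\
  (forall h rt r rr st s sr, rl_sub st s sr (rl_ren rt r rr h)
     = rl_sub (st \o rt) (s \o r) (sr \o rr) h).
Proof.
apply: lprop_lrel_ind => //=; intros; rewrite ?ty_sub_ren ?tm_sub_ren;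
  rewrite ?H ?H0 ?upT_upr ?upt_upr ?upR_upr //.
congr RTy; rewrite -map_comp; apply: map_allQ H => h Qh /=; exact: Qh.
Qed.

Lemma rl_sub_ren rt r rr st s sr h : rl_sub st s sr (rl_ren rt r rr h)
  = rl_sub (st \o rt) (s \o r) (sr \o rr) h.
Proof. exact: pr_rl_sub_ren.2. Qed.

Lemma upt_ren rt r s : tm_ren rt (upr r) \o upt s = upt (tm_ren rt r \o s).
Proof. by apply: functional_extensionality; case=> //= i; rewrite wkt_upr. Qed.

Lemma upT_ren r s : ty_ren (upr r) \o upT s = upT (ty_ren r \o s).
Proof. by apply: functional_extensionality; case=> //= i; rewrite !ty_ren_ren. Qed.

Lemma pr_rl_ren_sub :
  (forall p rt r rr st s sr, pr_ren rt r rr (pr_sub st s sr p)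
     = pr_sub (ty_ren rt \o st) (tm_ren rt r \o s) (rl_ren rt r rr \o sr) p) /\
  (forall h rt r rr st s sr, rl_ren rt r rr (rl_sub st s sr h)
     = rl_sub (ty_ren rt \o st) (tm_ren rt r \o s) (rl_ren rt r rr \o sr) h).
Proof.
apply: lprop_lrel_ind => //=; intros; rewrite ?ty_ren_sub ?tm_ren_sub;
  rewrite ?H ?H0 ?upT_ren ?upt_ren //.
- by congr (PAllTy (pr_sub _ _ _ _)); apply: functional_extensionality=> i /=;
    rewrite ?wkt_uprT // /wkr !rl_ren_ren.
- by congr (PExTy (pr_sub _ _ _ _)); apply: functional_extensionality=> i /=;
    rewrite ?wkt_uprT // /wkr !rl_ren_ren.
- by congr (PAllTm _ (pr_sub _ _ _ _)); apply: functional_extensionality=> i /=;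
    rewrite /wkr !rl_ren_ren.
- by congr (PExTm _ (pr_sub _ _ _ _)); apply: functional_extensionality=> i /=;
    rewrite /wkr !rl_ren_ren.
- congr (PAllRel _ _ _ (pr_sub _ _ _ _)); apply: functional_extensionality.
  by case=> //= i; rewrite /wkr !rl_ren_ren.
- congr (PExRel _ _ _ (pr_sub _ _ _ _)); apply: functional_extensionality.
  by case=> //= i; rewrite /wkr !rl_ren_ren.
- by congr (RAbs _ _ (pr_sub _ _ _ _)); apply: functional_extensionality=> i /=;
    rewrite /wkr !rl_ren_ren.
congr RTy; rewrite -!map_comp; apply: map_allQ H => h Qh /=; exact: Qh.
Qed.

Lemma rl_ren_sub rt r rr st s sr h : rl_ren rt r rr (rl_sub st s sr h)
  = rl_sub (ty_ren rt \o st) (tm_ren rt r \o s) (rl_ren rt r rr \o sr) h.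
Proof. exact: pr_rl_ren_sub.2. Qed.

Lemma rl_ext st st' s s' sr sr' h : st =1 st' -> s =1 s' -> sr =1 sr' ->
  rl_sub st s sr h = rl_sub st' s' sr' h.
Proof. by do 3 move/(@functional_extensionality _ _ _ _) ->. Qed.

Lemma pr_ext st st' s s' sr sr' p : st =1 st' -> s =1 s' -> sr =1 sr' ->
  pr_sub st s sr p = pr_sub st' s' sr' p.
Proof. by do 3 move/(@functional_extensionality _ _ _ _) ->. Qed.

Lemma tm_ext st st' s s' t : st =1 st' -> s =1 s' -> tm_sub st s t = tm_sub st' s' t.
Proof. by do 2 move/(@functional_extensionality _ _ _ _) ->. Qed.

Lemma ty_ext s s' a : s =1 s' -> ty_sub s a = ty_sub s' a.
Proof. by move/(@functional_extensionality _ _ _ _) ->. Qed.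

Lemma ty_ren0 a : ty_ren (addn 0) a = a.
Proof. by rewrite ty_renE -[RHS]ty_sub_id; apply: ty_ext. Qed.

Lemma pr_rl_sub_sub :
  (forall p st s sr st' s' sr', pr_sub st' s' sr' (pr_sub st s sr p)
     = pr_sub (ty_sub st' \o st) (tm_sub st' s' \o s) (rl_sub st' s' sr' \o sr) p) /\
  (forall h st s sr st' s' sr', rl_sub st' s' sr' (rl_sub st s sr h)
     = rl_sub (ty_sub st' \o st) (tm_sub st' s' \o s) (rl_sub st' s' sr' \o sr) h).
Proof.
apply: lprop_lrel_ind => //=; intros; rewrite ?ty_sub_sub ?tm_sub_sub;
  rewrite ?H ?H0 ?upT_comp ?upt_comp //.
- congr PAllTy; apply: pr_ext => i //=; first by rewrite wkt_subT.
  by rewrite /wkr rl_sub_ren rl_ren_sub; apply: rl_ext.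
- congr PExTy; apply: pr_ext => i //=; first by rewrite wkt_subT.
  by rewrite /wkr rl_sub_ren rl_ren_sub; apply: rl_ext.
- congr PAllTm; apply: pr_ext => i //=.
  by rewrite /wkr rl_sub_ren rl_ren_sub; apply: rl_ext=> j //=; rewrite ty_ren0.
- congr PExTm; apply: pr_ext => i //=.
  by rewrite /wkr rl_sub_ren rl_ren_sub; apply: rl_ext=> j //=; rewrite ty_ren0.
- congr PAllRel; apply: pr_ext => //; case=> //= i.
  rewrite /wkr rl_sub_ren rl_ren_sub; apply: rl_ext=> j //=; first by rewrite ty_ren0.
  by rewrite tm_renE -[LHS]tm_sub_id; apply: tm_ext.
- congr PExRel; apply: pr_ext => //; case=> //= i.
  rewrite /wkr rl_sub_ren rl_ren_sub; apply: rl_ext=> j //=; first by rewrite ty_ren0.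
  by rewrite tm_renE -[LHS]tm_sub_id; apply: tm_ext.
- congr RAbs; apply: pr_ext => i //=.
  rewrite /wkr rl_sub_ren rl_ren_sub; apply: rl_ext=> j //=; first by rewrite ty_ren0.
  by rewrite /wkt tm_ren_ren; congr tm_ren.
congr RTy; rewrite -!map_comp; apply: map_allQ H => h Qh /=; exact: Qh.
Qed.

Lemma pr_sub_sub st s sr st' s' sr' p : pr_sub st' s' sr' (pr_sub st s sr p)
  = pr_sub (ty_sub st' \o st) (tm_sub st' s' \o s) (rl_sub st' s' sr' \o sr) p.
Proof. exact: pr_rl_sub_sub.1. Qed.

Lemma rl_sub_sub st s sr st' s' sr' h : rl_sub st' s' sr' (rl_sub st s sr h)
  = rl_sub (ty_sub st' \o st) (tm_sub st' s' \o s) (rl_sub st' s' sr' \o sr) h.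
Proof. exact: pr_rl_sub_sub.2. Qed.

Lemma pr_rl_renE :
  (forall p rt r rr,
     pr_ren rt r rr p = pr_sub (TVar \o rt) (Var \o r) (RVar \o rr) p) /\
  (forall h rt r rr,
     rl_ren rt r rr h = rl_sub (TVar \o rt) (Var \o r) (RVar \o rr) h).
Proof.
apply: lprop_lrel_ind => //=; intros; rewrite ?ty_renE ?tm_renE ?H ?H0 //.
- by congr PAllTy; apply: pr_ext => //; case.
- by congr PExTy; apply: pr_ext => //; case.
- by congr PAllTm; apply: pr_ext => //; case.
- by congr PExTm; apply: pr_ext => //; case.
- by congr PAllRel; apply: pr_ext => //; case.
- by congr PExRel; apply: pr_ext => //; case.
- by congr RAbs; apply: pr_ext => //; case=> //; case.
congr RTy; apply: map_allQ H => h Qh /=; exact: Qh.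
Qed.

Lemma pr_renE rt r rr p :
  pr_ren rt r rr p = pr_sub (TVar \o rt) (Var \o r) (RVar \o rr) p.
Proof. exact: pr_rl_renE.1. Qed.

Lemma rl_renE rt r rr h :
  rl_ren rt r rr h = rl_sub (TVar \o rt) (Var \o r) (RVar \o rr) h.
Proof. exact: pr_rl_renE.2. Qed.

Lemma upR_RVar : upR RVar = RVar.
Proof. by apply: functional_extensionality; case. Qed.

Lemma pr_rl_sub_id :
  (forall p, pr_sub TVar Var RVar p = p) /\ (forall h, rl_sub TVar Var RVar h = h).
Proof.
apply: lprop_lrel_ind => //=; intros;
  rewrite ?ty_sub_id ?tm_sub_id ?upT_TVar ?upt_Var ?upR_RVar ?H ?H0 //.
by congr RTy; rewrite -[RHS]map_id; apply: map_allQ H.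
Qed.

Lemma pr_sub_id p : pr_sub TVar Var RVar p = p.
Proof. exact: pr_rl_sub_id.1. Qed.

Lemma rl_sub_id h : rl_sub TVar Var RVar h = h.
Proof. exact: pr_rl_sub_id.2. Qed.

(** * Typing and linearity *)

(* [sig] proves equations of the substitution calculus: renamings are turned
   into substitutions, substitutions are composed, and two substitutions under
   the same head are compared pointwise, by cases on the first few variables.
   [sig_hook] and [sig_cong] let it handle abstract type and term constructors
   that commute with substitution. *)
Ltac sig_norm0 :=
  unfold requiv, req, rlolli, rarr, rbang, rtens, runit, rpi,
    wkT, wkt, wkp, wkr, pinst_ty, pinst_tm, pinst_rel, pinst2, tinst, TArr,
    PIff, idtm;
  fold ty_ren tm_ren pr_ren rl_ren ty_sub tm_sub pr_sub rl_sub;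
  rewrite /= ?addSn ?add0n /=; unfold wkT, wkt, wkp, wkr;
  rewrite ?ty_renE ?tm_renE ?pr_renE ?rl_renE
    ?ty_sub_sub ?tm_sub_sub ?pr_sub_sub ?rl_sub_sub
    ?ty_sub_id ?tm_sub_id ?pr_sub_id ?rl_sub_id.

Ltac sig_hook := idtac.

Ltac sig_cong := fail.

Ltac sig_norm := sig_norm0; sig_hook.

Ltac is_ctor t := lazymatch t with ?f _ => is_ctor f | _ => is_constructor t end.

Ltac sig_upto n :=
  intros; sig_norm;
  first
  [ reflexivity
  | lazymatch goal with
    | |- ty_sub _ ?a = ty_sub _ ?a => apply: ty_ext; sig_fun n
    | |- tm_sub _ _ ?t = tm_sub _ _ ?t => apply: tm_ext; sig_fun n
    | |- pr_sub _ _ _ ?p = pr_sub _ _ _ ?p => apply: pr_ext; sig_fun n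
    | |- rl_sub _ _ _ ?h = rl_sub _ _ _ ?h => apply: rl_ext; sig_fun n
    | |- ty_sub _ ?a = ?a => rewrite -[RHS]ty_sub_id; apply: ty_ext; sig_fun n
    | |- tm_sub _ _ ?a = ?a => rewrite -[RHS]tm_sub_id; apply: tm_ext; sig_fun n
    | |- pr_sub _ _ _ ?a = ?a => rewrite -[RHS]pr_sub_id; apply: pr_ext; sig_fun n
    | |- rl_sub _ _ _ ?a = ?a => rewrite -[RHS]rl_sub_id; apply: rl_ext; sig_fun n
    | |- ?a = ty_sub _ ?a => rewrite -[LHS]ty_sub_id; apply: ty_ext; sig_fun n
    | |- ?a = tm_sub _ _ ?a => rewrite -[LHS]tm_sub_id; apply: tm_ext; sig_fun n
    | |- ?a = rl_sub _ _ _ ?a => rewrite -[LHS]rl_sub_id; apply: rl_ext; sig_fun n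
    | |- ?l = ?r => first [is_ctor l; is_ctor r | sig_cong]; f_equal; sig_upto n
    end ]
with sig_fun n :=
  let i := fresh "i" in intro i; sig_case n i
with sig_case n i :=
  first
  [ reflexivity
  | lazymatch n with
    | S ?m => first [solve [sig_upto m] | destruct i as [|i]; sig_case m i]
    end ].

(** The number bounds the nesting of case splits on variables, not the number of rewriting steps. *)
Ltac sig := sig_upto 10.

Lemma ty_sub_wf n s s' a : wf_ty n a -> (forall i, i < n -> s i = s' i) ->
  ty_sub s a = ty_sub s' a.
Proof.
elim: a n s s' => //= [i|a IHa b IHb|a IHa b IHb|a IHa|a IHa] n s s'.
- by move=> ni; apply.
- by case/andP=> wa wb e; rewrite (IHa _ _ _ wa e) (IHb _ _ _ wb e).
- by case/andP=> wa wb e; rewrite (IHa _ _ _ wa e) (IHb _ _ _ wb e).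
- by move=> wa e; rewrite (IHa _ _ _ wa e).
- move=> wa e; rewrite (IHa _ _ (upT s') wa) //.
  by case=> //= i ni; rewrite e.
Qed.

Lemma wf_ty_ren n m r a : wf_ty n a -> (forall i, i < n -> r i < m) ->
  wf_ty m (ty_ren r a).
Proof.
elim: a n m r => //= [i|a IHa b IHb|a IHa b IHb|a IHa] n m r.
- by move=> ni; apply.
- by case/andP=> wa wb e; rewrite (IHa _ _ _ wa e) (IHb _ _ _ wb e).
- by case/andP=> wa wb e; rewrite (IHa _ _ _ wa e) (IHb _ _ _ wb e).
- by move=> wa e; apply: IHa wa _; case=> //= i ni; apply: e.
Qed.

Lemma wf_ty_sub n m s a : wf_ty n a -> (forall i, i < n -> wf_ty m (s i)) ->
  wf_ty m (ty_sub s a).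
Proof.
elim: a n m s => //= [i|a IHa b IHb|a IHa b IHb|a IHa] n m s.
- by move=> ni; apply.
- by case/andP=> wa wb e; rewrite (IHa _ _ _ wa e) (IHb _ _ _ wb e).
- by case/andP=> wa wb e; rewrite (IHa _ _ _ wa e) (IHb _ _ _ wb e).
move=> wa e; apply: IHa wa _; case=> //= i ni; apply: wf_ty_ren (e _ ni) _ => j.
exact.
Qed.

Lemma wf_ty0_sub s a : wf_ty 0 a -> ty_sub s a = a.
Proof. by move=> wa; rewrite -[RHS]ty_sub_id; apply: ty_sub_wf wa _. Qed.

Lemma wf_ty0 n a : wf_ty 0 a -> wf_ty n a.
Proof. by move=> wa; rewrite -(wf_ty0_sub TVar wa); apply: wf_ty_sub wa _. Qed.

(* For the typing of PILL, linearity is separated from simple typing: [occ]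
   counts the uses of a variable, where a use under ! counts twice and so never
   as a linear use. *)
Inductive sty : nat -> tctx -> tm -> ty -> Prop :=
| sty_var Xi G i a : onth G i = Some a -> sty Xi G (Var i) a
| sty_star Xi G : sty Xi G Star TUnit
| sty_Y Xi G : sty Xi G Y Yty
| sty_lam Xi G a b t : wf_ty Xi a -> sty Xi (a :: G) t b ->
    sty Xi G (Lam a t) (TLolli a b)
| sty_app Xi G a b t u : sty Xi G t (TLolli a b) -> sty Xi G u a ->
    sty Xi G (App t u) b
| sty_tens Xi G a b t u : sty Xi G t a -> sty Xi G u b ->
    sty Xi G (Tens t u) (TTens a b)
| sty_bang Xi G a t : sty Xi G t a -> sty Xi G (Bang t) (TBang a)
| sty_tlam Xi G a t : sty Xi.+1 (tctx_wkT G) t a -> sty Xi G (TLam t) (TPi a)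
| sty_tapp Xi G a b c t : wf_ty Xi b -> sty Xi G t (TPi a) -> c = tinst a b ->
    sty Xi G (TApp t b) c
| sty_letT Xi G a b c s t : sty Xi G s (TTens a b) -> sty Xi (b :: a :: G) t c ->
    sty Xi G (LetT s t) c
| sty_letB Xi G a c s t : sty Xi G s (TBang a) -> sty Xi (a :: G) t c ->
    sty Xi G (LetB s t) c
| sty_letS Xi G c s t : sty Xi G s TUnit -> sty Xi G t c -> sty Xi G (LetS s t) c.

Fixpoint occ (i : nat) (t : tm) : nat :=
  match t with
  | Var j => j == i
  | Star | Y => 0
  | Lam _ t => occ i.+1 t
  | App t u | Tens t u | LetS t u => occ i t + occ i u
  | Bang t => (occ i t).*2
  | TLam t | TApp t _ => occ i t
  | LetT s t => occ i s + occ i.+2 t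
  | LetB s t => occ i s + occ i.+1 t
  end.

Fixpoint lin (t : tm) : bool :=
  match t with
  | Var _ | Star | Y => true
  | Lam _ t => (occ 0 t == 1) && lin t
  | App t u | Tens t u | LetS t u | LetB t u => lin t && lin u
  | Bang t | TLam t | TApp t _ => lin t
  | LetT s t => [&& occ 0 t == 1, occ 1 t == 1, lin s & lin t]
  end.

Definition use_mode (m : mode) (k : nat) : Prop :=
  match m with Int => True | Lin => k = 1 | Gone => k = 0 end.

Definition uses (G : ctx) (f : nat -> nat) : Prop :=
  forall i m b, onth G i = Some (m, b) -> use_mode m (f i).

Lemma csplit_snd G G1 G2 : csplit G G1 G2 ->
  map snd G1 = map snd G /\ map snd G2 = map snd G.
Proof. by elim=> //= {}G *; intuition congruence. Qed.

Lemma csplit_uses G G1 G2 f g : csplit G G1 G2 -> uses G1 f -> uses G2 g ->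
  uses G (fun i => f i + g i).
Proof.
move=> sp; elim: sp f g => [|a {}G {}G1 {}G2 _ IH|a {}G {}G1 {}G2 _ IH
  |a {}G {}G1 {}G2 _ IH|a {}G {}G1 {}G2 _ IH] f g uf ug; first by case.
all: case=> [m b [<- _]|i m b e] /=; last by
  apply: (IH (f \o succn) (g \o succn)) e => j; [exact: (uf j.+1)|exact: (ug j.+1)].
- by [].
- by rewrite (uf 0 _ a erefl) (ug 0 _ a erefl).
- by rewrite (uf 0 _ a erefl) (ug 0 _ a erefl).
by rewrite (uf 0 _ a erefl) (ug 0 _ a erefl).
Qed.

Lemma nolin_uses G : nolin G -> uses G (fun=> 0).
Proof. by move=> nl i [] b // e; case: (nl i b). Qed.

Lemma onth_map_some T U (f : T -> U) s i x : onth s i = Some x ->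
  onth (map f s) i = Some (f x).
Proof. by elim: s i => [|y s IH] [|i] //=; [case=> ->|exact: IH]. Qed.

Lemma onth_map_inv T U (f : T -> U) s i y : onth (map f s) i = Some y ->
  exists2 x, onth s i = Some x & y = f x.
Proof. by elim: s i => [|z s IH] [|i] //=; [case=> <-; exists z|exact: IH]. Qed.

Lemma ctx_wkT_snd G : map snd (ctx_wkT G) = tctx_wkT (map snd G).
Proof. by rewrite /tctx_wkT -!map_comp. Qed.

Lemma typed_sty Xi G t a : typed Xi G t a ->
  [/\ sty Xi (map snd G) t a, lin t & uses G (occ^~ t)].
Proof.
elim=> {Xi G t a} /=.
- move=> Xi G i a e nl; split=> //; first by constructor; rewrite (onth_map_some _ e).
  move=> j [] b //= ej; first by case: (nl j b).
  by case: eqP => // ij; rewrite ij ej in e.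
- move=> Xi G i a e u; split=> //; first by constructor; rewrite (onth_map_some _ e).
  move=> j [] b //= ej; first by rewrite (u _ _ ej) eqxx.
  by case: eqP => // ij; rewrite ij ej in e.
- by move=> Xi G nl; split=> //; [constructor|exact: nolin_uses].
- by move=> Xi G nl; split=> //; [constructor|exact: nolin_uses].
- move=> Xi G a b t wa _ [st lt ut]; split; first exact: sty_lam.
    by rewrite (ut 0 Lin a).
  by move=> i m c e; apply: (ut i.+1 m c).
- move=> Xi G G1 G2 a b t u sp _ [st lt ut] _ [su lu uu].
  have [e1 e2] := csplit_snd sp; rewrite e1 e2 in st su.
  split; [exact: sty_app st su|by rewrite lt lu|exact: csplit_uses sp ut uu].
- move=> Xi G G1 G2 a b t u sp _ [st lt ut] _ [su lu uu].
  have [e1 e2] := csplit_snd sp; rewrite e1 e2 in st su.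
  split; [exact: sty_tens st su|by rewrite lt lu|exact: csplit_uses sp ut uu].
- move=> Xi G a t nl _ [st lt ut]; split=> //; first exact: sty_bang.
  by move=> i [] b e //=; [case: (nl i b)|rewrite (ut i _ b e)].
- move=> Xi G a t _ [st lt ut]; split=> //.
    by apply: sty_tlam; rewrite -ctx_wkT_snd.
  by move=> i m b e; apply: (ut i m (wkT 1 b)); rewrite (onth_map_some _ e).
- by move=> Xi G a b t wb _ [st lt ut]; split=> //; apply: sty_tapp st _.
- move=> Xi G G1 G2 a b c s t sp _ [st lt ut] _ [su lu uu].
  have [e1 e2] := csplit_snd sp; rewrite /= e1 e2 in st su.
  split; first exact: sty_letT st su.
    by rewrite (uu 0 Lin b) // (uu 1 Lin a) // lt lu.
  by apply: csplit_uses sp ut _ => i m d e; apply: (uu i.+2 m d).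
- move=> Xi G G1 G2 a c s t sp _ [st lt ut] _ [su lu uu].
  have [e1 e2] := csplit_snd sp; rewrite /= e1 e2 in st su.
  split; first exact: sty_letB st su.
    by rewrite lt lu.
  by apply: csplit_uses sp ut _ => i m d e; apply: (uu i.+1 m d).
- move=> Xi G G1 G2 c s t sp _ [st lt ut] _ [su lu uu].
  have [e1 e2] := csplit_snd sp; rewrite e1 e2 in st su.
  split; [exact: sty_letS st su|by rewrite lt lu|exact: csplit_uses sp ut uu].
Qed.

(** Rebuilds one half of a context splitting from a choice of variables: a linear variable is kept
    if [P] selects it and becomes [Gone] otherwise. The other half is the mask by [predC P]. *)
Fixpoint mask (P : nat -> bool) (G : ctx) : ctx :=
  match G with
  | [::] => [::]
  | (m, a) :: G =>
      ((if m is Lin then if P 0 then Lin else Gone else m), a)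
        :: mask (P \o succn) G
  end.

Lemma mask_snd P G : map snd (mask P G) = map snd G.
Proof. by elim: G P => //= [[m a] G IH] P /=; rewrite IH. Qed.

Lemma csplit_mask P G : csplit G (mask P G) (mask (predC P) G).
Proof.
elim: G P => [|[[] a] G IH] P /=; try by constructor; apply: IH.
by case: (P 0); constructor; apply: IH.
Qed.

(** At a linear variable [f + g] is 1, so exactly one of the two counts is 1 and the other is 0; at
    a [Gone] variable both vanish. *)
Lemma uses_mask P G (f g h : nat -> nat) :
  (forall i, h i = f i + g i) -> (forall i, P i = (f i == 1)) -> uses G h ->
  uses (mask P G) f /\ uses (mask (predC P) G) g.
Proof.
elim: G P f g h => [|[m a] G IH] P f g h hE PE uh; first by split; case.
have [] := IH (P \o succn) (f \o succn) (g \o succn) (h \o succn).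
- by move=> i; exact: hE.
- by move=> i; exact: PE.
- by move=> i; exact: (uh i.+1).
have := uh 0 m a erefl; rewrite hE /= PE => um uf ug.
split=> -[|i] m' b /=; [|exact: uf| |exact: ug].
all: case=> <- _; case: m um {uh} => //= um.
all: case: (f 0) (g 0) um => [|[|n]] //= [|k] //=.
Qed.

(** A doubled count is even, hence never 1, so no entry of the context can be linear. *)
Lemma nolin_occ G t : uses G (fun i => (occ i t).*2) ->
  nolin G.
Proof. by move=> u i b /u /= /(congr1 odd); rewrite odd_double. Qed.

Lemma nolin_mode G : uses G (fun=> 0) -> nolin G.
Proof. by move=> u i b /u. Qed.

(** The splittings required by the binary rules are no longer recorded in a simple typing. They are
    recovered from the counts: the linear variables used once by the first subterm go to it, the
    remaining ones to the second. *)
Lemma sty_typed Xi Gs t a : sty Xi Gs t a -> forall G, map snd G = Gs ->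
  lin t -> uses G (occ^~ t) -> typed Xi G t a.
Proof.
elim=> {Xi Gs t a} /=.
- move=> Xi Gs i a e G eG _ u; rewrite -eG in e.
  have [[m b] /= ei ab] := onth_map_inv e.
  have := u i m b ei; rewrite /= eqxx; rewrite -ab in ei.
  case: m ei => //= ei _.
    apply: ty_ivar; [exact: ei|] => j c ej; have := u j _ c ej => /=.
    by case: eqP => // ij; rewrite -ij ei in ej.
  apply: ty_lvar; [exact: ei|] => j c ej; by have := u j _ c ej => /=; case: eqP.
- by move=> Xi Gs G _ _ u; apply: ty_star; apply: nolin_mode.
- by move=> Xi Gs G _ _ u; apply: ty_Y; apply: nolin_mode.
- move=> Xi Gs a b t wa _ IH G eG /andP[/eqP o1 lt] u.
  apply: ty_lam => //; apply: IH; [by rewrite /= eG|by []|].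
  by case=> [m c [<- _] //|i m c /=]; apply: u.
- move=> Xi Gs a b t u _ IHt _ IHu G eG /andP[lt lu] us.
  have [ut uu] := uses_mask (fun=> erefl) (fun=> erefl) us.
  apply: ty_app (csplit_mask (fun i => occ i t == 1) G) (IHt _ _ lt _) (IHu _ _ lu _) => //.
    by rewrite mask_snd.
  by rewrite mask_snd.
- move=> Xi Gs a b t u _ IHt _ IHu G eG /andP[lt lu] us.
  have [ut uu] := uses_mask (fun=> erefl) (fun=> erefl) us.
  apply: ty_tens (csplit_mask (fun i => occ i t == 1) G) (IHt _ _ lt _) (IHu _ _ lu _) => //.
    by rewrite mask_snd.
  by rewrite mask_snd.
- move=> Xi Gs a t _ IH G eG lt u; have nl := nolin_occ u.
  apply: ty_bang => //; apply: IH => // i [] b e //; first by case: (nl i b).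
  by apply: double_inj; apply: (u i _ b e).
- move=> Xi Gs a t _ IH G eG lt u; apply: ty_tlam; apply: IH => //.
    by rewrite ctx_wkT_snd eG.
  by rewrite /ctx_wkT => i m b e'; have [[m' c] e [-> _]] := onth_map_inv e'; apply: u e.
- move=> Xi Gs a b c t wb _ IH eqc G eG lt u; rewrite eqc; apply: ty_tapp => //; exact: (IH _ eG lt u).
- move=> Xi Gs a b c s t _ IHt _ IHu G eG /and4P[/eqP o0 /eqP o1 lt lu] us.
  have [ut uu] := uses_mask (fun=> erefl) (fun=> erefl) us.
  apply: ty_letT (csplit_mask (fun i => occ i s == 1) G) (IHt _ _ lt _) (IHu _ _ lu _) => //=.
  - by rewrite mask_snd.
  - by rewrite mask_snd eG.
  - by case=> [|[|i]] m d /=; [case=> <-|case=> <-|apply: uu].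
- move=> Xi Gs a c s t _ IHt _ IHu G eG /andP[lt lu] us.
  have [ut uu] := uses_mask (fun=> erefl) (fun=> erefl) us.
  apply: ty_letB (csplit_mask (fun i => occ i s == 1) G) (IHt _ _ lt _) (IHu _ _ lu _) => //=.
  - by rewrite mask_snd.
  - by rewrite mask_snd eG.
  - by case=> [|i] m d /=; [case=> <-|apply: uu].
- move=> Xi Gs c s t _ IHt _ IHu G eG /andP[lt lu] us.
  have [ut uu] := uses_mask (fun=> erefl) (fun=> erefl) us.
  apply: ty_letS (csplit_mask (fun i => occ i s == 1) G) (IHt _ _ lt _) (IHu _ _ lu _) => //=.
  - by rewrite mask_snd.
  by rewrite mask_snd.
Qed.

Lemma occ_ren i i0 rt r t : (forall j, (r j == i) = (j == i0)) ->
  occ i (tm_ren rt r t) = occ i0 t.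
Proof.
have up k k0 r' : (forall j, (r' j == k) = (j == k0)) ->
  forall j, (upr r' j == k.+1) = (j == k0.+1) by move=> e; case.
elim: t i i0 rt r => //= [j|a t IH|t IHt u IHu|t IHt u IHu|t IH|t IH|
  t IHt u IHu|t IHt u IHu|t IHt u IHu] i i0 rt r e;
  rewrite ?e ?(IH _ _ _ _ (up _ _ _ e)) ?(IH _ _ _ _ e) ?(IHt _ _ _ _ e)
    ?(IHu _ _ _ _ e) ?(IHu _ _ _ _ (up _ _ _ e)) ?(IHu _ _ _ _ (up _ _ _ (up _ _ _ e))) //.
Qed.

Lemma occ_ren0 i rt r t : (forall j, r j != i) -> occ i (tm_ren rt r t) = 0.
Proof.
have up k r' : (forall j, r' j != k) -> forall j, upr r' j != k.+1 by move=> e; case.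
elim: t i rt r => //= [j|a t IH|t IHt u IHu|t IHt u IHu|t IH|t IH|
  t IHt u IHu|t IHt u IHu|t IHt u IHu] i rt r e.
- by rewrite (negbTE (e j)).
all: rewrite ?(IH _ _ _ (up _ _ e)) ?(IH _ _ _ e) ?(IHt _ _ _ e)
    ?(IHu _ _ _ e) ?(IHu _ _ _ (up _ _ e)) ?(IHu _ _ _ (up _ _ (up _ _ e))) //.
Qed.

Lemma occ_wk i n t : i < n -> occ i (wkt 0 n t) = 0.
Proof. by move=> lt; apply: occ_ren0 => j; rewrite gtn_eqF // ltn_addr. Qed.

Lemma occ_sub i i0 st s t : (forall j, occ i (s j) = (j == i0)) ->
  occ i (tm_sub st s t) = occ i0 t.
Proof.
have up k k0 (s' : nat -> tm) : (forall j, occ k (s' j) = (j == k0)) ->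
    forall j, occ k.+1 (upt s' j) = (j == k0.+1).
  by move=> e [|j] //=; rewrite -[RHS]e; apply: occ_ren.
have upT' (k k0 : nat) (s' : nat -> tm) : (forall j, occ k (s' j) = (j == k0)) ->
    forall j, occ k (wkt 1 0 (s' j)) = (j == k0).
  by move=> e j; rewrite -[RHS]e; apply: occ_ren.
elim: t i i0 st s => //= [a t IH|t IHt u IHu|t IHt u IHu|t IH|t IH|
  t IHt u IHu|t IHt u IHu|t IHt u IHu] i i0 st s e;
  rewrite ?(IH _ _ _ _ (up _ _ _ e)) ?(IH _ _ _ _ e)
    ?(IHt _ _ _ _ e)
    ?(IHu _ _ _ _ e) ?(IHu _ _ _ _ (up _ _ _ e)) ?(IHu _ _ _ _ (up _ _ _ (up _ _ _ e))) //.
by apply: IH; apply: upT'.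
Qed.

Lemma lin_ren rt r t : lin (tm_ren rt r t) = lin t.
Proof.
have o0 rt' r' u : occ 0 (tm_ren rt' (upr r') u) = occ 0 u.
  by apply: occ_ren; case.
have o1 rt' r' u : occ 1 (tm_ren rt' (upr (upr r')) u) = occ 1 u.
  by apply: occ_ren; case=> //; case.
elim: t rt r => //= [a t IH|t IHt u IHu|t IHt u IHu|
  t IHt u IHu|t IHt u IHu|t IHt u IHu] rt r; by rewrite ?IH ?o0 ?o1 ?IHt ?IHu.
Qed.

(** [lin] constrains only variables bound inside the term. Substituted terms are weakened under
    these binders and cannot mention them, so the substituted variables themselves may occur any
    number of times. *)
Lemma lin_sub st s t : (forall j, lin (s j)) -> lin t -> lin (tm_sub st s t).
Proof.
have up s' : (forall j, lin (s' j)) -> forall j, lin (upt s' j).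
  by move=> e [|j] //=; rewrite lin_ren.
have o0 st' s' u : occ 0 (tm_sub st' (upt s') u) = occ 0 u.
  by apply: occ_sub; case=> // j; apply: occ_ren0.
have o1 st' s' u : occ 1 (tm_sub st' (upt (upt s')) u) = occ 1 u.
  apply: occ_sub; case=> // -[//|j] /=; rewrite /wkt tm_ren_ren.
  by apply: occ_ren0.
elim: t st s => //= [a t IH|t IHt u IHu|t IHt u IHu|t IH|
  t IHt u IHu|t IHt u IHu|t IHt u IHu] st s ls; rewrite ?o0 ?o1.
- by case/andP=> -> lt; rewrite IH //; apply: up.
- by case/andP=> lt lu; rewrite IHt // IHu.
- by case/andP=> lt lu; rewrite IHt // IHu.
- by move=> lt; apply: IH lt => j; rewrite lin_ren.
- by case/and4P=> -> -> lt lu; rewrite IHt // IHu //; apply/up/up.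
- by case/andP=> lt lu; rewrite IHt // IHu //; apply: up.
- by case/andP=> lt lu; rewrite IHt // IHu.
Qed.

Definition ren_ty (rt : nat -> nat) (Xi Xi' : nat) : Prop :=
  forall i, i < Xi -> rt i < Xi'.

Definition ren_tm (rt r : nat -> nat) (G G' : tctx) : Prop :=
  forall i a, onth G i = Some a -> onth G' (r i) = Some (ty_ren rt a).

Definition sub_ty (st : nat -> ty) (Xi Xi' : nat) : Prop :=
  forall i, i < Xi -> wf_ty Xi' (st i).

Definition sub_tm (st : nat -> ty) (s : nat -> tm) Xi' (G G' : tctx) : Prop :=
  forall i a, onth G i = Some a -> sty Xi' G' (s i) (ty_sub st a).

Lemma ren_ty_up rt Xi Xi' : ren_ty rt Xi Xi' -> ren_ty (upr rt) Xi.+1 Xi'.+1.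
Proof. by move=> e [|i] //=; apply: e. Qed.

Lemma ren_tm_up rt r a G G' : ren_tm rt r G G' ->
  ren_tm rt (upr r) (a :: G) (ty_ren rt a :: G').
Proof. by move=> e [|i] b /=; [case=> ->|apply: e]. Qed.

Lemma ren_tm_wkT rt r G G' : ren_tm rt r G G' ->
  ren_tm (upr rt) r (tctx_wkT G) (tctx_wkT G').
Proof.
move=> e i b eb; have [c ec ->] := onth_map_inv eb.
by rewrite (onth_map_some _ (e _ _ ec)); congr Some; sig.
Qed.

Lemma tinst_ren rt a b :
  ty_ren rt (tinst a b) = tinst (ty_ren (upr rt) a) (ty_ren rt b).
Proof. sig. Qed.

Lemma tinst_sub s a b :
  ty_sub s (tinst a b) = tinst (ty_sub (upT s) a) (ty_sub s b).
Proof. sig. Qed.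

Lemma sty_ren Xi G t a Xi' G' rt r : sty Xi G t a ->
  ren_ty rt Xi Xi' -> ren_tm rt r G G' ->
  sty Xi' G' (tm_ren rt r t) (ty_ren rt a).
Proof.
move=> st; elim: st Xi' G' rt r => {Xi G t a} /=.
- by move=> Xi G i a e Xi' G' rt r eX eG; apply: sty_var; apply: eG.
- by move=> Xi G Xi' G' rt r _ _; apply: sty_star.
- by move=> Xi G Xi' G' rt r _ _; apply: sty_Y.
- move=> Xi G a b t wa _ IH Xi' G' rt r eX eG; apply: sty_lam.
    exact: wf_ty_ren wa eX.
  by apply: IH => //; apply: ren_tm_up.
- by move=> Xi G a b t u _ IHt _ IHu Xi' G' rt r eX eG; apply: sty_app;
    [exact: IHt|exact: IHu].
- by move=> Xi G a b t u _ IHt _ IHu Xi' G' rt r eX eG; apply: sty_tens;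
    [exact: IHt|exact: IHu].
- by move=> Xi G a t _ IH Xi' G' rt r eX eG; apply: sty_bang; exact: IH.
- move=> Xi G a t _ IH Xi' G' rt r eX eG; apply: sty_tlam; apply: IH.
    exact: ren_ty_up.
  exact: ren_tm_wkT.
- move=> Xi G a b c t wb _ IH -> Xi' G' rt r eX eG; apply: sty_tapp.
  + exact: wf_ty_ren wb eX.
  + exact: IH.
  + exact: tinst_ren.
- move=> Xi G a b c s t _ IHt _ IHu Xi' G' rt r eX eG; apply: sty_letT.
    exact: IHt.
  by apply: IHu => //; do 2 apply: ren_tm_up.
- move=> Xi G a c s t _ IHt _ IHu Xi' G' rt r eX eG; apply: sty_letB.
    exact: IHt.
  by apply: IHu => //; apply: ren_tm_up.
- by move=> Xi G c s t _ IHt _ IHu Xi' G' rt r eX eG; apply: sty_letS;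
    [exact: IHt|exact: IHu].
Qed.

Lemma ren_ty_wk n Xi : ren_ty (addn n) Xi (n + Xi).
Proof. by move=> i; rewrite ltn_add2l. Qed.

Lemma ren_tm_wk1 b G : ren_tm (addn 0) (addn 1) G (b :: G).
Proof. by move=> i a e; rewrite ty_ren0. Qed.

Lemma ren_tm_wkT1 G : ren_tm (addn 1) (addn 0) G (tctx_wkT G).
Proof. by move=> i a e; apply: onth_map_some. Qed.

Lemma sub_ty_up st Xi Xi' : sub_ty st Xi Xi' -> sub_ty (upT st) Xi.+1 Xi'.+1.
Proof. by move=> e [|i] //= /e w; apply: wf_ty_ren w _ => j. Qed.

Lemma sub_tm_up st s a Xi' G G' : sub_tm st s Xi' G G' ->
  sub_tm st (upt s) Xi' (a :: G) (ty_sub st a :: G').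
Proof.
move=> e [|i] b /=; first by case=> ->; apply: sty_var.
move/e=> w; rewrite -[ty_sub st b]ty_ren0; apply: sty_ren w _ _.
  exact: ren_ty_wk.
exact: ren_tm_wk1.
Qed.

Lemma sub_tm_wkT st s Xi' G G' : sub_tm st s Xi' G G' ->
  sub_tm (upT st) (fun i => wkt 1 0 (s i)) Xi'.+1 (tctx_wkT G) (tctx_wkT G').
Proof.
move=> e i b eb; have [c ec ->] := onth_map_inv eb.
have -> : ty_sub (upT st) (wkT 1 c) = wkT 1 (ty_sub st c) by sig.
apply: sty_ren (e _ _ ec) _ _; first exact: ren_ty_wk.
exact: ren_tm_wkT1.
Qed.

Lemma sty_sub Xi G t a Xi' G' st s : sty Xi G t a ->
  sub_ty st Xi Xi' -> sub_tm st s Xi' G G' ->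
  sty Xi' G' (tm_sub st s t) (ty_sub st a).
Proof.
move=> h; elim: h Xi' G' st s => {Xi G t a} /=.
- by move=> Xi G i a e Xi' G' rt r eX eG; apply: eG.
- by move=> Xi G Xi' G' rt r _ _; apply: sty_star.
- by move=> Xi G Xi' G' rt r _ _; apply: sty_Y.
- move=> Xi G a b t wa _ IH Xi' G' rt r eX eG; apply: sty_lam.
    exact: wf_ty_sub wa eX.
  by apply: IH => //; apply: sub_tm_up.
- by move=> Xi G a b t u _ IHt _ IHu Xi' G' rt r eX eG; apply: sty_app;
    [exact: IHt|exact: IHu].
- by move=> Xi G a b t u _ IHt _ IHu Xi' G' rt r eX eG; apply: sty_tens;
    [exact: IHt|exact: IHu].
- by move=> Xi G a t _ IH Xi' G' rt r eX eG; apply: sty_bang; exact: IH.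
- move=> Xi G a t _ IH Xi' G' rt r eX eG; apply: sty_tlam; apply: IH.
    exact: sub_ty_up.
  exact: sub_tm_wkT.
- move=> Xi G a b c t wb _ IH -> Xi' G' rt r eX eG; apply: sty_tapp.
  + exact: wf_ty_sub wb eX.
  + exact: IH.
  + exact: tinst_sub.
- move=> Xi G a b c s t _ IHt _ IHu Xi' G' rt r eX eG; apply: sty_letT.
    exact: IHt.
  by apply: IHu => //; do 2 apply: sub_tm_up.
- move=> Xi G a c s t _ IHt _ IHu Xi' G' rt r eX eG; apply: sty_letB.
    exact: IHt.
  by apply: IHu => //; apply: sub_tm_up.
- by move=> Xi G c s t _ IHt _ IHu Xi' G' rt r eX eG; apply: sty_letS;
    [exact: IHt|exact: IHu].
Qed.

Definition wt Xi (G : tctx) (t : tm) (a : ty) : Prop := sty Xi G t a /\ lin t.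

Lemma ictx_snd G : map snd (ictx G) = G.
Proof. by rewrite -map_comp map_id. Qed.

(** All entries of [ictx G] are intuitionistic, and on such entries [uses] imposes nothing. *)
Lemma typed_wt Xi G t a : typed Xi (ictx G) t a <-> wt Xi G t a.
Proof.
split; first by case/typed_sty; rewrite ictx_snd.
case=> st lt; apply: (sty_typed st) => //; first exact: ictx_snd.
by move=> i m b e; have [c _ [-> _]] := onth_map_inv e.
Qed.

Lemma typed_lin Xi G a t b : typed Xi ((Lin, a) :: ictx G) t b <->
  wt Xi (a :: G) t b /\ occ 0 t = 1.
Proof.
split; first by case/typed_sty; rewrite /= ictx_snd => st lt ut; split=> //;
  apply: (ut 0 Lin a).
case=> -[st lt] o; apply: (sty_typed st) => //; first by rewrite /= ictx_snd.
by case=> [|i] m c /=; [case=> <-|move=> e; have [d _ [-> _]] := onth_map_inv e].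
Qed.

Lemma wt_ren Xi G t a Xi' G' rt r : wt Xi G t a ->
  ren_ty rt Xi Xi' -> ren_tm rt r G G' ->
  wt Xi' G' (tm_ren rt r t) (ty_ren rt a).
Proof. by case=> st lt eX eG; split; [exact: sty_ren st eX eG|rewrite lin_ren]. Qed.

(** * Renaming of logical contexts and judgements *)

Record ren : Type := Ren { rty : nat -> nat; rtm : nat -> nat; rrl : nat -> nat }.

Definition ren_rl (rt rr : nat -> nat) (Th Th' : rctx) : Prop :=
  forall i b a a', onth Th i = Some (RelSort b a a') ->
    onth Th' (rr i) = Some (RelSort b (ty_ren rt a) (ty_ren rt a')).

Definition ren_ctx (r : ren) Xi G Th Xi' G' Th' : Prop :=
  [/\ ren_ty (rty r) Xi Xi', ren_tm (rty r) (rtm r) G G'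
    & ren_rl (rty r) (rrl r) Th Th'].

Lemma ren_rl_up rt rr b a a' Th Th' : ren_rl rt rr Th Th' ->
  ren_rl rt (upr rr) (RelSort b a a' :: Th)
    (RelSort b (ty_ren rt a) (ty_ren rt a') :: Th').
Proof. by move=> e [|i] c d d' /=; [case=> -> -> ->|apply: e]. Qed.

Lemma ren_rl_wkT rt rr Th Th' : ren_rl rt rr Th Th' ->
  ren_rl (upr rt) rr (rctx_wkT Th) (rctx_wkT Th').
Proof.
move=> e i b a a' ei; have [[c d d'] ec [-> -> ->]] := onth_map_inv ei.
by rewrite (onth_map_some _ (e _ _ _ _ ec)); congr (Some (RelSort _ _ _)); sig.
Qed.

Scheme is_prop_mind := Minimality for is_prop Sort Prop
  with is_rel_mind := Minimality for is_rel Sort Prop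
  with is_adm_mind := Minimality for is_adm Sort Prop
  with are_adm_mind := Minimality for are_adm Sort Prop.
Combined Scheme is_lapl_ind from is_prop_mind, is_rel_mind, is_adm_mind, are_adm_mind.

Lemma are_adm_size Xi G Th hs ts us : are_adm Xi G Th hs ts us ->
  size ts = size hs /\ size us = size hs.
Proof. by elim=> //= {}Xi {}G {}Th h {}hs a {}ts b {}us _ _ [-> ->]. Qed.

Lemma tsub_of_map (f : ty -> ty) ts i : i < size ts ->
  tsub_of (map f ts) i = f (tsub_of ts i).
Proof. by move=> lt; rewrite /tsub_of (nth_map TUnit). Qed.

Lemma typed_lin_ren Xi G a t b Xi' G' rt r :
  typed Xi ((Lin, a) :: ictx G) t b -> ren_ty rt Xi Xi' -> ren_tm rt r G G' ->
  typed Xi' ((Lin, ty_ren rt a) :: ictx G') (tm_ren rt (upr r) t) (ty_ren rt b).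
Proof.
case/typed_lin=> w o eX eG; apply/typed_lin; split.
  by apply: wt_ren w eX _; apply: ren_tm_up.
by rewrite -o; apply: occ_ren; case.
Qed.

(** The rules for AdmRel prescribe the literal form of the relation, weakenings included. Most of
    these cases therefore begin by commuting the renaming with the prescribed weakenings before the
    rule can be applied again. *)
Lemma is_lapl_ren :
  (forall Xi G Th p, is_prop Xi G Th p ->
     forall Xi' G' Th' r, ren_ctx r Xi G Th Xi' G' Th' ->
     is_prop Xi' G' Th' (pr_ren (rty r) (rtm r) (rrl r) p)) /\
  (forall Xi G Th h a b, is_rel Xi G Th h a b ->
     forall Xi' G' Th' r, ren_ctx r Xi G Th Xi' G' Th' ->
     is_rel Xi' G' Th' (rl_ren (rty r) (rtm r) (rrl r) h)
       (ty_ren (rty r) a) (ty_ren (rty r) b)) /\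
  (forall Xi G Th h a b, is_adm Xi G Th h a b ->
     forall Xi' G' Th' r, ren_ctx r Xi G Th Xi' G' Th' ->
     is_adm Xi' G' Th' (rl_ren (rty r) (rtm r) (rrl r) h)
       (ty_ren (rty r) a) (ty_ren (rty r) b)) /\
  (forall Xi G Th hs ts us, are_adm Xi G Th hs ts us ->
     forall Xi' G' Th' r, ren_ctx r Xi G Th Xi' G' Th' ->
     are_adm Xi' G' Th' (map (rl_ren (rty r) (rtm r) (rrl r)) hs)
       (map (ty_ren (rty r)) ts) (map (ty_ren (rty r)) us)).
Proof.
have wtr Xi G t a Xi' G' rt r : typed Xi (ictx G) t a -> ren_ty rt Xi Xi' ->
    ren_tm rt r G G' -> typed Xi' (ictx G') (tm_ren rt r t) (ty_ren rt a).
  by move=> /typed_wt w eX eG; apply/typed_wt; apply: wt_ren w eX eG.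
have upRT Xi G Th Xi' G' Th' r : ren_ctx r Xi G Th Xi' G' Th' ->
  ren_ctx (Ren (upr (rty r)) (rtm r) (rrl r)) Xi.+1 (tctx_wkT G) (rctx_wkT Th)
    Xi'.+1 (tctx_wkT G') (rctx_wkT Th').
  case=> eX eG eT; split; [exact: ren_ty_up|exact: ren_tm_wkT|exact: ren_rl_wkT].
have upRt Xi G Th Xi' G' Th' r a : ren_ctx r Xi G Th Xi' G' Th' ->
  ren_ctx (Ren (rty r) (upr (rtm r)) (rrl r)) Xi (a :: G) Th
    Xi' (ty_ren (rty r) a :: G') Th'.
  case=> eX eG eT; split=> //; exact: ren_tm_up.
have upRR Xi G Th Xi' G' Th' r b a a' : ren_ctx r Xi G Th Xi' G' Th' ->
  ren_ctx (Ren (rty r) (rtm r) (upr (rrl r))) Xi G (RelSort b a a' :: Th)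
    Xi' G' (RelSort b (ty_ren (rty r) a) (ty_ren (rty r) a') :: Th').
  case=> eX eG eT; split=> //; exact: ren_rl_up.
apply: is_lapl_ind => /=.
- by move=> Xi G Th a t u tt tu Xi' G' Th' r [eX eG eT]; apply: ip_eq; apply: wtr eX eG.
- move=> Xi G Th h a b t u _ IH tt tu Xi' G' Th' r er; have [eX eG eT] := er.
  by apply: ip_rel (IH _ _ _ _ er) _ _; apply: wtr eX eG.
- by move=> *; apply: ip_top.
- by move=> *; apply: ip_bot.
- by move=> Xi G Th p q _ IHp _ IHq Xi' G' Th' r er; apply: ip_and; [apply: IHp|apply: IHq].
- by move=> Xi G Th p q _ IHp _ IHq Xi' G' Th' r er; apply: ip_or; [apply: IHp|apply: IHq].
- by move=> Xi G Th p q _ IHp _ IHq Xi' G' Th' r er; apply: ip_imp; [apply: IHp|apply: IHq].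
- move=> Xi G Th p _ IH Xi' G' Th' r /upRT er; apply: ip_allTy; exact: IH er.
- move=> Xi G Th p _ IH Xi' G' Th' r /upRT er; apply: ip_exTy; exact: IH er.
- move=> Xi G Th a p wa _ IH Xi' G' Th' r er; have [eX _ _] := er.
  by apply: ip_allTm; [exact: wf_ty_ren wa eX|exact: (IH _ _ _ _ (upRt _ _ _ _ _ _ _ a er))].
- move=> Xi G Th a p wa _ IH Xi' G' Th' r er; have [eX _ _] := er.
  by apply: ip_exTm; [exact: wf_ty_ren wa eX|exact: (IH _ _ _ _ (upRt _ _ _ _ _ _ _ a er))].
- move=> Xi G Th b a a' p wa wa' _ IH Xi' G' Th' r er; have [eX _ _] := er.
  by apply: ip_allRel; [exact: wf_ty_ren wa eX|exact: wf_ty_ren wa' eX|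
    exact: (IH _ _ _ _ (upRR _ _ _ _ _ _ _ b a a' er))].
- move=> Xi G Th b a a' p wa wa' _ IH Xi' G' Th' r er; have [eX _ _] := er.
  by apply: ip_exRel; [exact: wf_ty_ren wa eX|exact: wf_ty_ren wa' eX|
    exact: (IH _ _ _ _ (upRR _ _ _ _ _ _ _ b a a' er))].
- by move=> Xi G Th i a a' e Xi' G' Th' r [_ _ eT]; apply: ir_var; apply: eT.
- move=> Xi G Th a b p wa wb _ IH Xi' G' Th' r er; have [eX _ _] := er.
  apply: ir_abs; [exact: wf_ty_ren wa eX|exact: wf_ty_ren wb eX|].
  exact: (IH _ _ _ _ (upRt _ _ _ _ _ _ _ b (upRt _ _ _ _ _ _ _ a er))).
- by move=> Xi G Th h a b _ IH Xi' G' Th' r er; apply: ir_adm; apply: IH.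
- by move=> Xi G Th i a a' e Xi' G' Th' r [_ _ eT]; apply: adm_var; apply: eT.
- by move=> Xi G Th a wa Xi' G' Th' r [eX _ _]; apply: adm_eq; apply: wf_ty_ren wa eX.
- move=> Xi G Th a b t wa wb tt Xi' G' Th' r [eX eG _].
  have -> : tm_ren (rty r) (upr (upr (rtm r))) (wkt 0 1 t)
    = wkt 0 1 (tm_ren (rty r) (upr (rtm r)) t) by sig.
  apply: adm_graph; [exact: wf_ty_ren wa eX|exact: wf_ty_ren wb eX|].
  exact: typed_lin_ren tt eX eG.
- move=> Xi G Th h a b a' b' t u wa wb _ IH tt tu Xi' G' Th' r er.
  have [eX eG _] := er.
  have -> : tm_ren (rty r) (upr (upr (rtm r))) (wkt 0 1 t)
    = wkt 0 1 (tm_ren (rty r) (upr (rtm r)) t) by sig.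
  have -> : tm_ren (rty r) (upr (upr (rtm r))) (tm_ren id (upr succn) u)
    = tm_ren id (upr succn) (tm_ren (rty r) (upr (rtm r)) u) by sig.
  have -> : rl_ren (rty r) (upr (upr (rtm r))) (rrl r) (wkr 0 2 0 h)
    = wkr 0 2 0 (rl_ren (rty r) (rtm r) (rrl r) h) by sig.
  apply: adm_reindex; [exact: wf_ty_ren wa eX|exact: wf_ty_ren wb eX|exact: IH er| |].
    exact: typed_lin_ren tt eX eG.
  exact: typed_lin_ren tu eX eG.
- move=> Xi G Th h k a b _ IHh _ IHk Xi' G' Th' r er.
  have wk l : rl_ren (rty r) (upr (upr (rtm r))) (rrl r) (wkr 0 2 0 l)
    = wkr 0 2 0 (rl_ren (rty r) (rtm r) (rrl r) l) by sig.
  by rewrite !wk; apply: adm_and; [exact: IHh|exact: IHk].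
- move=> Xi G Th p h a b _ IHp _ IHh Xi' G' Th' r er.
  have -> : rl_ren (rty r) (upr (upr (rtm r))) (rrl r) (wkr 0 2 0 h)
    = wkr 0 2 0 (rl_ren (rty r) (rtm r) (rrl r) h) by sig.
  have -> : pr_ren (rty r) (upr (upr (rtm r))) (rrl r) (wkp 0 2 0 p)
    = wkp 0 2 0 (pr_ren (rty r) (rtm r) (rrl r) p) by sig.
  by apply: adm_imp; [exact: IHp|exact: IHh].
- move=> Xi G Th h a b wa wb _ IH Xi' G' Th' r er; have [eX _ _] := er.
  have -> : rl_ren (upr (rty r)) (upr (upr (rtm r))) (rrl r) (wkr 0 2 0 h)
    = wkr 0 2 0 (rl_ren (upr (rty r)) (rtm r) (rrl r) h) by sig.
  apply: adm_allTy; [exact: wf_ty_ren wa eX|exact: wf_ty_ren wb eX|].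
  have := IH _ _ _ _ (upRT _ _ _ _ _ _ _ er) => /=.
  have wk c : ty_ren (upr (rty r)) (wkT 1 c) = wkT 1 (ty_ren (rty r) c) by sig.
  by rewrite !wk.
- move=> Xi G Th c h a b wc _ IH Xi' G' Th' r er; have [eX _ _] := er.
  have -> : rl_ren (rty r) (upr (upr (upr (rtm r)))) (rrl r)
      (rl_ren id (upr (addn 2)) id h)
    = rl_ren id (upr (addn 2)) id (rl_ren (rty r) (upr (rtm r)) (rrl r) h) by sig.
  apply: adm_allTm; first exact: wf_ty_ren wc eX.
  exact: IH (upRt _ _ _ _ _ _ _ c er).
- move=> Xi G Th b c c' h a b' wc wc' _ IH Xi' G' Th' r er; have [eX _ _] := er.
  have -> : rl_ren (rty r) (upr (upr (rtm r))) (upr (rrl r)) (wkr 0 2 0 h)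
    = wkr 0 2 0 (rl_ren (rty r) (rtm r) (upr (rrl r)) h) by sig.
  apply: adm_allRel; [exact: wf_ty_ren wc eX|exact: wf_ty_ren wc' eX|].
  exact: IH (upRR _ _ _ _ _ _ _ b c c' er).
- move=> Xi G Th a hs ts us wa aa IH Xi' G' Th' r er.
  have [st su] := are_adm_size aa.
  (* The variables of [a] point into the lists and not into the context, so the renaming leaves [a]
     untouched and acts on the entries. *)
  have E vs : size vs = size hs -> ty_ren (rty r) (ty_sub (tsub_of vs) a)
     = ty_sub (tsub_of (map (ty_ren (rty r)) vs)) a.
    move=> sv; rewrite ty_ren_sub; apply: ty_sub_wf wa _ => i ih.
    by rewrite tsub_of_map // sv.
  by rewrite (E _ st) (E _ su); apply: adm_ty; [rewrite size_map|exact: IH].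
- by move=> *; apply: aa_nil.
- by move=> Xi G Th h hs a ts b us _ IH _ IHs Xi' G' Th' r er; apply: aa_cons;
    [exact: IH|exact: IHs].
Qed.

(** * Derivability stable under weakening *)

Notation tyr r := (ty_ren (rty r)).
Notation tmr r := (tm_ren (rty r) (rtm r)).
Notation rlr r := (rl_ren (rty r) (rtm r) (rrl r)).
Notation prr r := (pr_ren (rty r) (rtm r) (rrl r)).

Record world : Type := World { wX : nat; wG : tctx; wT : rctx; wP : seq lprop }.

(** A hypothesis only has to reappear at some position, so that extending a world by a type, a term,
    a relation or a hypothesis is in each case a morphism. *)
Definition morph (W W' : world) (r : ren) : Prop :=
  ren_ctx r (wX W) (wG W) (wT W) (wX W') (wG W') (wT W') /\
  forall i p, onth (wP W) i = Some p -> exists j, onth (wP W') j = Some (prr r p).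

Definition rid : ren := Ren id id id.
Definition rcomp (r r' : ren) : ren :=
  Ren (rty r' \o rty r) (rtm r' \o rtm r) (rrl r' \o rrl r).

Lemma ty_ren_id a : ty_ren id a = a. Proof. sig. Qed.
Lemma rl_ren_id h : rl_ren id id id h = h. Proof. sig. Qed.
Lemma pr_ren_id p : pr_ren id id id p = p.
Proof. by rewrite pr_renE; apply: pr_sub_id. Qed.

Lemma morph_id W : morph W W rid.
Proof.
split; last by move=> i p e; exists i; rewrite pr_ren_id.
split=> //= [i a e|i b a a' e]; rewrite !ty_ren_id //.
Qed.

Lemma morph_comp W W' W'' r r' : morph W W' r -> morph W' W'' r' ->
  morph W W'' (rcomp r r').
Proof.
case=> [[eX eG eT] eP] [[eX' eG' eT'] eP']; split; first split.
- by move=> i /eX /eX'.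
- by move=> i a /eG /eG' /=; rewrite ty_ren_ren.
- by move=> i b a a' /eT /eT' /=; rewrite !ty_ren_ren.
move=> i p /eP[j /eP'[k e]]; exists k; by rewrite e pr_ren_ren.
Qed.

Definition wf W a : Prop := wf_ty (wX W) a.
Definition el W t a : Prop := wt (wX W) (wG W) t a.
Definition prp W p : Prop := is_prop (wX W) (wG W) (wT W) p.
Definition rel W h a b : Prop :=
  [/\ is_rel (wX W) (wG W) (wT W) h a b, wf W a & wf W b].
Definition adm W h a b : Prop :=
  [/\ is_adm (wX W) (wG W) (wT W) h a b, wf W a & wf W b].

Definition derivable W p : Prop :=
  derives parametricity (wX W) (wG W) (wT W) (wP W) p.

(* Quantifying over all renamings makes [holds] stable under weakening without
   an induction on derivations. *)
Definition holds W p : Prop :=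
  forall W' r, morph W W' r -> derivable W' (prr r p).

Definition eqv W a t u : Prop := [/\ el W t a, el W u a & holds W (PEq a t u)].
(** The typing judgements travel with the derivability because the rules of the logic ask for them
    again at every use. *)
Definition rl W h a b t u : Prop :=
  [/\ rel W h a b, el W t a, el W u b & holds W (PRel h t u)].

Lemma wf_ren W W' r a : morph W W' r -> wf W a -> wf W' (tyr r a).
Proof. by case=> [[eX _ _] _] w; apply: wf_ty_ren w eX. Qed.

Lemma el_ren W W' r t a : morph W W' r -> el W t a -> el W' (tmr r t) (tyr r a).
Proof. by case=> [[eX eG _] _] w; apply: wt_ren w eX eG. Qed.

Lemma prp_ren W W' r p : morph W W' r -> prp W p -> prp W' (prr r p).
Proof. by case=> e _ w; apply: is_lapl_ren.1 w _ _ _ _ e. Qed.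

Lemma rel_ren W W' r h a b : morph W W' r -> rel W h a b ->
  rel W' (rlr r h) (tyr r a) (tyr r b).
Proof.
move=> e [w wa wb]; split; [|exact: wf_ren e wa|exact: wf_ren e wb].
exact: is_lapl_ren.2.1 w _ _ _ _ e.1.
Qed.

Lemma adm_ren W W' r h a b : morph W W' r -> adm W h a b ->
  adm W' (rlr r h) (tyr r a) (tyr r b).
Proof.
move=> e [w wa wb]; split; [|exact: wf_ren e wa|exact: wf_ren e wb].
exact: is_lapl_ren.2.2.1 w _ _ _ _ e.1.
Qed.

Lemma holds_ren W W' r p : morph W W' r -> holds W p -> holds W' (prr r p).
Proof.
move=> e H W'' r' e'; rewrite pr_ren_ren; exact: H (morph_comp e e').
Qed.

Lemma rl_morph W W' r h a b t u : morph W W' r -> rl W h a b t u ->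
  rl W' (rlr r h) (tyr r a) (tyr r b) (tmr r t) (tmr r u).
Proof.
move=> e [rh et eu hh]; split; [exact: rel_ren e rh|exact: el_ren e et|
  exact: el_ren e eu|exact: holds_ren e hh].
Qed.

Lemma holds_derivable W p : holds W p -> derivable W p.
Proof. by move/(_ W rid (morph_id W)); rewrite pr_ren_id. Qed.

Lemma adm_rel W h a b : adm W h a b -> rel W h a b.
Proof. by case=> ah wa wb; split=> //; apply: ir_adm. Qed.

Definition wty W := World (wX W).+1 (tctx_wkT (wG W)) (rctx_wkT (wT W))
  (map (wkp 1 0 0) (wP W)).
Definition wtm a W := World (wX W) (a :: wG W) (wT W) (map (wkp 0 1 0) (wP W)).
Definition wrl b a a' W := World (wX W) (wG W) (RelSort b a a' :: wT W)
  (map (wkp 0 0 1) (wP W)).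
Definition why p W := World (wX W) (wG W) (wT W) (p :: wP W).

Definition rwk l m n : ren := Ren (addn l) (addn m) (addn n).

Lemma morph_wty W : morph W (wty W) (rwk 1 0 0).
Proof.
split; last by move=> i p e; exists i; exact: onth_map_some.
split=> //= [i a e|i b a a' e]; first exact: onth_map_some.
by rewrite (onth_map_some _ e).
Qed.

Lemma morph_wtm a W : morph W (wtm a W) (rwk 0 1 0).
Proof.
split; last by move=> i p e; exists i; exact: onth_map_some.
by split=> //= [i c e|i b c c' e]; rewrite !ty_ren0.
Qed.

Lemma morph_wrl b a a' W : morph W (wrl b a a' W) (rwk 0 0 1).
Proof.
split; last by move=> i p e; exists i; exact: onth_map_some.
by split=> //= [i c e|i d c c' e]; rewrite !ty_ren0.
Qed.

Lemma morph_why p W : morph W (why p W) rid.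
Proof.
split; last by move=> i q e; exists i.+1; rewrite pr_ren_id.
exact: (morph_id W).1.
Qed.

Lemma holds_hyp W i p : onth (wP W) i = Some p -> holds W p.
Proof. by move=> e W' r [_ /(_ _ _ e)[j ej]]; apply: d_hyp ej. Qed.

(** The Kripke premise is used only at the extension of a world by the hypothesis itself, where that
    hypothesis is derivable. *)
Lemma holds_impI W p q : prp W p ->
  (forall W' r, morph W W' r -> holds W' (prr r p) -> holds W' (prr r q)) ->
  holds W (PImp p q).
Proof.
move=> pp K W1 r1 e1; apply: d_impI; first exact: prp_ren e1 pp.
have e2 := morph_comp e1 (morph_why (prr r1 p) W1).
by apply: holds_derivable (K _ _ e2 _); apply: (@holds_hyp _ 0).
Qed.

Lemma holds_impE W p q : holds W (PImp p q) -> holds W p -> holds W q.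
Proof. by move=> hpq hp W' r e; apply: d_impE (hpq _ _ e) (hp _ _ e). Qed.

Lemma holds_andE W p q : holds W (PAnd p q) -> holds W p /\ holds W q.
Proof.
move=> h; split=> W' r e; [exact: d_andE1 (h _ _ e)|exact: d_andE2 (h _ _ e)].
Qed.

Lemma derivable_eq W p q : derivable W p -> p = q -> derivable W q.
Proof. by move=> h <-. Qed.

Lemma holds_allTmE W a p t : holds W (PAllTm a p) -> el W t a ->
  holds W (pinst_tm p t).
Proof.
move=> h et W' r e.
have h' : derivable W' (PAllTm (tyr r a)
  (pr_ren (rty r) (upr (rtm r)) (rrl r) p)) := h _ _ e.
apply: derivable_eq (d_allTmE (proj2 (typed_wt _ _ _ _) (el_ren e et)) h') _.
sig.
Qed.

Lemma holds_allTyE W p a : holds W (PAllTy p) -> wf W a -> holds W (pinst_ty p a).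
Proof.
move=> h wa W' r e; have h' : derivable W' (PAllTy
  (pr_ren (upr (rty r)) (rtm r) (rrl r) p)) := h _ _ e.
apply: derivable_eq (d_allTyE (wf_ren e wa) h') _.
sig.
Qed.

Lemma holds_allRelE W a a' p h : holds W (PAllRel true a a' p) -> adm W h a a' ->
  holds W (pinst_rel p h).
Proof.
move=> H ah W' r e; 
have H' : derivable W' (PAllRel true (tyr r a) (tyr r a')
  (pr_ren (rty r) (rtm r) (upr (rrl r)) p)) := H _ _ e.
apply: derivable_eq (@d_allRelE _ _ _ _ _ true _ _ _ _ (let: And3 x _ _ := adm_ren e ah in x) H') _.
sig.
Qed.

Lemma relbeta W a b p t u : rel W (RAbs a b p) a b -> el W t a -> el W u b ->
  holds W (PRel (RAbs a b p) t u) <-> holds W (pinst2 p t u).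
Proof.
move=> rh et eu.
have : holds W (PIff (PRel (RAbs a b p) t u) (pinst2 p t u)).
  move=> W' r e.
  have rh' : is_rel (wX W') (wG W') (wT W') (RAbs (tyr r a) (tyr r b)
    (pr_ren (rty r) (upr (upr (rtm r))) (rrl r) p)) (tyr r a) (tyr r b).
    by case: (rel_ren e rh).
  apply: derivable_eq (d_relbeta parametricity (wP W') rh'
    (proj2 (typed_wt _ _ _ _) (el_ren e et)) (proj2 (typed_wt _ _ _ _) (el_ren e eu))) _.
  sig.
by case/holds_andE=> h1 h2; split; apply: holds_impE.
Qed.

Lemma leibniz W a p t u : prp (wtm a W) p -> eqv W a t u ->
  holds W (pinst_tm p t) -> holds W (pinst_tm p u).
Proof.
move=> pp [et eu h] ht W' r e.
have E v : prr r (pinst_tm p v)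
  = pinst_tm (pr_ren (rty r) (upr (rtm r)) (rrl r) p) (tmr r v) by sig.
rewrite E; apply: d_leibniz (h _ _ e) _; last by have := ht _ _ e; rewrite E.
case: e => [[eX eG eT] _]; apply: is_lapl_ren.1 pp _ _ _ (Ren _ _ _) _.
by split=> //=; exact: ren_tm_up.
Qed.

Lemma eqv_refl W a t : el W t a -> eqv W a t t.
Proof.
move=> et; split=> // W' r e; apply: d_exteq; apply: ee_refl.
by apply/typed_wt; apply: el_ren e et.
Qed.

Lemma el_wtm W a b t : el W t a -> el (wtm b W) (wkt 0 1 t) a.
Proof. by move/(el_ren (morph_wtm b W)); rewrite /= ty_ren0. Qed.

Lemma rel_wtm W h a b c : rel W h a b -> rel (wtm c W) (wkr 0 1 0 h) a b.
Proof. by move/(rel_ren (morph_wtm c W)); rewrite /= !ty_ren0. Qed.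

Lemma el_var W i a : onth (wG W) i = Some a -> el W (Var i) a.
Proof. by move=> e; split=> //; apply: sty_var. Qed.

Lemma el_sub1 W a t u b : el (wtm a W) t b -> el W u a ->
  el W (tm_sub TVar (scons u Var) t) b.
Proof.
case=> st lt [su lu]; split; last by apply: lin_sub => // -[].
rewrite -[b]ty_sub_id; apply: sty_sub st _ _ => // -[|i] c /=; rewrite ty_sub_id.
  by case=> <-.
exact: sty_var.
Qed.

Lemma eqv_sub W a t u b c : eqv W a t u -> el (wtm a W) c b ->
  eqv W b (tm_sub TVar (scons t Var) c) (tm_sub TVar (scons u Var) c).
Proof.
move=> e ec; have [et eu _] := e.
have et' := el_sub1 ec et; have eu' := el_sub1 ec eu.
split=> //.
(* Leibniz is applied to the predicate that sends [v] to the equation [c[t] = c[v]]; its left side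
   is weakened so as to stay fixed. *)
have E v : PEq b (tm_sub TVar (scons t Var) c) (tm_sub TVar (scons v Var) c)
   = pinst_tm (PEq b (wkt 0 1 (tm_sub TVar (scons t Var) c)) c) v by sig.
rewrite E; apply: leibniz e _.
  by apply: ip_eq; apply/typed_wt; [exact: el_wtm|].
by rewrite -E; case: (eqv_refl et').
Qed.

Lemma eqv_sym W a t u : eqv W a t u -> eqv W a u t.
Proof.
move=> e; have [et eu h] := e; split=> //.
have E v : PEq a v t = pinst_tm (PEq a (Var 0) (wkt 0 1 t)) v by sig.
rewrite E; apply: leibniz e _; last by rewrite -E; case: (eqv_refl et).
by apply: ip_eq; apply/typed_wt; [exact: el_var|exact: el_wtm].
Qed.

Lemma eqv_trans W a t u v : eqv W a t u -> eqv W a u v -> eqv W a t v.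
Proof.
move=> e1 e; have [et eu h] := e1; have [_ ev _] := e; split=> //.
have E w : PEq a t w = pinst_tm (PEq a (wkt 0 1 t) (Var 0)) w by sig.
rewrite E; apply: leibniz e _; last by rewrite -E.
by apply: ip_eq; apply/typed_wt; [exact: el_wtm|exact: el_var].
Qed.

Lemma rl_eqv_l W h a b t t' u : rl W h a b t u -> eqv W a t t' -> rl W h a b t' u.
Proof.
move=> [rh et eu hh] e; have [_ et' _] := e; split=> //.
have E v : PRel h v u = pinst_tm (PRel (wkr 0 1 0 h) (Var 0) (wkt 0 1 u)) v by sig.
rewrite E; apply: leibniz e _; last by rewrite -E.
have [rh' _ _] := rel_wtm a rh.
by apply: ip_rel rh' _ _; apply/typed_wt; [exact: el_var|exact: el_wtm].
Qed.

Lemma rl_eqv_r W h a b t u u' : rl W h a b t u -> eqv W b u u' -> rl W h a b t u'.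
Proof.
move=> [rh et eu hh] e; have [_ et' _] := e; split=> //.
have E v : PRel h t v = pinst_tm (PRel (wkr 0 1 0 h) (wkt 0 1 t) (Var 0)) v by sig.
rewrite E; apply: leibniz e _; last by rewrite -E.
have [rh' _ _] := rel_wtm b rh.
by apply: ip_rel rh' _ _; apply/typed_wt; [exact: el_wtm|exact: el_var].
Qed.

Lemma rl_eqv W h a b t t' u u' : rl W h a b t u -> eqv W a t t' -> eqv W b u u' ->
  rl W h a b t' u'.
Proof. by move=> h1 et eu; apply: rl_eqv_r eu; apply: rl_eqv_l et. Qed.

(** * Rules of inference *)

Lemma el_app W a b t u : el W t (TLolli a b) -> el W u a -> el W (App t u) b.
Proof. by case=> st lt [su lu]; split; [exact: sty_app st su|rewrite /= lt]. Qed.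

Lemma el_lam W a b t : wf W a -> el (wtm a W) t b -> occ 0 t = 1 ->
  el W (Lam a t) (TLolli a b).
Proof. by move=> wa [st lt] o; split; [exact: sty_lam|rewrite /= o]. Qed.

Lemma el_tens W a b t u : el W t a -> el W u b -> el W (Tens t u) (TTens a b).
Proof. by case=> st lt [su lu]; split; [exact: sty_tens|rewrite /= lt]. Qed.

Lemma el_bang W a t : el W t a -> el W (Bang t) (TBang a).
Proof. by case=> st lt; split; [exact: sty_bang|]. Qed.

Lemma el_tlam W a t : el (wty W) t a -> el W (TLam t) (TPi a).
Proof. by case=> st lt; split; [exact: sty_tlam|]. Qed.

Lemma el_tapp W a b c t : el W t (TPi a) -> wf W b -> c = tinst a b ->
  el W (TApp t b) c.
Proof. by case=> st lt wb e; split; [exact: sty_tapp st e|]. Qed.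

Lemma el_letT W a b c s t : el W s (TTens a b) -> el (wtm b (wtm a W)) t c ->
  occ 0 t = 1 -> occ 1 t = 1 -> el W (LetT s t) c.
Proof.
by case=> ss ls [st lt] o0 o1; split; [exact: sty_letT ss st|rewrite /= o0 o1 ls].
Qed.

Lemma el_letB W a c s t : el W s (TBang a) -> el (wtm a W) t c -> el W (LetB s t) c.
Proof. by case=> ss ls [st lt]; split; [exact: sty_letB ss st|rewrite /= ls]. Qed.

Lemma el_wk2 W a b c t : el W t a -> el (wtm c (wtm b W)) (wkt 0 2 t) a.
Proof.
move=> et; have -> : wkt 0 2 t = wkt 0 1 (wkt 0 1 t) by sig.
by do 2 apply: el_wtm.
Qed.

(** The equation must be derived in all later worlds, hence the axiom is demanded for all renamings
    of the two terms. *)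
Lemma eqv_ax W a t u : el W t a -> el W u a ->
  (forall rt r, eq_ax (tm_ren rt r t) (tm_ren rt r u)) -> eqv W a t u.
Proof.
move=> et eu ax; split=> // W' r e; apply: d_exteq; apply: ee_ax; first exact: ax.
  by apply/typed_wt; apply: el_ren e et.
by apply/typed_wt; apply: el_ren e eu.
Qed.

Lemma eqv_beta W a b t u v : el (wtm a W) t b -> occ 0 t = 1 -> wf W a -> el W u a ->
  v = tm_sub TVar (scons u Var) t -> eqv W b (App (Lam a t) u) v.
Proof.
move=> et o wa eu ->; apply: eqv_ax.
- by apply: el_app eu; apply: el_lam.
- exact: el_sub1 et eu.
move=> rt r /=.
have -> : tm_ren rt r (tm_sub TVar (scons u Var) t)
  = tm_sub TVar (scons (tm_ren rt r u) Var) (tm_ren rt (upr r) t) by sig.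
exact: beta_lam.
Qed.

Lemma el_subT W a t b : el (wty W) t a -> wf W b ->
  el W (tm_sub (scons b TVar) Var t) (tinst a b).
Proof.
case=> st lt wb; split; last exact: lin_sub.
apply: sty_sub st _ _; first by case.
move=> i c ei; have [d ed ->] := onth_map_inv ei.
apply: sty_var; rewrite ed; congr Some; sig.
Qed.

Lemma eqv_tbeta W a t b c v : el (wty W) t a -> wf W b -> c = tinst a b ->
  v = tm_sub (scons b TVar) Var t -> eqv W c (TApp (TLam t) b) v.
Proof.
move=> et wb -> ->; apply: eqv_ax.
- by apply: el_tapp wb _ => //; apply: el_tlam.
- exact: el_subT.
move=> rt r /=.
have -> : tm_ren rt r (tm_sub (scons b TVar) Var t)
  = tm_sub (scons (ty_ren rt b) TVar) Var (tm_ren (upr rt) r t) by sig.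
exact: beta_tlam.
Qed.

Lemma el_sub2 W a b c s u t : el (wtm b (wtm a W)) t c -> el W s a -> el W u b ->
  el W (tm_sub TVar (scons u (scons s Var)) t) c.
Proof.
case=> st lt [ss ls] [su lu]; split; last by apply: lin_sub => // -[|[]].
rewrite -[c]ty_sub_id; apply: sty_sub st _ _ => // -[|[|i]] d /=; rewrite ty_sub_id.
- by case=> <-.
- by case=> <-.
exact: sty_var.
Qed.

Lemma eqv_betaT W a b c s u t v : el W s a -> el W u b ->
  el (wtm b (wtm a W)) t c -> occ 0 t = 1 -> occ 1 t = 1 ->
  v = tm_sub TVar (scons u (scons s Var)) t -> eqv W c (LetT (Tens s u) t) v.
Proof.
move=> es eu et o0 o1 ->; apply: eqv_ax.
- by apply: el_letT et o0 o1; apply: el_tens.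
- exact: el_sub2 et es eu.
move=> rt r /=.
have -> : tm_ren rt r (tm_sub TVar (scons u (scons s Var)) t)
  = tm_sub TVar (scons (tm_ren rt r u) (scons (tm_ren rt r s) Var))
      (tm_ren rt (upr (upr r)) t) by sig.
exact: beta_tens.
Qed.

Lemma eqv_betaB W a b u t v : el W u a -> el (wtm a W) t b ->
  v = tm_sub TVar (scons u Var) t -> eqv W b (LetB (Bang u) t) v.
Proof.
move=> eu et ->; apply: eqv_ax.
- by apply: el_letB et; apply: el_bang.
- exact: el_sub1 et eu.
move=> rt r /=.
have -> : tm_ren rt r (tm_sub TVar (scons u Var) t)
  = tm_sub TVar (scons (tm_ren rt r u) Var) (tm_ren rt (upr r) t) by sig.
exact: beta_bang.
Qed.

Lemma eqv_sub' W a t u b c t' u' : eqv W a t u -> el (wtm a W) c b ->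
  t' = tm_sub TVar (scons t Var) c -> u' = tm_sub TVar (scons u Var) c ->
  eqv W b t' u'.
Proof. by move=> e ec -> ->; apply: eqv_sub e ec. Qed.

Lemma eqv_app W a b f g x y : eqv W (TLolli a b) f g -> eqv W a x y ->
  eqv W b (App f x) (App g y).
Proof.
move=> ef ex; have [_ eg _] := ef; have [ex' _ _] := ex.
apply: (@eqv_trans _ _ _ (App g x)).
  apply: eqv_sub' ef (_ : el _ (App (Var 0) (wkt 0 1 x)) _) _ _; [|sig|sig].
  by apply: el_app (el_wtm _ ex'); apply: el_var.
apply: eqv_sub' ex (_ : el _ (App (wkt 0 1 g) (Var 0)) _) _ _; [|sig|sig].
by apply: el_app; [exact: el_wtm eg|apply: el_var].
Qed.

Lemma eqv_tens W a b f g x y : eqv W a f g -> eqv W b x y ->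
  eqv W (TTens a b) (Tens f x) (Tens g y).
Proof.
move=> ef ex; have [_ eg _] := ef; have [ex' _ _] := ex.
apply: (@eqv_trans _ _ _ (Tens g x)).
  apply: eqv_sub' ef (_ : el _ (Tens (Var 0) (wkt 0 1 x)) _) _ _; [|sig|sig].
  by apply: el_tens (el_wtm _ ex'); apply: el_var.
apply: eqv_sub' ex (_ : el _ (Tens (wkt 0 1 g) (Var 0)) _) _ _; [|sig|sig].
by apply: el_tens; [exact: el_wtm eg|apply: el_var].
Qed.

Lemma eqv_bang W a x y : eqv W a x y -> eqv W (TBang a) (Bang x) (Bang y).
Proof.
move=> ex; apply: eqv_sub' ex (_ : el _ (Bang (Var 0)) _) _ _ => //.
by apply: el_bang; apply: el_var.
Qed.

Lemma eqv_tapp W a b c x y : eqv W (TPi a) x y -> wf W b -> c = tinst a b ->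
  eqv W c (TApp x b) (TApp y b).
Proof.
move=> ex wb ->; apply: eqv_sub' ex (_ : el _ (TApp (Var 0) b) _) _ _; [|sig|sig].
by apply: el_tapp; [exact: el_var|exact: wb|].
Qed.

Lemma eqv_letT W a b c s s' t : eqv W (TTens a b) s s' ->
  el (wtm b (wtm a W)) t c -> occ 0 t = 1 -> occ 1 t = 1 ->
  eqv W c (LetT s t) (LetT s' t).
Proof.
move=> es et o0 o1.
apply: eqv_sub' es (_ : el _ (LetT (Var 0) (tm_ren id (upr (upr succn)) t)) _) _ _;
  [|sig|sig].
have o i : i < 2 -> occ i (tm_ren id (upr (upr succn)) t) = occ i t.
  by move=> i2; apply: occ_ren; case: i i2 => [|[|]] // _ [|[|]].
apply: el_letT (el_var _) _ _ _; rewrite ?o //.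
rewrite -[c]ty_ren_id; case: et => st lt; split; last by rewrite lin_ren.
by apply: sty_ren st _ _ => // -[|[|i]] d /=; rewrite ty_ren_id.
Qed.

Lemma eqv_ext W a b t u : wf W a -> el W t (TLolli a b) -> el W u (TLolli a b) ->
  (forall W' r x, morph W W' r -> el W' x (tyr r a) ->
     eqv W' (tyr r b) (App (tmr r t) x) (App (tmr r u) x)) ->
  eqv W (TLolli a b) t u.
Proof.
move=> wa et eu K; split=> // W' r e.
apply: d_impE; first apply: d_theory.
  by left; apply: ext_lolli; apply/typed_wt; [exact: el_ren e et|exact: el_ren e eu].
apply: d_allTmI; first exact: wf_ren e wa.
have e' := morph_comp e (morph_wtm (tyr r a) W').
have [|_ _] := K _ _ (Var 0) e'; first by apply: el_var; rewrite /=; congr Some; sig.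
by move/holds_derivable => h; apply: derivable_eq h _; sig.
Qed.

Lemma eqv_extT W a t u : el W t (TPi a) -> el W u (TPi a) ->
  (forall W' r c, morph W W' r -> wf W' c ->
     eqv W' (ty_sub (scons c (TVar \o rty r)) a) (TApp (tmr r t) c) (TApp (tmr r u) c)) ->
  eqv W (TPi a) t u.
Proof.
move=> et eu K; split=> // W' r e.
apply: d_impE; first apply: d_theory.
  by left; apply: ext_pi; apply/typed_wt; [exact: el_ren e et|exact: el_ren e eu].
apply: d_allTyI.
have e' := morph_comp e (morph_wty W').
have [//|_ _] := K _ _ (TVar 0) e'.
by move/holds_derivable => h; apply: derivable_eq h _; sig.
Qed.

(** * Introduction and elimination rules for the relational constructions *)

Lemma rel_at W W' r h a b h' a' b' : morph W W' r -> rel W h a b ->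
  h' = rlr r h -> a' = tyr r a -> b' = tyr r b -> rel W' h' a' b'.
Proof. by move=> e rh -> -> ->; apply: rel_ren e rh. Qed.

Lemma prp_rel W h a b t u : rel W h a b -> el W t a -> el W u b -> prp W (PRel h t u).
Proof. by case=> rh _ _ et eu; apply: ip_rel rh _ _; apply/typed_wt. Qed.

Lemma rel_abs W a b p : wf W a -> wf W b -> prp (wtm b (wtm a W)) p ->
  rel W (RAbs a b p) a b.
Proof. by move=> wa wb pp; split=> //; apply: ir_abs. Qed.

Lemma rel_req W a : wf W a -> rel W (req a) a a.
Proof. by move=> wa; split=> //; apply: ir_adm; apply: adm_eq. Qed.

Lemma adm_req W a : wf W a -> adm W (req a) a a.
Proof. by move=> wa; split=> //; apply: adm_eq. Qed.

Lemma wf_lolli W a b : wf W a -> wf W b -> wf W (TLolli a b).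
Proof. by rewrite /wf /= => -> ->. Qed.

Lemma reqP W a t u : wf W a -> rl W (req a) a a t u <-> eqv W a t u.
Proof.
move=> wa; have rr := rel_req wa; split=> -[].
  by move=> _ et eu /(relbeta rr et eu); rewrite /pinst2 /= ty_sub_id.
by move=> et eu h; split=> //; apply/(relbeta rr et eu); rewrite /pinst2 /= ty_sub_id.
Qed.

Lemma morph_wtm2 a b W : morph W (wtm b (wtm a W)) (rwk 0 2 0).
Proof. exact: morph_comp (morph_wtm a W) (morph_wtm b _). Qed.

Lemma morph_wtm4 a b c d W : morph W (wtm d (wtm c (wtm b (wtm a W)))) (rwk 0 4 0).
Proof. exact: morph_comp (morph_wtm2 a b W) (morph_wtm2 c d _). Qed.

Ltac el_at := apply: el_var; rewrite /=; try (congr Some; sig).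

Lemma prp_rlolli W a b a' b' h h' : rel W h a b -> rel W h' a' b' ->
  prp (wtm (TLolli b b') (wtm (TLolli a a') W))
    (PAllTm a (PAllTm b
      (PImp (PRel (wkr 0 4 0 h) (Var 1) (Var 0))
            (PRel (wkr 0 4 0 h') (App (Var 3) (Var 1)) (App (Var 2) (Var 0)))))).
Proof.
move=> rh rh'; have [_ wa wb] := rh; have [_ wa' wb'] := rh'.
do 2 (apply: ip_allTm => //); apply: ip_imp.
  apply: (@prp_rel (wtm b (wtm a (wtm _ (wtm _ W)))) _ a b); [|el_at|el_at].
  by apply: rel_at (morph_wtm4 _ _ _ _ _) rh _ _ _ => //=; rewrite ty_ren0.
apply: (@prp_rel (wtm b (wtm a (wtm _ (wtm _ W)))) _ a' b').
- by apply: rel_at (morph_wtm4 _ _ _ _ _) rh' _ _ _ => //=; rewrite ty_ren0.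
- by apply: (@el_app _ a); el_at.
by apply: (@el_app _ b); el_at.
Qed.

Lemma rel_rlolli W a b a' b' h h' : rel W h a b -> rel W h' a' b' ->
  rel W (rlolli a b a' b' h h') (TLolli a a') (TLolli b b').
Proof.
move=> rh rh'; have [_ wa wb] := rh; have [_ wa' wb'] := rh'.
by apply: rel_abs; [exact: wf_lolli|exact: wf_lolli|exact: prp_rlolli].
Qed.

Lemma rlolli_ren r a b a' b' h h' :
  rlr r (rlolli a b a' b' h h')
  = rlolli (tyr r a) (tyr r b) (tyr r a') (tyr r b') (rlr r h) (rlr r h').
Proof. sig. Qed.

Lemma der_imp W p q p' q' : p = p' -> q = q' -> prp W p' ->
  (holds (why p' W) p' -> holds (why p' W) q') -> derivable W (PImp p q).
Proof.
move=> -> -> pp K; apply: d_impI => //.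
by apply: (@holds_derivable (why p' W)); apply: K; apply: (@holds_hyp _ 0).
Qed.

(** The Kripke premise is instantiated at two fresh variables assumed to be related; the
    introduction rules for the other relational constructions follow the same pattern. *)
Lemma rlolliI W a b a' b' h h' f g : rel W h a b -> rel W h' a' b' ->
  el W f (TLolli a a') -> el W g (TLolli b b') ->
  (forall W' r x y, morph W W' r -> rl W' (rlr r h) (tyr r a) (tyr r b) x y ->
     rl W' (rlr r h') (tyr r a') (tyr r b') (App (tmr r f) x) (App (tmr r g) y)) ->
  rl W (rlolli a b a' b' h h') (TLolli a a') (TLolli b b') f g.
Proof.
move=> rh rh' ef eg K; have [_ wa wb] := rh.
have rr := rel_rlolli rh rh'; split=> //; apply/(relbeta rr ef eg) => W' r e.
do 2 (apply: d_allTmI => /=; first by rewrite ty_sub_id; apply: wf_ren e _).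
rewrite !ty_sub_id.
set W1 := wtm (tyr r b) (wtm (tyr r a) W').
have e1 := morph_comp e (morph_wtm2 (tyr r a) (tyr r b) W').
have rh1 : rel W1 (rlr (rcomp r (rwk 0 2 0)) h) (tyr r a) (tyr r b).
  apply: rel_at e1 rh _ _ _ => //=; sig.
have E0 : el W1 (Var 0) (tyr r b) by el_at.
have E1 : el W1 (Var 1) (tyr r a) by el_at.
apply: (@der_imp W1 _ _ (PRel (rlr (rcomp r (rwk 0 2 0)) h) (Var 1) (Var 0))
  (PRel (rlr (rcomp r (rwk 0 2 0)) h') (App (tmr (rcomp r (rwk 0 2 0)) f) (Var 1))
     (App (tmr (rcomp r (rwk 0 2 0)) g) (Var 0)))); [sig|sig|exact: prp_rel rh1 _ _|].
set P := PRel _ _ _ => hp; have e2 := morph_comp e1 (morph_why P W1).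
have hx : rl (why P W1) (rlr (rcomp r (rwk 0 2 0)) h) (tyr r a) (tyr r b) (Var 1) (Var 0).
  by split.
by case: (K _ _ (Var 1) (Var 0) e2 hx).
Qed.

Lemma rlolliE W a b a' b' h h' f g x y : rel W h' a' b' ->
  rl W (rlolli a b a' b' h h') (TLolli a a') (TLolli b b') f g ->
  rl W h a b x y -> rl W h' a' b' (App f x) (App g y).
Proof.
move=> rh' [rr ef eg hh] [rh ex ey hxy]; split=> //.
- exact: el_app ef ex.
- exact: el_app eg ey.
have /(relbeta rr ef eg) hp := hh.
rewrite /pinst2 /= in hp; have hp1 := holds_allTmE hp.
rewrite ty_sub_id in hp1; have {hp hp1} := hp1 _ ex.
rewrite /pinst_tm /= => hp; have hp1 := holds_allTmE hp.
rewrite !ty_sub_id in hp1; have {hp hp1} := hp1 _ ey.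
rewrite /pinst_tm /= => hp.
suff: holds W (PImp (PRel h x y) (PRel h' (App f x) (App g y))).
  by move/holds_impE; apply.
by move: hp; congr holds; sig.
Qed.

Lemma rel_rarr W a b a' b' h h' : rel W h a b -> rel W h' a' b' ->
  rel W (rarr a b a' b' h h') (TArr a a') (TArr b b').
Proof.
move=> rh rh'; have [_ wa wb] := rh; have [_ wa' wb'] := rh'.
apply: rel_abs; [exact: wf_lolli|exact: wf_lolli|].
do 2 (apply: ip_allTm => //); apply: ip_imp.
  apply: (@prp_rel (wtm b (wtm a (wtm _ (wtm _ W)))) _ a b); [|el_at|el_at].
  by apply: rel_at (morph_wtm4 _ _ _ _ _) rh _ _ _ => //=; rewrite ty_ren0.
apply: (@prp_rel (wtm b (wtm a (wtm _ (wtm _ W)))) _ a' b').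
- by apply: rel_at (morph_wtm4 _ _ _ _ _) rh' _ _ _ => //=; rewrite ty_ren0.
- by apply: (@el_app _ (TBang a)); [el_at|apply: el_bang; el_at].
by apply: (@el_app _ (TBang b)); [el_at|apply: el_bang; el_at].
Qed.

Lemma rarr_ren r a b a' b' h h' :
  rlr r (rarr a b a' b' h h')
  = rarr (tyr r a) (tyr r b) (tyr r a') (tyr r b') (rlr r h) (rlr r h').
Proof. sig. Qed.

Lemma der_allTm W a a' p : a = a' -> wf W a' -> derivable (wtm a' W) p ->
  derivable W (PAllTm a p).
Proof. by move=> -> wa d; apply: d_allTmI. Qed.

Lemma rarrI W a b a' b' h h' f g : rel W h a b -> rel W h' a' b' ->
  el W f (TArr a a') -> el W g (TArr b b') ->
  (forall W' r x y, morph W W' r -> rl W' (rlr r h) (tyr r a) (tyr r b) x y ->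
     rl W' (rlr r h') (tyr r a') (tyr r b')
       (App (tmr r f) (Bang x)) (App (tmr r g) (Bang y))) ->
  rl W (rarr a b a' b' h h') (TArr a a') (TArr b b') f g.
Proof.
move=> rh rh' ef eg K; have [_ wa wb] := rh.
have rr := rel_rarr rh rh'; split=> //; apply/(relbeta rr ef eg) => W' r e.
apply: (@der_allTm W' _ (tyr r a)); [sig|exact: wf_ren e wa|].
apply: (@der_allTm (wtm (tyr r a) W') _ (tyr r b)); [sig|exact: wf_ren e wb|].
set W1 := wtm (tyr r b) (wtm (tyr r a) W').
have e1 := morph_comp e (morph_wtm2 (tyr r a) (tyr r b) W').
have rh1 : rel W1 (rlr (rcomp r (rwk 0 2 0)) h) (tyr r a) (tyr r b).
  apply: rel_at e1 rh _ _ _ => //=; sig.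
have E0 : el W1 (Var 0) (tyr r b) by el_at.
have E1 : el W1 (Var 1) (tyr r a) by el_at.
apply: (@der_imp W1 _ _ (PRel (rlr (rcomp r (rwk 0 2 0)) h) (Var 1) (Var 0))
  (PRel (rlr (rcomp r (rwk 0 2 0)) h') (App (tmr (rcomp r (rwk 0 2 0)) f) (Bang (Var 1)))
     (App (tmr (rcomp r (rwk 0 2 0)) g) (Bang (Var 0))))); [sig|sig|exact: prp_rel rh1 _ _|].
set P := PRel _ _ _ => hp; have e2 := morph_comp e1 (morph_why P W1).
have hx : rl (why P W1) (rlr (rcomp r (rwk 0 2 0)) h) (tyr r a) (tyr r b) (Var 1) (Var 0).
  by split.
by case: (K _ _ (Var 1) (Var 0) e2 hx).
Qed.

Lemma holds_eq W p q : holds W p -> p = q -> holds W q.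
Proof. by move=> h <-. Qed.

Lemma holds_allTm W a a' p t : holds W (PAllTm a p) -> a = a' -> el W t a' ->
  holds W (pinst_tm p t).
Proof. by move=> h <-; apply: holds_allTmE. Qed.

Lemma rarrE W a b a' b' h h' f g x y : rel W h' a' b' ->
  rl W (rarr a b a' b' h h') (TArr a a') (TArr b b') f g ->
  rl W h a b x y -> rl W h' a' b' (App f (Bang x)) (App g (Bang y)).
Proof.
move=> rh' [rr ef eg hh] [rh ex ey hxy]; split=> //.
- by apply: el_app ef _; apply: el_bang.
- by apply: el_app eg _; apply: el_bang.
have /(relbeta rr ef eg) hp := hh.
have {}hp := holds_allTm hp (_ : _ = a) ex.
have {}hp := holds_allTm (hp _) (_ : _ = b) ey.
suff: holds W (PImp (PRel h x y) (PRel h' (App f (Bang x)) (App g (Bang y)))).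
  by move/holds_impE; apply.
by apply: holds_eq (hp _ _) _; sig.
Qed.

(** The world below the quantifier prefix shared by the second-order clauses for !, for the tensor
    and for the unit: two types, an admissible relation between them and two terms. *)
Definition wpoly a b W :=
  wtm b (wtm a (wrl true (TVar 1) (TVar 0) (wty (wty W)))).

Lemma morph_wpoly a b W : morph W (wpoly a b W) (rwk 2 2 1).
Proof.
exact: morph_comp (morph_wty W) (morph_comp (morph_wty _)
  (morph_comp (morph_wrl true (TVar 1) (TVar 0) _) (morph_wtm2 a b _))).
Qed.

Lemma adm_wpoly a b W : adm (wpoly a b W) (RVar 0) (TVar 1) (TVar 0).
Proof. by split=> //; apply: adm_var. Qed.

Lemma rel_rbang W a b h : rel W h a b -> rel W (rbang a b h) (TBang a) (TBang b).
Proof.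
move=> rh; have [_ wa wb] := rh; apply: rel_abs => //.
do 2 apply: ip_allTy; apply: ip_allRel => //.
set W0 := wtm (TBang b) (wtm (TBang a) W).
set c := TArr (wkT 2 a) (TVar 1); set c' := TArr (wkT 2 b) (TVar 0).
have e : morph W (wpoly c c' W0) (rwk 2 4 1).
  exact: morph_comp (morph_wtm2 _ _ W) (morph_wpoly _ _ _).
have wa2 : wf (wpoly c c' W0) (wkT 2 a) by apply: wf_ren e wa.
have wb2 : wf (wpoly c c' W0) (wkT 2 b) by apply: wf_ren e wb.
apply: ip_allTm; first by rewrite /c /= andbT; exact: wa2.
apply: ip_allTm; first by rewrite /c' /= andbT; exact: wb2.
have aR := adm_wpoly c c' W0.
apply: ip_imp.
  apply: (@prp_rel (wpoly c c' W0) _ c c'); [|el_at|el_at].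
  by apply: rel_rarr (adm_rel aR); apply: rel_ren e rh.
apply: (@prp_rel (wpoly c c' W0) _ (TVar 1) (TVar 0)); first exact: adm_rel.
  by apply: (@el_app _ (TBang (wkT 2 a))); el_at.
by apply: (@el_app _ (TBang (wkT 2 b))); el_at.
Qed.

Lemma rbang_ren r a b h : rlr r (rbang a b h) = rbang (tyr r a) (tyr r b) (rlr r h).
Proof. sig. Qed.

Lemma rbangI W a b h t u : rel W h a b -> el W t (TBang a) -> el W u (TBang b) ->
  (forall W' r c c' S f g, morph W W' r -> adm W' S c c' ->
     rl W' (rarr (tyr r a) (tyr r b) c c' (rlr r h) S)
       (TArr (tyr r a) c) (TArr (tyr r b) c') f g ->
     rl W' S c c' (App f (tmr r t)) (App g (tmr r u))) ->
  rl W (rbang a b h) (TBang a) (TBang b) t u.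
Proof.
move=> rh et eu K; have [_ wa wb] := rh.
have rr := rel_rbang rh; split=> //; apply/(relbeta rr et eu) => W' r e.
do 2 apply: d_allTyI; apply: d_allRelI => //.
pose r2 := rcomp r (rwk 2 2 1).
set c := TArr (tyr r2 a) (TVar 1); set c' := TArr (tyr r2 b) (TVar 0).
have e1 : morph W (wpoly c c' W') r2 := morph_comp e (morph_wpoly c c' W').
have wa2 := wf_ren e1 wa; have wb2 := wf_ren e1 wb.
apply: (@der_allTm (wrl true (TVar 1) (TVar 0) (wty (wty W'))) _ c).
- by rewrite /c /r2; sig.
- by rewrite /c /wf /= andbT; exact: wa2.
apply: (@der_allTm (wtm c (wrl true (TVar 1) (TVar 0) (wty (wty W')))) _ c').
- by rewrite /c' /r2; sig.
- by rewrite /c' /wf /= andbT; exact: wb2.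
have aR := adm_wpoly c c' W'.
have rR : rel (wpoly c c' W') (rarr (tyr r2 a) (tyr r2 b) (TVar 1) (TVar 0) (rlr r2 h)
   (RVar 0)) c c'.
  by apply: rel_rarr (adm_rel aR); apply: rel_ren e1 rh.
have E0 : el (wpoly c c' W') (Var 0) c' by el_at.
have E1 : el (wpoly c c' W') (Var 1) c by el_at.
apply: (@der_imp (wpoly c c' W') _ _
  (PRel (rarr (tyr r2 a) (tyr r2 b) (TVar 1) (TVar 0) (rlr r2 h) (RVar 0)) (Var 1) (Var 0))
  (PRel (RVar 0) (App (Var 1) (tmr r2 t)) (App (Var 0) (tmr r2 u)))).
- by rewrite /r2; sig.
- by rewrite /r2; sig.
- exact: prp_rel rR _ _.
set P := PRel _ _ _ => hp.
have e2 := morph_comp e1 (morph_why P _).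
have aR2 : adm (why P (wpoly c c' W')) (RVar 0) (TVar 1) (TVar 0) := aR.
have hx : rl (why P (wpoly c c' W')) (rarr (tyr r2 a) (tyr r2 b) (TVar 1) (TVar 0)
   (rlr r2 h) (RVar 0)) c c' (Var 1) (Var 0) by split.
by case: (K _ _ _ _ _ (Var 1) (Var 0) e2 aR2 hx).
Qed.

Lemma holds_allTy W p a : holds W (PAllTy p) -> wf W a -> holds W (pinst_ty p a).
Proof. exact: holds_allTyE. Qed.

Lemma holds_allRel W a a' b b' p h : holds W (PAllRel true a a' p) ->
  a = b -> a' = b' -> adm W h b b' -> holds W (pinst_rel p h).
Proof. by move=> hp <- <-; apply: holds_allRelE. Qed.

Lemma rbangE W a b h t u c c' S f g :
  rl W (rbang a b h) (TBang a) (TBang b) t u -> adm W S c c' ->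
  rl W (rarr a b c c' h S) (TArr a c) (TArr b c') f g ->
  rl W S c c' (App f t) (App g u).
Proof.
move=> [rr et eu hh] aS [rS ef eg hfg]; split.
- exact: adm_rel.
- exact: el_app ef et.
- exact: el_app eg eu.
have [_ wc wc'] := aS.
have /(relbeta rr et eu) hp := hh.
have {}hp := holds_allTy hp wc.
have {}hp := holds_allTy hp wc'.
have {}hp := holds_allRel hp (_ : _ = c) (_ : _ = c') aS.
have {}hp := holds_allTm (hp _ _) (_ : _ = TArr a c) ef.
have {}hp := holds_allTm (hp _ _ _) (_ : _ = TArr b c') eg.
suff: holds W (PImp (PRel (rarr a b c c' h S) f g) (PRel S (App f t) (App g u))).
  by move/holds_impE; apply.
apply: holds_eq (hp _ _ _ _) _; sig.
Qed.

Definition letT (f z : tm) : tm := LetT z (App (App (wkt 0 2 f) (Var 1)) (Var 0)).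

Lemma el_letTapp W a a' c f z : el W f (TLolli a (TLolli a' c)) ->
  el W z (TTens a a') -> el W (letT f z) c.
Proof.
move=> ef ez; apply: el_letT ez _ _ _.
- apply: (@el_app _ a'); last by el_at.
  by apply: (@el_app _ a); [exact: el_wk2 ef|el_at].
- by rewrite /= occ_wk.
by rewrite /= occ_wk.
Qed.

Definition tens_hyp (a b a' b' c c' : ty) (h h' S : lrel) : lrel :=
  rlolli a b (TLolli a' c) (TLolli b' c') h (rlolli a' b' c c' h' S).

Lemma rel_tens_hyp W a b a' b' c c' h h' S : rel W h a b -> rel W h' a' b' ->
  rel W S c c' -> rel W (tens_hyp a b a' b' c c' h h' S)
    (TLolli a (TLolli a' c)) (TLolli b (TLolli b' c')).
Proof. by move=> rh rh' rS; do 2 apply: rel_rlolli => //. Qed.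

Lemma rel_rtens W a b a' b' h h' : rel W h a b -> rel W h' a' b' ->
  rel W (rtens a b a' b' h h') (TTens a a') (TTens b b').
Proof.
move=> rh rh'; have [_ wa wb] := rh; have [_ wa' wb'] := rh'.
apply: rel_abs; [by rewrite /wf /= wa wa'|by rewrite /wf /= wb wb'|].
do 2 apply: ip_allTy; apply: ip_allRel => //.
set W0 := wtm (TTens b b') (wtm (TTens a a') W).
set c := TLolli (wkT 2 a) (TLolli (wkT 2 a') (TVar 1)).
set c' := TLolli (wkT 2 b) (TLolli (wkT 2 b') (TVar 0)).
have e : morph W (wpoly c c' W0) (rwk 2 4 1).
  exact: morph_comp (morph_wtm2 _ _ W) (morph_wpoly _ _ _).
have rh2 := rel_ren e rh; have rh2' := rel_ren e rh'.
have [_ wa2 wb2] := rh2; have [_ wa2' wb2'] := rh2'.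
have aR := adm_wpoly c c' W0.
have rH := rel_tens_hyp rh2 rh2' (adm_rel aR).
have [_ wc wc'] := rH.
apply: ip_allTm; first exact: wc.
apply: ip_allTm; first exact: wc'.
apply: ip_imp.
  by apply: (@prp_rel (wpoly c c' W0) _ c c'); [exact: rH|el_at|el_at].
apply: (@prp_rel (wpoly c c' W0) _ (TVar 1) (TVar 0)); first exact: adm_rel.
  by apply: (@el_letTapp _ (wkT 2 a) (wkT 2 a') _ (Var 1)); el_at.
by apply: (@el_letTapp _ (wkT 2 b) (wkT 2 b') _ (Var 0)); el_at.
Qed.

Lemma rtens_ren r a b a' b' h h' : rlr r (rtens a b a' b' h h')
  = rtens (tyr r a) (tyr r b) (tyr r a') (tyr r b') (rlr r h) (rlr r h').
Proof. sig. Qed.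

Lemma rtensI W a b a' b' h h' t u : rel W h a b -> rel W h' a' b' ->
  el W t (TTens a a') -> el W u (TTens b b') ->
  (forall W' r c c' S f g, morph W W' r -> adm W' S c c' ->
     rl W' (tens_hyp (tyr r a) (tyr r b) (tyr r a') (tyr r b') c c' (rlr r h) (rlr r h') S)
       (TLolli (tyr r a) (TLolli (tyr r a') c)) (TLolli (tyr r b) (TLolli (tyr r b') c'))
       f g ->
     rl W' S c c' (letT f (tmr r t)) (letT g (tmr r u))) ->
  rl W (rtens a b a' b' h h') (TTens a a') (TTens b b') t u.
Proof.
move=> rh rh' et eu K; have rr := rel_rtens rh rh'.
split=> //; apply/(relbeta rr et eu) => W' r e.
do 2 apply: d_allTyI; apply: d_allRelI => //.
pose r2 := rcomp r (rwk 2 2 1).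
set c := TLolli (tyr r2 a) (TLolli (tyr r2 a') (TVar 1)).
set c' := TLolli (tyr r2 b) (TLolli (tyr r2 b') (TVar 0)).
have e1 : morph W (wpoly c c' W') r2 := morph_comp e (morph_wpoly c c' W').
have aR := adm_wpoly c c' W'.
have rR := rel_tens_hyp (rel_ren e1 rh) (rel_ren e1 rh') (adm_rel aR).
have [_ wc wc'] := rR.
apply: (@der_allTm (wrl true (TVar 1) (TVar 0) (wty (wty W'))) _ c).
- by rewrite /c /r2; sig.
- exact: wc.
apply: (@der_allTm (wtm c (wrl true (TVar 1) (TVar 0) (wty (wty W')))) _ c').
- by rewrite /c' /r2; sig.
- exact: wc'.
have E0 : el (wpoly c c' W') (Var 0) c' by el_at.
have E1 : el (wpoly c c' W') (Var 1) c by el_at.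
apply: (@der_imp (wpoly c c' W') _ _
  (PRel (tens_hyp (tyr r2 a) (tyr r2 b) (tyr r2 a') (tyr r2 b') (TVar 1) (TVar 0)
     (rlr r2 h) (rlr r2 h') (RVar 0)) (Var 1) (Var 0))
  (PRel (RVar 0) (letT (Var 1) (tmr r2 t)) (letT (Var 0) (tmr r2 u)))).
- by rewrite /r2 /tens_hyp; sig.
- by rewrite /r2 /letT; sig.
- exact: prp_rel rR _ _.
set P := PRel _ _ _ => hp.
have e2 := morph_comp e1 (morph_why P _).
have aR2 : adm (why P (wpoly c c' W')) (RVar 0) (TVar 1) (TVar 0) := aR.
have hx : rl (why P (wpoly c c' W')) (tens_hyp (tyr r2 a) (tyr r2 b) (tyr r2 a')
   (tyr r2 b') (TVar 1) (TVar 0) (rlr r2 h) (rlr r2 h') (RVar 0)) c c' (Var 1) (Var 0).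
  by split.
by case: (K _ _ _ _ _ (Var 1) (Var 0) e2 aR2 hx).
Qed.

Lemma rtensE W a b a' b' h h' t u c c' S f g :
  rl W (rtens a b a' b' h h') (TTens a a') (TTens b b') t u -> adm W S c c' ->
  rl W (tens_hyp a b a' b' c c' h h' S)
    (TLolli a (TLolli a' c)) (TLolli b (TLolli b' c')) f g ->
  rl W S c c' (letT f t) (letT g u).
Proof.
move=> [rr et eu hh] aS [rS ef eg hfg]; split.
- exact: adm_rel.
- exact: el_letTapp ef et.
- exact: el_letTapp eg eu.
have [_ wc wc'] := aS.
have /(relbeta rr et eu) hp := hh.
have {}hp := holds_allTy hp wc.
have {}hp := holds_allTy hp wc'.
have {}hp := holds_allRel hp (_ : _ = c) (_ : _ = c') aS.
have {}hp := holds_allTm (hp _ _) (_ : _ = TLolli a (TLolli a' c)) ef.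
have {}hp := holds_allTm (hp _ _ _) (_ : _ = TLolli b (TLolli b' c')) eg.
suff: holds W (PImp (PRel (tens_hyp a b a' b' c c' h h' S) f g)
    (PRel S (letT f t) (letT g u))).
  by move/holds_impE; apply.
by apply: holds_eq (hp _ _ _ _) _; rewrite /letT /tens_hyp; sig.
Qed.

Definition wpi W := wrl true (TVar 1) (TVar 0) (wty (wty W)).

Lemma morph_wpi W : morph W (wpi W) (rwk 2 0 1).
Proof.
exact: morph_comp (morph_wty W) (morph_comp (morph_wty _)
  (morph_wrl true (TVar 1) (TVar 0) _)).
Qed.

Lemma adm_wpi W : adm (wpi W) (RVar 0) (TVar 1) (TVar 0).
Proof. by split=> //; apply: adm_var. Qed.

Definition pity (s : nat -> ty) (c : ty) (a : ty) : ty := ty_sub (scons c s) a.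

Lemma rel_rpi W a b h : wf W (TPi a) -> wf W (TPi b) ->
  rel (wpi W) h (pity (TVar \o addn 2) (TVar 1) a) (pity (TVar \o addn 2) (TVar 0) b) ->
  rel W (rpi a b h) (TPi a) (TPi b).
Proof.
move=> wa wb rh; apply: rel_abs => //.
do 2 apply: ip_allTy; apply: ip_allRel => //.
set W0 := wtm (TPi b) (wtm (TPi a) W).
(* The related terms are bound outside the two types and the relation, whereas [h] lives without
   these terms. Since the index spaces are separate, inserting two term variables commutes with the
   other three binders. *)
have e : morph (wpi W) (wpi W0) (rwk 0 2 0).
  have [[eX eG eT] eP] := morph_wtm2 (TPi a) (TPi b) W.
  split; last first.
    move=> i p /=; rewrite -2!map_comp => ei; have [q eq ->] := onth_map_inv ei.
    exists i; rewrite -4!map_comp (onth_map_some _ eq) /=; congr Some.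
    by rewrite /wkp !pr_ren_ren; congr pr_ren; apply: functional_extensionality.
  split=> //= i.
    by move=> c ec; rewrite ty_ren0.
  by move=> d c c' ec; rewrite !ty_ren0.
apply: (@prp_rel (wpi W0) _ (pity (TVar \o addn 2) (TVar 1) a)
  (pity (TVar \o addn 2) (TVar 0) b)).
- by apply: rel_at e rh _ _ _ => //; rewrite ty_ren0.
- apply: (@el_tapp _ (ty_sub (upT (TVar \o addn 2)) a)); [|by []|by rewrite /pity; sig].
  by el_at.
apply: (@el_tapp _ (ty_sub (upT (TVar \o addn 2)) b)); [|by []|by rewrite /pity; sig].
by el_at.
Qed.

Lemma rpi_ren r a b h : rlr r (rpi a b h)
  = rpi (ty_ren (upr (rty r)) a) (ty_ren (upr (rty r)) b)
      (rl_ren (upr (upr (rty r))) (rtm r) (upr (rrl r)) h).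
Proof. sig. Qed.

(** The instance, in a later world, of the body of an [rpi]: the bound types 1 and 0 become [c] and
    [c'], the bound relation becomes [S], and everything else is renamed by [r]. *)
Definition piinst (r : ren) (c c' : ty) (S h : lrel) : lrel :=
  rl_sub (scons c' (scons c (TVar \o rty r))) (Var \o rtm r) (scons S (RVar \o rrl r)) h.

Lemma rpiI W a b h t u : rel W (rpi a b h) (TPi a) (TPi b) ->
  el W t (TPi a) -> el W u (TPi b) ->
  (forall W' r c c' S, morph W W' r -> adm W' S c c' ->
     rl W' (piinst r c c' S h) (pity (TVar \o rty r) c a) (pity (TVar \o rty r) c' b)
       (TApp (tmr r t) c) (TApp (tmr r u) c')) ->
  rl W (rpi a b h) (TPi a) (TPi b) t u.
Proof.
move=> rr et eu K; split=> //; apply/(relbeta rr et eu) => W' r e.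
do 2 apply: d_allTyI; apply: d_allRelI => //.
have e1 := morph_comp e (morph_wpi W').
case: (K _ _ _ _ _ e1 (adm_wpi W')) => _ _ _ /holds_derivable H.
by apply: derivable_eq H _; rewrite /piinst; sig.
Qed.

Lemma rpiE W a b h t u c c' S :
  rl W (rpi a b h) (TPi a) (TPi b) t u -> adm W S c c' ->
  rel W (piinst rid c c' S h) (pity TVar c a) (pity TVar c' b) ->
  rl W (piinst rid c c' S h) (pity TVar c a) (pity TVar c' b) (TApp t c) (TApp u c').
Proof.
move=> [rr et eu hh] aS rS; have [_ wc wc'] := aS; split=> //.
- by apply: el_tapp et wc _.
- by apply: el_tapp eu wc' _.
have /(relbeta rr et eu) hp := hh.
have {}hp := holds_allTy hp wc.
have {}hp := holds_allTy hp wc'.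
have {}hp := holds_allRel hp (_ : _ = c) (_ : _ = c') aS.
by apply: holds_eq (hp _ _) _; rewrite /piinst; sig.
Qed.

(** * Relational interpretation of inductively constructed types *)

Lemma wf_ic_ty n s : wf_icty n s -> wf_ty n (ic_ty s).
Proof.
elim: s n => //= [c|s1 IH1 s2 IH2|s1 IH1 s2 IH2|s1 IH1] n.
- exact: wf_ty0.
- by case/andP=> /IH1 -> /IH2 ->.
- by case/andP=> /IH1 -> /IH2 ->.
exact: IH1.
Qed.

Lemma ic_rel_ext n s A B R A' B' R' : wf_icty n s ->
  (forall i, i < n -> [/\ A i = A' i, B i = B' i & R i = R' i]) ->
  ic_rel A B R s = ic_rel A' B' R' s.
Proof.
elim: s n A B R A' B' R' => //=
  [i|s1 IH1 s2 IH2|s1 IH1 s2 IH2|s1 IH1|s1 IH1] n A B R A' B' R'.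
- by move=> ni /(_ _ ni)[].
- case/andP=> w1 w2 e; rewrite (IH1 _ _ _ _ A' B' R' w1) // (IH2 _ _ _ _ A' B' R' w2) //.
  by congr rtens; (apply: ty_sub_wf; first by apply: wf_ic_ty; eassumption);
    move=> i /e[].
- case/andP=> w1 w2 e; rewrite (IH1 _ _ _ _ A' B' R' w1) // (IH2 _ _ _ _ A' B' R' w2) //.
  by congr rlolli; (apply: ty_sub_wf; first by apply: wf_ic_ty; eassumption);
    move=> i /e[].
- move=> w1 e; rewrite (IH1 _ _ _ _ A' B' R' w1) //.
  by congr rbang; (apply: ty_sub_wf; first by apply: wf_ic_ty; eassumption);
    move=> i /e[].
move=> w1 e; congr rpi.
- by apply: ty_sub_wf (wf_ic_ty w1) _ => -[|i] //= /e[->].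
- by apply: ty_sub_wf (wf_ic_ty w1) _ => -[|i] //= /e[_ ->].
by apply: IH1 w1 _ => -[|i] //= /e[-> -> ->].
Qed.

Lemma rpi_sub st s sr a b h : rl_sub st s sr (rpi a b h)
  = rpi (ty_sub (upT st) a) (ty_sub (upT st) b)
      (rl_sub (upT (upT st)) (fun i => wkt 2 0 (s i)) (upR (fun i => wkr 2 0 0 (sr i))) h).
Proof. sig. Qed.

Lemma rtens_sub st s sr a b a' b' h h' : rl_sub st s sr (rtens a b a' b' h h')
  = rtens (ty_sub st a) (ty_sub st b) (ty_sub st a') (ty_sub st b')
      (rl_sub st s sr h) (rl_sub st s sr h').
Proof. sig. Qed.

Lemma rlolli_sub st s sr a b a' b' h h' : rl_sub st s sr (rlolli a b a' b' h h')
  = rlolli (ty_sub st a) (ty_sub st b) (ty_sub st a') (ty_sub st b')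
      (rl_sub st s sr h) (rl_sub st s sr h').
Proof. sig. Qed.

Lemma rbang_sub st s sr a b h : rl_sub st s sr (rbang a b h)
  = rbang (ty_sub st a) (ty_sub st b) (rl_sub st s sr h).
Proof. sig. Qed.

Lemma ic_rel_sub n s A B R st sb sr : wf_icty n s ->
  rl_sub st sb sr (ic_rel A B R s)
  = ic_rel (ty_sub st \o A) (ty_sub st \o B) (rl_sub st sb sr \o R) s.
Proof.
elim: s n A B R st sb sr => [i|c||s1 IH1 s2 IH2|s1 IH1 s2 IH2|s1 IH1|s1 IH1] n A B R
  st sb sr //.
- by move=> wc /=; rewrite /req wf_ty0_sub.
- by case/andP=> w1 w2; rewrite [LHS]rtens_sub (IH1 _ _ _ _ _ _ _ w1)
    (IH2 _ _ _ _ _ _ _ w2) !ty_sub_sub.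
- by case/andP=> w1 w2; rewrite [LHS]rlolli_sub (IH1 _ _ _ _ _ _ _ w1)
    (IH2 _ _ _ _ _ _ _ w2) !ty_sub_sub.
- by move=> w1; rewrite [LHS]rbang_sub (IH1 _ _ _ _ _ _ _ w1) !ty_sub_sub.
move=> w1; rewrite [LHS]rpi_sub (IH1 _ _ _ _ _ _ _ w1) !ty_sub_sub !upT_comp.
apply: (congr1 (rpi _ _)); fold ic_rel.
apply: (@ic_rel_ext n.+1) w1 _ => -[|i] //= _; split; try by sig.
Qed.

Lemma rel_runit W : rel W runit TUnit TUnit.
Proof.
apply: rel_abs => //; do 2 apply: ip_allTy; apply: ip_allRel => //.
do 2 (apply: ip_allTm => //).
set W0 := wtm TUnit (wtm TUnit W).
have aR := adm_wpoly (TVar 1) (TVar 0) W0.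
have eS i (c : ty) : onth (wG (wpoly (TVar 1) (TVar 0) W0)) i = Some TUnit ->
   forall j, onth (wG (wpoly (TVar 1) (TVar 0) W0)) j = Some c ->
   el (wpoly (TVar 1) (TVar 0) W0) (LetS (Var i) (Var j)) c.
  move=> ei j ej; split=> //; apply: sty_letS; exact: sty_var.
apply: ip_imp; apply: (@prp_rel (wpoly (TVar 1) (TVar 0) W0) _ (TVar 1) (TVar 0));
  try exact: adm_rel; try by el_at.
  by apply: eS.
by apply: eS.
Qed.

Lemma rel_ic_rel n s W A B R : wf_icty n s ->
  (forall i, i < n -> rel W (R i) (A i) (B i)) ->
  rel W (ic_rel A B R s) (ty_sub A (ic_ty s)) (ty_sub B (ic_ty s)).
Proof.
elim: s n W A B R => [i|c||s1 IH1 s2 IH2|s1 IH1 s2 IH2|s1 IH1|s1 IH1] n W A B R /=.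
- by move=> ni; apply.
- by move=> wc _; rewrite !wf_ty0_sub //; apply: rel_req; apply: wf_ty0.
- by move=> _ _; apply: rel_runit.
- by case/andP=> w1 w2 e; apply: rel_rtens; [exact: IH1 w1 e|exact: IH2 w2 e].
- by case/andP=> w1 w2 e; apply: rel_rlolli; [exact: IH1 w1 e|exact: IH2 w2 e].
- by move=> w1 e; apply: rel_rbang; exact: IH1 w1 e.
move=> w1 e; have wA : wf W (TPi (ty_sub (upT A) (ic_ty s1))).
  rewrite /wf /=; apply: wf_ty_sub (wf_ic_ty w1) _ => -[|i] //= /e[_ wa _].
  by apply: wf_ty_ren wa _ => j.
have wB : wf W (TPi (ty_sub (upT B) (ic_ty s1))).
  rewrite /wf /=; apply: wf_ty_sub (wf_ic_ty w1) _ => -[|i] //= /e[_ _ wb].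
  by apply: wf_ty_ren wb _ => j.
apply: rel_rpi => //.
have pE c A' : pity (TVar \o addn 2) c (ty_sub (upT A') (ic_ty s1))
   = ty_sub (scons c (fun i => wkT 2 (A' i))) (ic_ty s1) by rewrite /pity; sig.
rewrite !pE; apply: IH1 w1 _ => -[|i] /=; first by move=> _; exact: adm_rel (adm_wpi W).
by move=> /e; exact: rel_ren (morph_wpi W).
Qed.

(** * Equivalence of relations, the clauses of [RTy], identity extension *)

Definition requ W a b h k : Prop :=
  [/\ rel W h a b, rel W k a b
    & forall W' r x y, morph W W' r ->
        rl W' (rlr r h) (tyr r a) (tyr r b) x y
        <-> rl W' (rlr r k) (tyr r a) (tyr r b) x y].

Lemma requ_sym W a b h k : requ W a b h k -> requ W a b k h.
Proof. by case=> rh rk e; split=> // W' r x y m; split=> /(e _ _ _ _ m). Qed.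

Lemma requ_trans W a b h k l : requ W a b h k -> requ W a b k l -> requ W a b h l.
Proof.
case=> rh rk e [_ rl e']; split=> // W' r x y m.
by split=> [/(e _ _ _ _ m)/(e' _ _ _ _ m)|/(e' _ _ _ _ m)/(e _ _ _ _ m)].
Qed.

Lemma requ_refl W a b h : rel W h a b -> requ W a b h h.
Proof. by []. Qed.

Lemma requ_ren W W' r a b h k : morph W W' r -> requ W a b h k ->
  requ W' (tyr r a) (tyr r b) (rlr r h) (rlr r k).
Proof.
move=> m [rh rk e]; split; [exact: rel_ren m rh|exact: rel_ren m rk|].
move=> W2 r2 x y m2; rewrite !ty_ren_ren !rl_ren_ren.
exact: e _ _ _ _ (morph_comp m m2).
Qed.

Lemma requ_id W a b h k x y : requ W a b h k -> rl W h a b x y <-> rl W k a b x y.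
Proof.
case=> _ _ /(_ W rid x y (morph_id W)); by rewrite !ty_ren_id !rl_ren_id.
Qed.

Lemma requI W a b h k : rel W h a b -> rel W k a b ->
  (forall W' r x y, morph W W' r -> rl W' (rlr r h) (tyr r a) (tyr r b) x y ->
     rl W' (rlr r k) (tyr r a) (tyr r b) x y) ->
  (forall W' r x y, morph W W' r -> rl W' (rlr r k) (tyr r a) (tyr r b) x y ->
     rl W' (rlr r h) (tyr r a) (tyr r b) x y) -> requ W a b h k.
Proof. by move=> rh rk K1 K2; split=> // W' r x y m; split; [exact: K1|exact: K2]. Qed.

Lemma rlolli_mono W a b a' b' h h' k k' f g :
  requ W a b h k -> requ W a' b' h' k' ->
  rl W (rlolli a b a' b' h h') (TLolli a a') (TLolli b b') f g ->
  rl W (rlolli a b a' b' k k') (TLolli a a') (TLolli b b') f g.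
Proof.
move=> [rh rk e] [rh' rk' e'] H; have [_ ef eg _] := H.
apply: rlolliI => // W' r x y m /(e _ _ _ _ m) hx.
apply/(e' _ _ _ _ m); have := rl_morph m H; rewrite rlolli_ren => H'.
exact: rlolliE (rel_ren m rh') H' hx.
Qed.

Lemma requ_rlolli W a b a' b' h h' k k' :
  requ W a b h k -> requ W a' b' h' k' ->
  requ W (TLolli a a') (TLolli b b') (rlolli a b a' b' h h') (rlolli a b a' b' k k').
Proof.
move=> e e'; have [rh rk _] := e; have [rh' rk' _] := e'.
apply: requI; try exact: rel_rlolli.
  move=> W' r x y m; rewrite !rlolli_ren /=.
  exact: rlolli_mono (requ_ren m e) (requ_ren m e').
move=> W' r x y m; rewrite !rlolli_ren /=.
exact: rlolli_mono (requ_sym (requ_ren m e)) (requ_sym (requ_ren m e')).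
Qed.

Lemma rarr_mono W a b a' b' h h' k k' f g :
  requ W a b h k -> requ W a' b' h' k' ->
  rl W (rarr a b a' b' h h') (TArr a a') (TArr b b') f g ->
  rl W (rarr a b a' b' k k') (TArr a a') (TArr b b') f g.
Proof.
move=> [rh rk e] [rh' rk' e'] H; have [_ ef eg _] := H.
apply: rarrI => // W' r x y m /(e _ _ _ _ m) hx.
apply/(e' _ _ _ _ m); have := rl_morph m H; rewrite rarr_ren => H'.
exact: rarrE (rel_ren m rh') H' hx.
Qed.

Lemma rbang_mono W a b h k t u : requ W a b h k ->
  rl W (rbang a b h) (TBang a) (TBang b) t u ->
  rl W (rbang a b k) (TBang a) (TBang b) t u.
Proof.
move=> e H; have [rh rk _] := e; have [_ et eu _] := H.
apply: rbangI => // W' r c c' S f g m aS hfg.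
have := rl_morph m H; rewrite rbang_ren => H'.
apply: (rbangE H' aS).
exact: rarr_mono (requ_sym (requ_ren m e)) (requ_refl (adm_rel aS)) hfg.
Qed.

Lemma requ_rbang W a b h k : requ W a b h k ->
  requ W (TBang a) (TBang b) (rbang a b h) (rbang a b k).
Proof.
move=> e; have [rh rk _] := e; apply: requI; try exact: rel_rbang.
  by move=> W' r x y m; rewrite !rbang_ren /=; apply: rbang_mono (requ_ren m e).
move=> W' r x y m; rewrite !rbang_ren /=; exact: rbang_mono (requ_sym (requ_ren m e)).
Qed.

Lemma rtens_mono W a b a' b' h h' k k' t u :
  requ W a b h k -> requ W a' b' h' k' ->
  rl W (rtens a b a' b' h h') (TTens a a') (TTens b b') t u ->
  rl W (rtens a b a' b' k k') (TTens a a') (TTens b b') t u.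
Proof.
move=> e e' H; have [rh rk _] := e; have [rh' rk' _] := e'.
have [_ et eu _] := H; apply: rtensI => // W' r c c' S f g m aS hfg.
have := rl_morph m H; rewrite rtens_ren => H'.
apply: (rtensE H' aS); apply: rlolli_mono hfg.
  exact: requ_sym (requ_ren m e).
exact: requ_rlolli (requ_sym (requ_ren m e')) (requ_refl (adm_rel aS)).
Qed.

Lemma requ_rtens W a b a' b' h h' k k' :
  requ W a b h k -> requ W a' b' h' k' ->
  requ W (TTens a a') (TTens b b') (rtens a b a' b' h h') (rtens a b a' b' k k').
Proof.
move=> e e'; have [rh rk _] := e; have [rh' rk' _] := e'.
apply: requI; try exact: rel_rtens.
  move=> W' r x y m; rewrite !rtens_ren /=.
  exact: rtens_mono (requ_ren m e) (requ_ren m e').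
move=> W' r x y m; rewrite !rtens_ren /=.
exact: rtens_mono (requ_sym (requ_ren m e)) (requ_sym (requ_ren m e')).
Qed.

Lemma piinst_ren r r' c c' S h :
  piinst r' c c' S (rl_ren (upr (upr (rty r))) (rtm r) (upr (rrl r)) h)
  = piinst (rcomp r r') c c' S h.
Proof. rewrite /piinst; sig. Qed.

Lemma rpi_mono W a b h k t u :
  rel W (rpi a b k) (TPi a) (TPi b) ->
  (forall W' r c c' S, morph W W' r -> adm W' S c c' ->
     requ W' (pity (TVar \o rty r) c a) (pity (TVar \o rty r) c' b)
       (piinst r c c' S h) (piinst r c c' S k)) ->
  rl W (rpi a b h) (TPi a) (TPi b) t u -> rl W (rpi a b k) (TPi a) (TPi b) t u.
Proof.
move=> rk K H; have [rh et eu _] := H.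
apply: rpiI => // W' r c c' S m aS.
have e := K _ _ _ _ _ m aS; apply/(requ_id _ _ e).
have := rl_morph m H; rewrite rpi_ren => H'.
have E d a' : pity TVar d (ty_ren (upr (rty r)) a') = pity (TVar \o rty r) d a'.
  by rewrite /pity; sig.
have := rpiE H' aS; rewrite piinst_ren !E; apply.
by case: e.
Qed.

Lemma requ_rpi W a b h k :
  rel W (rpi a b h) (TPi a) (TPi b) -> rel W (rpi a b k) (TPi a) (TPi b) ->
  (forall W' r c c' S, morph W W' r -> adm W' S c c' ->
     requ W' (pity (TVar \o rty r) c a) (pity (TVar \o rty r) c' b)
       (piinst r c c' S h) (piinst r c c' S k)) ->
  requ W (TPi a) (TPi b) (rpi a b h) (rpi a b k).
Proof.
move=> rh rk K.
have E r r' d a' : pity (TVar \o rty r') d (ty_ren (upr (rty r)) a')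
    = pity (TVar \o rty (rcomp r r')) d a'.
  by rewrite /pity; sig.
apply: requI => // W' r x y m; rewrite !rpi_ren; apply: rpi_mono.
- by have := rel_ren m rk; rewrite rpi_ren.
- move=> W2 r2 c c' S m2 aS; rewrite !piinst_ren !E.
  exact: K (morph_comp m m2) aS.
- by have := rel_ren m rh; rewrite rpi_ren.
move=> W2 r2 c c' S m2 aS; rewrite !piinst_ren !E; apply: requ_sym.
exact: K (morph_comp m m2) aS.
Qed.

Lemma requ_of_holds W a b h k : rel W h a b -> rel W k a b ->
  holds W (requiv a b h k) -> requ W a b h k.
Proof.
move=> rh rk H.
suff K W' r x y : morph W W' r -> el W' x (tyr r a) -> el W' y (tyr r b) ->
    holds W' (PRel (rlr r h) x y) <-> holds W' (PRel (rlr r k) x y).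
  split=> // W' r x y m; split=> -[_ ex ey hx]; split=> //.
  - exact: rel_ren m rk.
  - by apply/(K _ _ _ _ m ex ey).
  - exact: rel_ren m rh.
  - by apply/(K _ _ _ _ m ex ey).
move=> m ex ey; have {}H := holds_ren m H.
have {}H := holds_allTm H erefl ex.
have {}H := holds_allTm H (_ : _ = tyr r b) ey.
have {}H : holds W' (PIff (PRel (rlr r h) x y) (PRel (rlr r k) x y)).
  by apply: holds_eq (H _) _; sig.
by case/holds_andE: H => h1 h2; split; apply: holds_impE.
Qed.

Definition adms W (hs : seq lrel) (ts us : seq ty) : Prop :=
  [/\ are_adm (wX W) (wG W) (wT W) hs ts us, all (wf_ty (wX W)) ts
    & all (wf_ty (wX W)) us].

Lemma adms_ren W W' r hs ts us : morph W W' r -> adms W hs ts us ->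
  adms W' (map (rlr r) hs) (map (tyr r) ts) (map (tyr r) us).
Proof.
move=> m [ah wt wu]; split; first exact: is_lapl_ren.2.2.2 ah _ _ _ _ m.1.
  by rewrite all_map; apply: sub_all wt => a; apply: wf_ren m.
by rewrite all_map; apply: sub_all wu => a; apply: wf_ren m.
Qed.

Lemma adms_cons W h hs a ts b us : adm W h a b -> adms W hs ts us ->
  adms W (h :: hs) (a :: ts) (b :: us).
Proof.
case=> ah wa wb [ahs wt wu]; split; first exact: aa_cons.
  by apply/andP.
by apply/andP.
Qed.

Lemma are_adm_nth Xi G Th hs ts us i : are_adm Xi G Th hs ts us -> i < size hs ->
  is_adm Xi G Th (nth (RVar 0) hs i) (tsub_of ts i) (tsub_of us i).
Proof.
move=> ah; elim: ah i => // {}Xi {}G {}Th h {}hs a {}ts b {}us ah _ IH [|i] //=.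
exact: IH.
Qed.

Lemma adms_size W hs ts us : adms W hs ts us ->
  size ts = size hs /\ size us = size hs.
Proof. by case=> /are_adm_size. Qed.

Lemma adms_wf W hs ts us i : adms W hs ts us -> i < size hs ->
  wf W (tsub_of ts i) /\ wf W (tsub_of us i).
Proof.
move=> ah hi; have [st su] := adms_size ah; case: ah => _ /all_nthP wt /all_nthP wu.
by split; [apply: wt; rewrite st|apply: wu; rewrite su].
Qed.

Lemma adms_nth W hs ts us i : adms W hs ts us -> i < size hs ->
  adm W (nth (RVar 0) hs i) (tsub_of ts i) (tsub_of us i).
Proof.
move=> ah hi; have [wt wu] := adms_wf ah hi; split=> //; case: ah => ah _ _.
exact: are_adm_nth.
Qed.

Lemma wf_tsub W hs ts us a : adms W hs ts us -> wf_ty (size hs) a ->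
  wf W (ty_sub (tsub_of ts) a) /\ wf W (ty_sub (tsub_of us) a).
Proof.
by move=> ah wa; split; apply: wf_ty_sub wa _ => i /(adms_wf ah)[].
Qed.

Lemma adm_RTy W hs ts us a : adms W hs ts us -> wf_ty (size hs) a ->
  adm W (RTy a hs) (ty_sub (tsub_of ts) a) (ty_sub (tsub_of us) a).
Proof.
move=> ah wa; have [w1 w2] := wf_tsub ah wa; split=> //; case: ah => ah _ _.
exact: adm_ty.
Qed.

Lemma tsub_of_ren r n ts a : wf_ty n a -> size ts = n ->
  tyr r (ty_sub (tsub_of ts) a) = ty_sub (tsub_of (map (tyr r) ts)) a.
Proof.
move=> wa sz; rewrite ty_ren_sub; apply: ty_sub_wf wa _ => i ih.
by rewrite tsub_of_map // sz.
Qed.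

Lemma ty_clause_ren r a hs ts us : wf_ty (size hs) a -> size ts = size hs ->
  size us = size hs ->
  rlr r (ty_clause a hs ts us)
  = ty_clause a (map (rlr r) hs) (map (tyr r) ts) (map (tyr r) us).
Proof.
move=> wa st su.
have E b : wf_ty (size hs) b ->
    (tyr r (ty_sub (tsub_of ts) b) = ty_sub (tsub_of (map (tyr r) ts)) b)
    * (tyr r (ty_sub (tsub_of us) b) = ty_sub (tsub_of (map (tyr r) us)) b).
  by move=> wb; rewrite (tsub_of_ren _ wb st) (tsub_of_ren _ wb su).
case: a wa => [i|_|a b /andP[wa wb]|a b /andP[wa wb]|a wa|a wa].
- by move=> hi; rewrite /= (nth_map (RVar 0)).
- by sig.
- by rewrite /ty_clause rtens_ren !E.
- by rewrite /ty_clause rlolli_ren !E.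
- by rewrite /ty_clause rbang_ren !E.
have U vs : size vs = size hs -> ty_ren (upr (rty r)) (ty_sub (upT (tsub_of vs)) a)
    = ty_sub (upT (tsub_of (map (tyr r) vs))) a.
  move=> sv; rewrite ty_ren_sub; apply: (@ty_sub_wf (size hs).+1) wa _ => -[|i] //= ih.
  by rewrite tsub_of_map ?sv // !ty_ren_ren.
have M : map (rl_ren (upr (upr (rty r))) (rtm r) (upr (rrl r))) (map (wkr 2 0 1) hs)
    = map (wkr 2 0 1) (map (rlr r) hs).
  by rewrite -!map_comp; apply: eq_map => h /=; rewrite /wkr !rl_ren_ren.
have R : rl_ren (upr (upr (rty r))) (rtm r) (upr (rrl r))
    (RTy a (RVar 0 :: map (wkr 2 0 1) hs))
    = RTy a (RVar 0 :: map (wkr 2 0 1) (map (rlr r) hs)) by rewrite -M.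
by rewrite /ty_clause rpi_ren !U // R.
Qed.

Lemma rel_clause W hs ts us a : adms W hs ts us -> wf_ty (size hs) a ->
  rel W (ty_clause a hs ts us) (ty_sub (tsub_of ts) a) (ty_sub (tsub_of us) a).
Proof.
move=> ah; case: a => [i|_|a b /andP[wa wb]|a b /andP[wa wb]|a wa|a wa].
- by move=> hi; apply: adm_rel; apply: adms_nth.
- exact: rel_runit.
- by apply: rel_rtens; apply: adm_rel; apply: adm_RTy.
- by apply: rel_rlolli; apply: adm_rel; apply: adm_RTy.
- by apply: rel_rbang; apply: adm_rel; apply: adm_RTy.
have [w1 w2] := @wf_tsub W _ _ _ (TPi a) ah wa.
apply: rel_rpi => //.
have pE c vs : size vs = size hs ->
  pity (TVar \o addn 2) c (ty_sub (upT (tsub_of vs)) a)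
  = ty_sub (tsub_of (c :: map (wkT 2) vs)) a.
  move=> sv; rewrite /pity ty_sub_sub; apply: (@ty_sub_wf (size hs).+1) wa _ => -[|i] //= hi.
  by rewrite /tsub_of /= (nth_map TUnit) ?sv //; sig.
have [st su] := adms_size ah; rewrite !pE //.
apply: adm_rel; apply: adm_RTy; last by rewrite /= size_map.
apply: adms_cons; first exact: adm_wpi.
exact: adms_ren (morph_wpi W) ah.
Qed.

Lemma requ_clause W hs ts us a : adms W hs ts us -> wf_ty (size hs) a ->
  requ W (ty_sub (tsub_of ts) a) (ty_sub (tsub_of us) a)
    (RTy a hs) (ty_clause a hs ts us).
Proof.
move=> ah wa; have rR := adm_rel (adm_RTy ah wa); have rC := rel_clause ah wa.
have [st su] := adms_size ah.
have H : holds W (requiv (ty_sub (tsub_of ts) a) (ty_sub (tsub_of us) a)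
    (RTy a hs) (ty_clause a hs ts us)).
  move=> W' r m; have [ah' _ _] := adms_ren m ah.
  have := @d_clause parametricity _ _ _ (wP W') a _ _ _ _ ah'.
  rewrite size_map => /(_ wa) d; apply: derivable_eq d _.
  rewrite -(tsub_of_ren _ wa st) -(tsub_of_ren _ wa su) -ty_clause_ren //.
  have -> : RTy a (map (rlr r) hs) = rlr r (RTy a hs) by [].
  by move: (RTy a hs) (ty_clause a hs ts us) => h k; sig.
exact: requ_of_holds.
Qed.

Lemma pity_upT r c A a :
  pity (TVar \o rty r) c (ty_sub (upT A) a) = ty_sub (scons c (tyr r \o A)) a.
Proof. rewrite /pity; sig. Qed.

Lemma piinst_ic_rel n r c c' S A B R s : wf_icty n.+1 s ->
  piinst r c c' S
    (ic_rel (scons (TVar 1) (fun i => wkT 2 (A i))) (scons (TVar 0) (fun i => wkT 2 (B i)))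
       (scons (RVar 0) (fun i => wkr 2 0 1 (R i))) s)
  = ic_rel (scons c (tyr r \o A)) (scons c' (tyr r \o B)) (scons S (rlr r \o R)) s.
Proof.
move=> ws; rewrite /piinst (ic_rel_sub _ _ _ _ _ _ ws).
by apply: ic_rel_ext ws _ => -[|i] _; split; sig.
Qed.

Fixpoint closed_free (s : icty) : bool :=
  match s with
  | IVar _ | IUnit => true
  | IClosed _ => false
  | ITens s1 s2 | ILolli s1 s2 => closed_free s1 && closed_free s2
  | IBang s1 | IPi s1 => closed_free s1
  end.

Fixpoint icty_of (a : ty) : icty :=
  match a with
  | TVar i => IVar i
  | TUnit => IUnit
  | TTens a b => ITens (icty_of a) (icty_of b)
  | TLolli a b => ILolli (icty_of a) (icty_of b)
  | TBang a => IBang (icty_of a)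
  | TPi a => IPi (icty_of a)
  end.

Lemma icty_of_closed_free a : closed_free (icty_of a).
Proof. by elim: a => //= a -> b ->. Qed.

Lemma ic_ty_of a : ic_ty (icty_of a) = a.
Proof. by elim: a => //= [a -> b ->|a -> b ->|a ->|a ->]. Qed.

Lemma wf_icty_of n a : wf_icty n (icty_of a) = wf_ty n a.
Proof. by elim: a n => //= [a IHa b IHb|a IHa b IHb] n; rewrite IHa IHb. Qed.

(* Rebuilt as [icty_of c], a closed type has no closed leaf, so the clauses of
   [RTy] alone show that [RTy c hs] does not depend on [hs]; identity extension
   then applies at [hs = [::]]. *)
Definition closed_RTy : Prop := forall c W hs ts us, wf_ty 0 c ->
  adms W hs ts us -> requ W c c (RTy c hs) (req c).

(** The disjunction lets a single induction serve twice. On a presentation without closed leaves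
    nothing has to be known about closed types, and this case yields [closed_RTy_holds]; that result
    is then the second disjunct for arbitrary [s]. *)
Lemma requ_RTy_ic_gen n s W hs ts us : closed_free s \/ closed_RTy ->
  wf_icty n s -> size hs = n -> adms W hs ts us ->
  requ W (ty_sub (tsub_of ts) (ic_ty s)) (ty_sub (tsub_of us) (ic_ty s))
    (RTy (ic_ty s) hs) (ic_rel (tsub_of ts) (tsub_of us) (nth (RVar 0) hs) s).
Proof.
elim: s n W hs ts us => [i|c||s1 IH1 s2 IH2|s1 IH1 s2 IH2|s1 IH1|s1 IH1] n W hs ts us
  cf ws sz ah; have := wf_ic_ty ws; rewrite -{1}sz => wt.
- exact: requ_clause ah wt.
- case: cf => // cl; rewrite /= !wf_ty0_sub //; exact: cl ah.
- exact: requ_clause ah wt.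
- apply: requ_trans (requ_clause ah wt) _; case/andP: ws => w1 w2.
  have [cf1 cf2] : (closed_free s1 \/ closed_RTy) /\ (closed_free s2 \/ closed_RTy).
    by case: cf => [/andP[]|]; auto.
  by apply: requ_rtens; [exact: IH1 cf1 w1 sz ah|exact: IH2 cf2 w2 sz ah].
- apply: requ_trans (requ_clause ah wt) _; case/andP: ws => w1 w2.
  have [cf1 cf2] : (closed_free s1 \/ closed_RTy) /\ (closed_free s2 \/ closed_RTy).
    by case: cf => [/andP[]|]; auto.
  by apply: requ_rlolli; [exact: IH1 cf1 w1 sz ah|exact: IH2 cf2 w2 sz ah].
- apply: requ_trans (requ_clause ah wt) _.
  by apply: requ_rbang; exact: IH1 cf ws sz ah.
apply: requ_trans (requ_clause ah wt) _.
have rC := rel_clause ah wt.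
have rI : rel W (ic_rel (tsub_of ts) (tsub_of us) (nth (RVar 0) hs) (IPi s1))
    (ty_sub (tsub_of ts) (TPi (ic_ty s1))) (ty_sub (tsub_of us) (TPi (ic_ty s1))).
  apply: (@rel_ic_rel n) => // i hi; apply: adm_rel; apply: adms_nth => //.
  by rewrite sz.
apply: requ_rpi rC rI _ => W' r c c' S m aS.
have [st su] := adms_size ah.
have ah' := adms_cons aS (adms_ren m ah).
have := IH1 n.+1 W' _ _ _ cf ws _ ah'; rewrite /= size_map sz => /(_ erefl).
have T d vs : size vs = size hs -> pity (TVar \o rty r) d (ty_sub (upT (tsub_of vs)) (ic_ty s1))
    = ty_sub (tsub_of (d :: map (tyr r) vs)) (ic_ty s1).
  move=> sv; rewrite pity_upT; apply: (@ty_sub_wf n.+1); first exact: wf_ic_ty.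
  by case=> [|i] //= hi; rewrite /tsub_of /= (nth_map TUnit) // sv sz.
rewrite -!T // (piinst_ic_rel _ _ _ _ _ _ _ ws).
fold ic_ty => e.
have M : map (rl_sub (scons c' (scons c (TVar \o rty r))) (Var \o rtm r)
    (scons S (RVar \o rrl r))) (map (wkr 2 0 1) hs) = map (rlr r) hs.
  by rewrite -map_comp; apply: eq_map => h /=; sig.
rewrite M.
have <- : ic_rel (tsub_of (c :: map (tyr r) ts)) (tsub_of (c' :: map (tyr r) us))
    (nth (RVar 0) (S :: map (rlr r) hs)) s1
  = ic_rel (scons c (tyr r \o tsub_of ts)) (scons c' (tyr r \o tsub_of us))
      (scons S (rlr r \o nth (RVar 0) hs)) s1; last exact: e.
apply: (@ic_rel_ext n.+1) ws _ => -[|i] //= hi.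
have hi' : i < size hs by rewrite sz.
by split; rewrite /tsub_of /= ?(nth_map TUnit) ?(nth_map (RVar 0)) ?st ?su.
Qed.

Lemma adms_nil W : adms W [::] [::] [::].
Proof. by split=> //; apply: aa_nil. Qed.

Lemma idext0 W c : wf_ty 0 c -> requ W c c (RTy c [::]) (req c).
Proof.
move=> wc; have wW : wf W c by apply: wf_ty0.
have E s : ty_sub s c = c by apply: wf_ty0_sub.
apply: requ_of_holds; last 1 first.
- move=> W' r m; apply: d_theory; right.
  have -> : prr r (requiv c c (RTy c [::]) (req c))
    = iter 0 PAllTy (requiv c c (RTy c (mkseq (fun i => req (TVar i)) 0)) (req c)).
    have Er s : ty_ren s c = c by rewrite ty_renE.
    by rewrite /requiv /req /wkr /= ?Er.
  exact: id_ext.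
- by have := adm_rel (adm_RTy (adms_nil W) (wc : wf_ty (size [::]) c)); rewrite !E.
exact: rel_req.
Qed.

Lemma closed_RTy_holds : closed_RTy.
Proof.
move=> c W hs ts us wc ah.
have E s : ty_sub s c = c by apply: wf_ty0_sub.
have wn n : wf_icty n (icty_of c) by rewrite wf_icty_of; apply: wf_ty0.
have cf := icty_of_closed_free c.
have := requ_RTy_ic_gen (or_introl cf) (wn _) erefl ah.
have := requ_RTy_ic_gen (or_introl cf) (wn _) erefl (adms_nil W).
rewrite ic_ty_of !E => e0 eh; apply: requ_trans eh _.
apply: requ_trans (idext0 W wc); apply: requ_sym.
have <- : ic_rel (tsub_of [::]) (tsub_of [::]) (nth (RVar 0) [::]) (icty_of c)
  = ic_rel (tsub_of ts) (tsub_of us) (nth (RVar 0) hs) (icty_of c) => //.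
by apply: (@ic_rel_ext 0).
Qed.

Lemma requ_RTy_ic n s W hs ts us : wf_icty n s -> size hs = n -> adms W hs ts us ->
  requ W (ty_sub (tsub_of ts) (ic_ty s)) (ty_sub (tsub_of us) (ic_ty s))
    (RTy (ic_ty s) hs) (ic_rel (tsub_of ts) (tsub_of us) (nth (RVar 0) hs) s).
Proof. exact: requ_RTy_ic_gen (or_intror closed_RTy_holds). Qed.

Lemma idext1 W a b : wf_ty 1 a -> wf W b ->
  requ W (tinst a b) (tinst a b) (RTy a [:: req b]) (req (tinst a b)).
Proof.
move=> wa wb; have wab : wf W (tinst a b) by apply: wf_ty_sub wa _ => -[].
have E c : ty_sub (tsub_of [:: c]) a = tinst a c by apply: ty_sub_wf wa _ => -[].
apply: requ_of_holds.
- have ah : adms W [:: req b] [:: b] [:: b].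
    by apply: adms_cons (adms_nil W); apply: adm_req.
  by have := adm_rel (adm_RTy ah (wa : wf_ty (size [:: req b]) a)); rewrite E.
- exact: rel_req.
have H : holds W (PAllTy (requiv a a (RTy a [:: req (TVar 0)]) (req a))).
  move=> W' r m; apply: d_theory; right.
  have -> : prr r (PAllTy (requiv a a (RTy a [:: req (TVar 0)]) (req a)))
    = iter 1 PAllTy (requiv a a (RTy a (mkseq (fun i => req (TVar i)) 1)) (req a)).
    have Er s : ty_ren (upr s) a = a.
      rewrite ty_renE -[RHS]ty_sub_id; apply: ty_sub_wf wa _ => -[] //.
    by rewrite /requiv /req /wkr /= ?ty_ren0 ?Er.
  exact: id_ext.
by apply: holds_eq (holds_allTy H wb) _; rewrite /tinst; sig.
Qed.

(** Identity extension is an axiom about [RTy]; the equivalence of [RTy] with the structural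
    interpretation transfers it. Every later appeal to parametricity goes through this form. *)
Lemma idext_ic W s A R : wf_icty 1 s -> wf W (A 0) -> R 0 = req (A 0) ->
  requ W (ty_sub A (ic_ty s)) (ty_sub A (ic_ty s)) (ic_rel A A R s)
    (req (ty_sub A (ic_ty s))).
Proof.
move=> ws wA R0; have wa := wf_ic_ty ws.
have E : ty_sub A (ic_ty s) = tinst (ic_ty s) (A 0) by apply: ty_sub_wf wa _ => -[].
have E' : ty_sub (tsub_of [:: A 0]) (ic_ty s) = tinst (ic_ty s) (A 0).
  by apply: ty_sub_wf wa _ => -[].
have ah : adms W [:: req (A 0)] [:: A 0] [:: A 0].
  by apply: adms_cons (adms_nil W); apply: adm_req.
have := requ_RTy_ic ws (erefl : size [:: req (A 0)] = 1) ah; rewrite E' E => e.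
apply: requ_trans (idext1 wa wA); apply: requ_sym.
have -> : ic_rel A A R s = ic_rel (tsub_of [:: A 0]) (tsub_of [:: A 0])
   (nth (RVar 0) [:: req (A 0)]) s by apply: ic_rel_ext ws _ => -[].
exact: e.
Qed.

(** * Extensionality for functions out of a tensor and out of ! *)

Lemma typed_of Xi G t a : sty Xi (map snd G) t a -> lin t -> uses G (occ^~ t) ->
  typed Xi G t a.
Proof. by move=> st lt u; apply: sty_typed st _ erefl lt u. Qed.

Lemma uses2 G m0 m1 a b f : use_mode m0 (f 0) -> use_mode m1 (f 1) ->
  uses ((m0, b) :: (m1, a) :: ictx G) f.
Proof.
move=> u0 u1 [|[|i]] m c /=; [by case=> <-|by case=> <-|].
by move=> e; have [d _ [-> _]] := onth_map_inv e.
Qed.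

Lemma csplit_ictx G : csplit (ictx G) (ictx G) (ictx G).
Proof. by elim: G => [|a G IH]; constructor. Qed.

Lemma sty_wk2 Xi G t a b c : sty Xi G t a -> sty Xi (b :: c :: G) (wkt 0 2 t) a.
Proof.
move=> st; rewrite -[a]ty_ren0; apply: sty_ren st _ _; first exact: ren_ty_wk.
by move=> i d e; rewrite ty_ren0.
Qed.

Definition curryT (a b : ty) (f : tm) : tm :=
  Lam a (Lam b (App (wkt 0 2 f) (Tens (Var 1) (Var 0)))).

Lemma exteq_letT_eta Xi G a b c f z : wf_ty Xi a -> wf_ty Xi b ->
  wt Xi G f (TLolli (TTens a b) c) -> wt Xi G z (TTens a b) ->
  exteq Xi (ictx G) (letT (curryT a b f) z) (App f z) c.
Proof.
move=> wa wb [sf lf] [sz lz].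
have tz : typed Xi (ictx G) z (TTens a b) by apply/typed_wt.
have tf : typed Xi (ictx G) f (TLolli (TTens a b) c) by apply/typed_wt.
have sp := csplit_ictx G.
have sf2 : sty Xi [:: b, a & G] (wkt 0 2 f) (TLolli (TTens a b) c) by exact: sty_wk2.
have sf4 : sty Xi [:: b, a, b, a & G] (wkt 0 2 (wkt 0 2 f)) (TLolli (TTens a b) c).
  exact: sty_wk2.
have sf3 : sty Xi [:: b, b, a & G] (wkt 0 1 (wkt 0 2 f)) (TLolli (TTens a b) c).
  rewrite -[TLolli _ _]ty_ren0; apply: sty_ren sf2 _ _; first exact: ren_ty_wk.
  exact: ren_tm_wk1.
have T i j a' b' D : onth D i = Some a' -> onth D j = Some b' ->
  sty Xi D (Tens (Var i) (Var j)) (TTens a' b').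
  by move=> ei ej; apply: sty_tens; apply: sty_var.
(* The second component is consumed by the argument [Var 0] of the outer application, so it is
   [Gone] while the function part is reduced. *)
have b1 : exteq Xi [:: (Gone, b), (Lin, a) & ictx G]
   (App (wkt 0 2 (curryT a b f)) (Var 1))
   (Lam b (App (wkt 0 1 (wkt 0 2 f)) (Tens (Var 2) (Var 0)))) (TLolli b c).
  have E : wkt 0 2 (curryT a b f)
    = Lam a (Lam b (App (wkt 0 2 (wkt 0 2 f)) (Tens (Var 1) (Var 0)))).
    rewrite /curryT /wkt /= !ty_ren0; congr (Lam _ (Lam _ (App _ _))); sig.
  rewrite E; apply: ee_ax.
  - have -> : Lam b (App (wkt 0 1 (wkt 0 2 f)) (Tens (Var 2) (Var 0)))
      = tm_sub TVar (scons (Var 1) Var)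
         (Lam b (App (wkt 0 2 (wkt 0 2 f)) (Tens (Var 1) (Var 0)))).
      sig.
    exact: beta_lam.
  - apply: typed_of.
    + rewrite /= ictx_snd; apply: (@sty_app _ _ a); last exact: sty_var.
      do 2 apply: sty_lam => //; apply: sty_app sf4 _; exact: T.
    + by rewrite /= !occ_wk //= !lin_ren lf.
    + by apply: uses2; rewrite /= /wkt tm_ren_ren; rewrite occ_ren0.
  apply: typed_of.
  - rewrite /= ictx_snd; apply: sty_lam => //; apply: sty_app sf3 _; exact: T.
  - by rewrite /= !occ_wk //= !lin_ren lf.
  by apply: uses2; rewrite /= /wkt tm_ren_ren; rewrite occ_ren0.
have b2 : exteq Xi [:: (Lin, b), (Lin, a) & ictx G]
   (App (Lam b (App (wkt 0 1 (wkt 0 2 f)) (Tens (Var 2) (Var 0)))) (Var 0))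
   (App (wkt 0 2 f) (Tens (Var 1) (Var 0))) c.
  apply: ee_ax.
  - have -> : App (wkt 0 2 f) (Tens (Var 1) (Var 0)) = tm_sub TVar (scons (Var 0) Var)
       (App (wkt 0 1 (wkt 0 2 f)) (Tens (Var 2) (Var 0))) by sig.
    exact: beta_lam.
  - apply: typed_of.
    + rewrite /= ictx_snd; apply: (@sty_app _ _ b); last exact: sty_var.
      apply: sty_lam => //; apply: sty_app sf3 _; exact: T.
    + by rewrite /= !occ_wk //= !lin_ren lf.
    + by apply: uses2; rewrite /= /wkt tm_ren_ren; rewrite occ_ren0.
  apply: typed_of.
  - rewrite /= ictx_snd; apply: sty_app sf2 _; exact: T.
  - by rewrite /= !lin_ren lf.
  by apply: uses2; rewrite /= /wkt occ_ren0.
have v0 : typed Xi [:: (Lin, b), (Gone, a) & ictx G] (Var 0) b.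
  apply: typed_of => //; last by apply: uses2.
  by apply: sty_var.
apply: ee_trans.
  apply: ee_letT sp (ee_refl tz) (ee_trans _ b2).
  by apply: ee_app b1 (ee_refl v0); apply: split_right; apply: split_left; exact: csplit_ictx.
have tT : typed Xi [:: (Lin, b), (Lin, a) & ictx G] (Tens (Var 1) (Var 0)) (TTens a b).
  apply: typed_of => //; last by apply: uses2.
  by rewrite /= ictx_snd; apply: T.
have tL : typed Xi (ictx G) (LetT z (Tens (Var 1) (Var 0))) (TTens a b).
  exact: ty_letT sp tz tT.
apply: (@ee_trans _ _ _ (App f (LetT z (Tens (Var 1) (Var 0))))).
  apply: ee_ax.
  - have := comm_let KTens z (FAppR f) (Tens (Var 1) (Var 0)).
    by rewrite /= (_ : wkt 0 0 z = z); [exact|sig].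
  - apply: ty_letT sp tz _; apply: typed_of.
    + rewrite /= ictx_snd; apply: sty_app sf2 _; exact: T.
    + by rewrite /= !lin_ren lf.
    by apply: uses2; rewrite /= /wkt occ_ren0.
  exact: ty_app sp tf tL.
apply: ee_app sp (ee_refl tf) _; apply: ee_ax tL tz; exact: eta_tens.
Qed.

Lemma el_curryT W a b c f : wf W a -> wf W b -> el W f (TLolli (TTens a b) c) ->
  el W (curryT a b f) (TLolli a (TLolli b c)).
Proof.
move=> wa wb ef; apply: el_lam => //; last by rewrite /= occ_wk.
apply: el_lam => //; last by rewrite /= occ_wk.
apply: el_app; first exact: el_wk2 ef.
by apply: el_tens; el_at.
Qed.

Lemma letT_eta W a b c f z : wf W a -> wf W b ->
  el W f (TLolli (TTens a b) c) -> el W z (TTens a b) ->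
  eqv W c (letT (curryT a b f) z) (App f z).
Proof.
move=> wa wb ef ez; split.
- by apply: el_letTapp (el_curryT wa wb ef) ez.
- exact: el_app ef ez.
move=> W' r m; have ef' := el_ren m ef; have ez' := el_ren m ez.
have := d_exteq parametricity (wT W') (wP W')
  (exteq_letT_eta (wf_ren m wa) (wf_ren m wb) ef' ez').
by move=> d; apply: derivable_eq d _; rewrite /letT /curryT; sig.
Qed.

Lemma curryT_beta W a b c f x y : wf W a -> wf W b ->
  el W f (TLolli (TTens a b) c) -> el W x a -> el W y b ->
  eqv W c (App (App (curryT a b f) x) y) (App f (Tens x y)).
Proof.
move=> wa wb ef ex ey.
have ef2 : el (wtm b (wtm a W)) (App (wkt 0 2 f) (Tens (Var 1) (Var 0))) c.
  by apply: el_app (el_wk2 _ _ ef) _; apply: el_tens; el_at.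
apply: (@eqv_trans _ _ _ (App (Lam b (App (wkt 0 1 f) (Tens (wkt 0 1 x) (Var 0)))) y)).
  apply: eqv_app (eqv_refl ey).
  apply: (@eqv_beta _ a) => //; last by sig.
  - by apply: el_lam => //; rewrite /= occ_wk.
  - by rewrite /= occ_wk.
apply: eqv_beta => //; last by sig.
- apply: el_app; first exact: el_wtm ef.
  by apply: el_tens; [exact: el_wtm|el_at].
by rewrite /= !occ_wk.
Qed.

Lemma tens_ext W a b c f g z : wf W a -> wf W b ->
  el W f (TLolli (TTens a b) c) -> el W g (TLolli (TTens a b) c) ->
  (forall W' r x y, morph W W' r -> el W' x (tyr r a) -> el W' y (tyr r b) ->
     eqv W' (tyr r c) (App (tmr r f) (Tens x y)) (App (tmr r g) (Tens x y))) ->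
  el W z (TTens a b) -> eqv W c (App f z) (App g z).
Proof.
move=> wa wb ef eg K ez.
apply: eqv_trans (letT_eta wa wb eg ez).
apply: eqv_trans (eqv_sym (letT_eta wa wb ef ez)) _.
have ecf := el_curryT wa wb ef; have ecg := el_curryT wa wb eg.
have E r h : tmr r (curryT a b h) = curryT (tyr r a) (tyr r b) (tmr r h).
  by rewrite /curryT; sig.
have e : eqv W (TLolli a (TLolli b c)) (curryT a b f) (curryT a b g).
  apply: eqv_ext => // W1 r1 x m1 ex; rewrite !E.
  have := el_curryT (wf_ren m1 wa) (wf_ren m1 wb) (el_ren m1 ef).
  have := el_curryT (wf_ren m1 wa) (wf_ren m1 wb) (el_ren m1 eg).
  move=> ecg1 ecf1; apply: eqv_ext; [exact: wf_ren m1 wb|exact: el_app ecf1 ex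
    |exact: el_app ecg1 ex|].
  move=> W2 r2 y m2 ey; have m := morph_comp m1 m2.
  have C h : tmr r2 (App (curryT (tyr r1 a) (tyr r1 b) (tmr r1 h)) x)
    = App (curryT (tyr (rcomp r1 r2) a) (tyr (rcomp r1 r2) b) (tmr (rcomp r1 r2) h))
        (tmr r2 x) by rewrite /curryT; sig.
  rewrite !C !ty_ren_ren in ey *.
  have ex2 : el W2 (tmr r2 x) (tyr (rcomp r1 r2) a).
    by have := el_ren m2 ex; rewrite ty_ren_ren.
  have eB h : el W h (TLolli (TTens a b) c) -> _ :=
    fun eh => curryT_beta (wf_ren m wa) (wf_ren m wb) (el_ren m eh) ex2 ey.
  exact: eqv_trans (eB _ ef) (eqv_trans (K _ _ _ _ m ex2 ey) (eqv_sym (eB _ eg))).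
apply: eqv_sub' e (_ : el _ (LetT (wkt 0 1 z) (App (App (Var 2) (Var 1)) (Var 0))) _) _ _.
- apply: (@el_letT _ a b) => //; first exact: el_wtm ez.
  by apply: (@el_app _ b); [apply: (@el_app _ a)|]; el_at.
- by rewrite /letT /=; sig.
by rewrite /letT /=; sig.
Qed.

(** Identity extension relates [z] to itself by the ! of equality at [a]. By the second-order clause
    for !, tested at equality on [c], it is enough that [f] and [g] send equal elements [x] and [y]
    to equal values [f (!x)] and [g (!y)], which the premise provides. *)
Lemma bang_ext W a c f g z : wf W a -> wf W c ->
  el W f (TArr a c) -> el W g (TArr a c) ->
  (forall W' r x, morph W W' r -> el W' x (tyr r a) ->
     eqv W' (tyr r c) (App (tmr r f) (Bang x)) (App (tmr r g) (Bang x))) ->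
  el W z (TBang a) -> eqv W c (App f z) (App g z).
Proof.
move=> wa wc ef eg K ez.
have e := @idext_ic W (IBang (IVar 0)) (fun=> a) (fun=> req a) erefl wa erefl.
have wBa : wf W (TBang a) by [].
have hz : rl W (rbang a a (req a)) (TBang a) (TBang a) z z.
  by apply/(requ_id z z e); apply/reqP => //; exact: eqv_refl ez.
apply/(reqP _ _ wc); apply: rbangE hz (adm_req wc) _.
have ra := rel_req wa; have rc := rel_req wc.
apply: rarrI => // W' r x y m.
have Er d : rlr r (req d) = req (tyr r d) by sig.
rewrite !Er => /(reqP _ _ (wf_ren m wa)) exy; apply/(reqP _ _ (wf_ren m wc)).
have [ex _ _] := exy; apply: eqv_trans (K _ _ _ m ex) _.
apply: eqv_app (eqv_refl (el_ren m eg)) _; exact: eqv_bang exy.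
Qed.

(** * The functorial action *)

Lemma ic_map_ext n s A B F A' B' F' : wf_icty n s ->
  (forall i, i < n -> [/\ A i = A' i, B i = B' i & F i = F' i]) ->
  ic_map A B F s = ic_map A' B' F' s.
Proof.
elim: s n A B F A' B' F' => [i|c||s1 IH1 s2 IH2|s1 IH1 s2 IH2|s1 IH1|s1 IH1]
  n A B F A' B' F' ws e.
- by have [_ _ /= ->] := e _ ws.
- by [].
- by [].
- case/andP: (ws) => w1 w2.
  rewrite /= (IH1 _ _ _ _ A' B' F' w1 e) (IH2 _ _ _ _ A' B' F' w2 e).
  rewrite (ty_sub_wf (s := A) (s' := A') (wf_ic_ty w1)); last by move=> i /e[].
  by rewrite (ty_sub_wf (s := A) (s' := A') (wf_ic_ty w2)) // => i /e[].
- case/andP: (ws) => w1 w2.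
  have e' : forall i, i < n -> [/\ B i = B' i, A i = A' i & F i = F' i] by move=> i /e[].
  rewrite /= (IH1 _ _ _ _ B' A' F' w1 e') (IH2 _ _ _ _ A' B' F' w2 e).
  rewrite (ty_sub_wf (s := A) (s' := A') (wf_ic_ty w1)); last by move=> i /e[].
  rewrite (ty_sub_wf (s := A) (s' := A') (wf_ic_ty w2)); last by move=> i /e[].
  by rewrite (ty_sub_wf (s := B) (s' := B') (wf_ic_ty w1)) // => i /e[].
- rewrite /= (IH1 _ _ _ _ A' B' F' ws e).
  by rewrite (ty_sub_wf (s := A) (s' := A') (wf_ic_ty (ws : wf_icty n s1))) // => i /e[].
rewrite /= (IH1 n.+1 _ _ _ (upT A') (upT B')
  (scons (idtm (TVar 0)) (fun i => wkt 1 0 (F' i))) ws).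
  rewrite (ty_sub_wf (s := upT A) (s' := upT A') (wf_ic_ty (ws : wf_icty n.+1 s1))) //.
  by case=> //= i /e[->].
by case=> //= i /e[-> -> ->].
Qed.

Lemma ic_map_sub n s A B F st sb : wf_icty n s ->
  tm_sub st sb (ic_map A B F s)
  = ic_map (ty_sub st \o A) (ty_sub st \o B) (tm_sub st sb \o F) s.
Proof.
have up2 st' s' t : tm_sub st' (upt (upt s')) (wkt 0 2 t) = wkt 0 2 (tm_sub st' s' t).
  by sig.
have up3 st' s' t :
  tm_sub st' (upt (upt (upt s'))) (wkt 0 3 t) = wkt 0 3 (tm_sub st' s' t) by sig.
elim: s n A B F st sb => [i|c||s1 IH1 s2 IH2|s1 IH1 s2 IH2|s1 IH1|s1 IH1]
  n A B F st sb ws.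
- by [].
- by rewrite /= /idtm wf_ty0_sub.
- by [].
- case/andP: ws => w1 w2.
  by rewrite /= !up3 (IH1 _ _ _ _ _ _ w1) (IH2 _ _ _ _ _ _ w2) !ty_sub_sub.
- case/andP: ws => w1 w2.
  by rewrite /= !up2 (IH1 _ _ _ _ _ _ w1) (IH2 _ _ _ _ _ _ w2) !ty_sub_sub.
- by rewrite /= !up2 (IH1 _ _ _ _ _ _ ws) !ty_sub_sub.
rewrite /= -/(idtm _) !ty_sub_sub upT_comp.
have up1 t : tm_sub (upT st) (fun i => wkt 1 0 (upt sb i)) (wkt 0 1 t)
  = wkt 0 1 (tm_sub (upT st) (fun i => wkt 1 0 (sb i)) t) by sig.
rewrite up1 (IH1 n.+1 _ _ _ _ _ ws); congr (Lam _ (TLam (App (wkt 0 1 _) _))).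
by apply: (@ic_map_ext n.+1) ws _ => -[|i] //= _; split; sig.
Qed.

(* [okp i] ([okn i]) records that the functorial action may use [F i] at a
   positive (negative) occurrence of the variable [i]; for such an occurrence
   [F i] goes from [A i] to [B i] (from [B i] to [A i]). *)
Definition menv W n (okp okn : nat -> bool) (A B : nat -> ty) (F : nat -> tm) : Prop :=
  forall i, i < n -> [/\ wf W (A i), wf W (B i),
    okp i -> el W (F i) (TLolli (A i) (B i))
    & okn i -> el W (F i) (TLolli (B i) (A i))].

(** A variable barred from positive use must have only negative occurrences, and conversely; thus
    the action calls [F i] only in the directions in which it is typed. *)
Definition mpol n (okp okn : nat -> bool) (s : icty) : Prop :=
  forall i, i < n -> (okp i || polar false i (ic_ty s)) &&
    (okn i || polar true i (ic_ty s)).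

Lemma menv_swap W n okp okn A B F : menv W n okp okn A B F -> menv W n okn okp B A F.
Proof. by move=> e i /e[]. Qed.

Lemma mpol_split n okp okn s1 s2 : mpol n okp okn (ITens s1 s2) ->
  mpol n okp okn s1 /\ mpol n okp okn s2.
Proof.
move=> e; split=> i /e /=; case: (okp i); case: (okn i) => //=.
all: try by move/andP=> [/andP[? ?] /andP[? ?]]; apply/andP.
all: by rewrite ?andbT; case/andP.
Qed.

Lemma mpol_lolli n okp okn s1 s2 : mpol n okp okn (ILolli s1 s2) ->
  mpol n okn okp s1 /\ mpol n okp okn s2.
Proof.
move=> e; split=> i /e /=; case: (okp i); case: (okn i) => //=.
all: try by move/andP=> [/andP[? ?] /andP[? ?]]; apply/andP.
all: by rewrite ?andbT; case/andP.
Qed.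

(** The variable bound by Pi is acted on by the identity, which is available in both directions. *)
Lemma mpol_pi n okp okn s : mpol n okp okn (IPi s) ->
  mpol n.+1 (scons true okp) (scons true okn) s.
Proof. by move=> e [|i] //= /e. Qed.

Lemma el_idtm W a : wf W a -> el W (idtm a) (TLolli a a).
Proof. by move=> wa; apply: el_lam => //; el_at. Qed.

Lemma menv_up W n okp okn A B F : menv W n okp okn A B F ->
  menv (wty W) n.+1 (scons true okp) (scons true okn) (upT A) (upT B)
    (scons (idtm (TVar 0)) (fun i => wkt 1 0 (F i))).
Proof.
move=> e [|i] /=; first by split=> // _; apply: el_idtm.
move/e=> [wa wb ep en]; have m := morph_wty W; split.
- exact: wf_ren m wa.
- exact: wf_ren m wb.
- by move/ep => h; apply: el_ren m h.
by move/en => h; apply: el_ren m h.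
Qed.

Lemma menv_ren W W' r n okp okn A B F : morph W W' r -> menv W n okp okn A B F ->
  menv W' n okp okn (tyr r \o A) (tyr r \o B) (tmr r \o F).
Proof.
move=> m e i /e[wa wb ep en]; split.
- exact: wf_ren m wa.
- exact: wf_ren m wb.
- by move/ep => h; apply: el_ren m h.
by move/en => h; apply: el_ren m h.
Qed.

Lemma wf_menv W n okp okn A B F s : wf_icty n s -> menv W n okp okn A B F ->
  wf W (ty_sub A (ic_ty s)) /\ wf W (ty_sub B (ic_ty s)).
Proof.
by move=> ws e; split; apply: wf_ty_sub (wf_ic_ty ws) _ => i /e[].
Qed.

Lemma el_wk W D t a : el W t a ->
  el (World (wX W) (D ++ wG W) (wT W) (wP W)) (wkt 0 (size D) t) a.
Proof.
case=> st lt; split; last by rewrite lin_ren.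
rewrite -[a]ty_ren0; apply: sty_ren st _ _; first exact: ren_ty_wk.
by move=> i d e; rewrite /= ty_ren0; elim: D.
Qed.

Lemma el_ic_map n s W okp okn A B F : wf_icty n s -> mpol n okp okn s ->
  menv W n okp okn A B F ->
  el W (ic_map A B F s) (TLolli (ty_sub A (ic_ty s)) (ty_sub B (ic_ty s))).
Proof.
elim: s n W okp okn A B F => [i|c||s1 IH1 s2 IH2|s1 IH1 s2 IH2|s1 IH1|s1 IH1]
  n W okp okn A B F ws ps e.
- have [_ _ ep _] := e _ ws; apply: ep.
  by have := ps _ ws; rewrite /= eqxx /= orbF; case/andP.
- by rewrite /= !wf_ty0_sub //; apply: el_idtm; apply: wf_ty0.
- exact: el_idtm.
- have [wA _] := wf_menv ws e.
  case/andP: ws => w1 w2; have [p1 p2] := mpol_split ps.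
  have e1 := IH1 _ _ _ _ _ _ _ w1 p1 e; have e2 := IH2 _ _ _ _ _ _ _ w2 p2 e.
  apply: el_lam => //; last by rewrite /= !occ_wk.
  apply: (@el_letT _ (ty_sub A (ic_ty s1)) (ty_sub A (ic_ty s2))); [by el_at| | |].
  + apply: el_tens.
      apply: el_app (_ : el _ (Var 1) (ty_sub A (ic_ty s1))); last by el_at.
      exact: (el_wk [:: _; _; _] e1).
    apply: el_app (_ : el _ (Var 0) (ty_sub A (ic_ty s2))); last by el_at.
    exact: (el_wk [:: _; _; _] e2).
  + by rewrite /= !occ_wk.
  + by rewrite /= !occ_wk.
- have [wA wB] := wf_menv ws e.
  case/andP: (ws) => w1 w2; have [p1 p2] := mpol_lolli ps.
  have [wA1 wB1] := wf_menv w1 e.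
  have e1 := IH1 _ _ _ _ _ _ _ w1 p1 (menv_swap e).
  have e2 := IH2 _ _ _ _ _ _ _ w2 p2 e.
  apply: el_lam => //; last by rewrite /= !occ_wk.
  apply: el_lam => //; last by rewrite /= !occ_wk.
  apply: el_app (el_wk [:: _; _] e2) _.
  apply: (@el_app _ (ty_sub A (ic_ty s1))); first by el_at.
  by apply: el_app (el_wk [:: _; _] e1) _; el_at.
- have [wA _] := wf_menv ws e.
  have e1 := IH1 _ _ _ _ _ _ _ ws ps e.
  apply: el_lam => //; last by rewrite /= !occ_wk.
  apply: (@el_letB _ (ty_sub A (ic_ty s1))); first by el_at.
  by apply: el_bang; apply: el_app (el_wk [:: _; _] e1) _; el_at.
have [wA wB] := wf_menv ws e.
have e1 := IH1 n.+1 _ _ _ _ _ _ ws (mpol_pi ps) (menv_up e).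
apply: el_lam => //; last by rewrite /= !occ_wk.
apply: el_tlam; apply: el_app (el_wk [:: _] e1) _.
apply: (@el_tapp _ (ty_ren (upr (addn 1)) (ty_sub (upT A) (ic_ty s1)))) => //.
  by el_at.
by sig.
Qed.

Section Steps.

Variables (n : nat) (W : world) (okp okn : nat -> bool) (A B : nat -> ty) (F : nat -> tm).
Hypothesis e : menv W n okp okn A B F.

Lemma ic_map_tens s1 s2 x y : wf_icty n (ITens s1 s2) -> mpol n okp okn (ITens s1 s2) ->
  el W x (ty_sub A (ic_ty s1)) -> el W y (ty_sub A (ic_ty s2)) ->
  eqv W (ty_sub B (ic_ty (ITens s1 s2)))
    (App (ic_map A B F (ITens s1 s2)) (Tens x y))
    (Tens (App (ic_map A B F s1) x) (App (ic_map A B F s2) y)).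
Proof.
move=> ws ps ex ey; have [wA _] := wf_menv ws e.
case/andP: (ws) => w1 w2; have [p1 p2] := mpol_split ps.
have e1 := el_ic_map w1 p1 e; have e2 := el_ic_map w2 p2 e.
have eT D0 D1 D : el (World (wX W) [:: ty_sub A (ic_ty s2), ty_sub A (ic_ty s1), D0 & wG W] D D1)
   (Tens (App (wkt 0 3 (ic_map A B F s1)) (Var 1)) (App (wkt 0 3 (ic_map A B F s2)) (Var 0)))
   (TTens (ty_sub B (ic_ty s1)) (ty_sub B (ic_ty s2))).
  apply: el_tens.
    apply: el_app (_ : el _ (Var 1) (ty_sub A (ic_ty s1))); last by el_at.
    exact: (el_wk [:: _; _; _] e1).
  apply: el_app (_ : el _ (Var 0) (ty_sub A (ic_ty s2))); last by el_at.
  exact: (el_wk [:: _; _; _] e2).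
apply: (@eqv_trans _ _ _ (LetT (Tens x y) (Tens
   (App (wkt 0 2 (ic_map A B F s1)) (Var 1)) (App (wkt 0 2 (ic_map A B F s2)) (Var 0))))).
  apply: (@eqv_beta _ (ty_sub A (ic_ty (ITens s1 s2)))) => //.
  - by apply: (@el_letT _ (ty_sub A (ic_ty s1)) (ty_sub A (ic_ty s2)));
      [by el_at|exact: eT|rewrite /= !occ_wk|rewrite /= !occ_wk].
  - by rewrite /= !occ_wk.
  - exact: el_tens.
  by sig.
apply: (eqv_betaT ex ey).
- apply: el_tens.
    apply: el_app (_ : el _ (Var 1) (ty_sub A (ic_ty s1))); last by el_at.
    exact: (el_wk [:: _; _] e1).
  apply: el_app (_ : el _ (Var 0) (ty_sub A (ic_ty s2))); last by el_at.
  exact: (el_wk [:: _; _] e2).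
- by rewrite /= !occ_wk.
- by rewrite /= !occ_wk.
by sig.
Qed.

Lemma ic_map_bang s1 x : wf_icty n s1 -> mpol n okp okn s1 ->
  el W x (ty_sub A (ic_ty s1)) ->
  eqv W (ty_sub B (ic_ty (IBang s1))) (App (ic_map A B F (IBang s1)) (Bang x))
    (Bang (App (ic_map A B F s1) x)).
Proof.
move=> w1 p1 ex; have [wA _] := wf_menv w1 e; have e1 := el_ic_map w1 p1 e.
apply: (@eqv_trans _ _ _ (LetB (Bang x) (Bang (App (wkt 0 1 (ic_map A B F s1)) (Var 0))))).
  apply: (@eqv_beta _ (TBang (ty_sub A (ic_ty s1)))) => //.
  - apply: (@el_letB _ (ty_sub A (ic_ty s1))); first by el_at.
    by apply: el_bang; apply: el_app (el_wk [:: _; _] e1) _; el_at.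
  - by rewrite /= !occ_wk.
  - exact: el_bang.
  by sig.
apply: (eqv_betaB ex); last by sig.
by apply: el_bang; apply: el_app (el_wk [:: _] e1) _; el_at.
Qed.

Lemma ic_map_lolli s1 s2 u x : wf_icty n (ILolli s1 s2) ->
  mpol n okp okn (ILolli s1 s2) ->
  el W u (ty_sub A (ic_ty (ILolli s1 s2))) -> el W x (ty_sub B (ic_ty s1)) ->
  eqv W (ty_sub B (ic_ty s2)) (App (App (ic_map A B F (ILolli s1 s2)) u) x)
    (App (ic_map A B F s2) (App u (App (ic_map B A F s1) x))).
Proof.
move=> ws ps eu ex; have [wA _] := wf_menv ws e.
case/andP: (ws) => w1 w2; have [p1 p2] := mpol_lolli ps.
have [wA1 wB1] := wf_menv w1 e.
have e1 := el_ic_map w1 p1 (menv_swap e); have e2 := el_ic_map w2 p2 e.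
apply: (@eqv_trans _ _ _ (App (Lam (ty_sub B (ic_ty s1)) (App (wkt 0 1 (ic_map A B F s2))
   (App (wkt 0 1 u) (App (wkt 0 1 (ic_map B A F s1)) (Var 0))))) x)).
  apply: eqv_app (eqv_refl ex).
  apply: (@eqv_beta _ (ty_sub A (ic_ty (ILolli s1 s2)))) => //.
  - apply: el_lam => //; last by rewrite /= !occ_wk.
    apply: el_app (el_wk [:: _; _] e2) _.
    apply: (@el_app _ (ty_sub A (ic_ty s1))); first by el_at.
    by apply: el_app (el_wk [:: _; _] e1) _; el_at.
  - by rewrite /= !occ_wk.
  by sig.
apply: eqv_beta => //; last by sig.
- apply: el_app (el_wk [:: _] e2) _; apply: el_app (el_wk [:: _] eu) _.
  by apply: el_app (el_wk [:: _] e1) _; el_at.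
by rewrite /= !occ_wk.
Qed.

Lemma ic_map_pi s1 z c : wf_icty n (IPi s1) -> mpol n okp okn (IPi s1) ->
  el W z (ty_sub A (ic_ty (IPi s1))) -> wf W c ->
  eqv W (ty_sub (scons c B) (ic_ty s1)) (TApp (App (ic_map A B F (IPi s1)) z) c)
    (App (ic_map (scons c A) (scons c B) (scons (idtm c) F) s1) (TApp z c)).
Proof.
move=> ws ps ez wc; have [wA _] := wf_menv ws e.
pose F1 := scons (idtm (TVar 0)) (fun i => wkt 1 0 (F i)).
have e1 : el (wty W) (ic_map (upT A) (upT B) F1 s1) _ :=
  el_ic_map (ws : wf_icty n.+1 s1) (mpol_pi ps) (menv_up e).
have cE : ty_sub (scons c B) (ic_ty s1) = tinst (ty_sub (upT B) (ic_ty s1)) c by sig.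
apply: (@eqv_trans _ _ _ (TApp (TLam (App (ic_map (upT A) (upT B) F1 s1)
   (TApp (wkt 1 0 z) (TVar 0)))) c)).
  apply: eqv_tapp wc cE.
  apply: (@eqv_beta _ (ty_sub A (ic_ty (IPi s1)))) => //.
  - apply: el_tlam; apply: el_app (el_wk [:: _] e1) _.
    apply: (@el_tapp _ (ty_ren (upr (addn 1)) (ty_sub (upT A) (ic_ty s1)))) => //.
      by el_at.
    by sig.
  - by rewrite /= !occ_wk.
  by rewrite /=; fold ic_map; rewrite -/F1; move: (ic_map _ _ F1 s1) => M; sig.
apply: (@eqv_tbeta _ (ty_sub (upT B) (ic_ty s1))) => //.
  apply: el_app e1 _.
  apply: (@el_tapp _ (ty_ren (upr (addn 1)) (ty_sub (upT A) (ic_ty s1)))) => //.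
    exact: el_ren (morph_wty W) ez.
  by sig.
rewrite /= (ic_map_sub _ _ _ _ _ (ws : wf_icty n.+1 s1)); congr (App _ (TApp _ _)).
  by apply: (@ic_map_ext n.+1) ws _ => -[|i] _; rewrite /F1; split; sig.
by sig.
Qed.

End Steps.

Lemma ic_map_ren n r s A B F : wf_icty n s ->
  tmr r (ic_map A B F s) = ic_map (tyr r \o A) (tyr r \o B) (tmr r \o F) s.
Proof.
move=> ws; rewrite tm_renE (ic_map_sub _ _ _ _ _ ws).
by apply: ic_map_ext ws _ => i _; split; sig.
Qed.

Lemma ic_map_id_ren n r s A : wf_icty n s -> tmr r (ic_map A A (idtm \o A) s)
  = ic_map (tyr r \o A) (tyr r \o A) (idtm \o (tyr r \o A)) s.
Proof. by move=> ws; rewrite (ic_map_ren _ _ _ _ ws). Qed.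

Lemma idtm_ren r A a : tmr r (idtm (ty_sub A a)) = idtm (ty_sub (tyr r \o A) a).
Proof. by rewrite /idtm /= ty_ren_sub. Qed.

Lemma idtm_beta W a x : el W x a -> wf W a -> eqv W a (App (idtm a) x) x.
Proof. by move=> ex wa; apply: eqv_beta => //; el_at. Qed.

Lemma tm_ren_app rt r t u : tm_ren rt r (App t u) = App (tm_ren rt r t) (tm_ren rt r u).
Proof. by []. Qed.

Lemma menv_idtm W n A : (forall i, i < n -> wf W (A i)) ->
  menv W n xpredT xpredT A A (idtm \o A).
Proof. by move=> wA i /wA wi; split=> // _; apply: el_idtm. Qed.

Lemma mpol_true n s : mpol n xpredT xpredT s.
Proof. by []. Qed.

(** Elements of function and Pi types are compared by extensionality, those of tensor and ! types by
    [tens_ext] and [bang_ext]. All variables carry identities, not only the functor variable, so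
    that the induction passes below Pi. *)
Lemma ic_map_idtm n s W A x : wf_icty n s -> (forall i, i < n -> wf W (A i)) ->
  el W x (ty_sub A (ic_ty s)) ->
  eqv W (ty_sub A (ic_ty s)) (App (ic_map A A (idtm \o A) s) x) x.
Proof.
elim: s n W A x => [i|c||s1 IH1 s2 IH2|s1 IH1 s2 IH2|s1 IH1|s1 IH1] n W A x ws wA ex.
- exact: idtm_beta ex (wA _ ws).
- by rewrite /= wf_ty0_sub // in ex *; apply: idtm_beta => //; apply: wf_ty0.
- exact: idtm_beta.
- have [wS _] := wf_menv ws (menv_idtm wA).
  have eM := el_ic_map ws (@mpol_true _ _) (menv_idtm wA).
  case/andP: (ws) => w1 w2.
  have [wS1 _] := wf_menv w1 (menv_idtm wA); have [wS2 _] := wf_menv w2 (menv_idtm wA).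
  (* The right side is written as a value of the identity map because [tens_ext] compares two
     functions at the same argument. *)
  apply: eqv_trans (idtm_beta ex wS).
  apply: tens_ext eM (el_idtm wS) _ ex => // W' r y z m ey ez.
  have wA' i : i < n -> wf W' ((tyr r \o A) i) by move/wA; apply: wf_ren m.
  rewrite (ic_map_id_ren _ _ ws) idtm_ren !ty_ren_sub in ey ez *.
  have H := ic_map_tens (menv_idtm wA') ws (@mpol_true _ _) ey ez.
  apply: (eqv_trans H) => {H}.
  have H := idtm_beta (el_tens ey ez) (wf_menv ws (menv_idtm wA')).1.
  apply: eqv_trans (eqv_sym H) => {H}.
  by apply: eqv_tens; [exact: IH1 w1 wA' ey|exact: IH2 w2 wA' ez].
- have eM := el_ic_map ws (@mpol_true _ _) (menv_idtm wA).
  case/andP: (ws) => w1 w2; have [wS1 _] := wf_menv w1 (menv_idtm wA).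
  apply: eqv_ext => //; first exact: el_app eM ex.
  move=> W' r y m ey.
  have wA' i : i < n -> wf W' ((tyr r \o A) i) by move/wA; apply: wf_ren m.
  have ex' := el_ren m ex.
  rewrite tm_ren_app (ic_map_id_ren _ _ ws) !ty_ren_sub in ey ex' *.
  have eM1 := el_ic_map w1 (@mpol_true _ _) (menv_idtm wA').
  have H := ic_map_lolli (menv_idtm wA') ws (@mpol_true _ _) ex' ey.
  apply: (eqv_trans H) => {H}.
  apply: (eqv_trans (IH2 _ _ _ _ w2 wA' (el_app ex' (el_app eM1 ey)))).
  apply: eqv_app (eqv_refl ex') _; exact: IH1 w1 wA' ey.
- have [wS _] := wf_menv ws (menv_idtm wA).
  have eM := el_ic_map ws (@mpol_true _ _) (menv_idtm wA).
  have [wS1 _] := wf_menv (s := s1) ws (menv_idtm wA).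
  apply: eqv_trans (idtm_beta ex wS).
  apply: bang_ext eM (el_idtm wS) _ ex => // W' r y m ey.
  have wA' i : i < n -> wf W' ((tyr r \o A) i) by move/wA; apply: wf_ren m.
  rewrite (ic_map_id_ren _ _ ws) idtm_ren !ty_ren_sub in ey *.
  have H := ic_map_bang (menv_idtm wA') (ws : wf_icty n s1) (@mpol_true _ _) ey.
  apply: (eqv_trans H) => {H}.
  have H := idtm_beta (el_bang ey) (wf_menv (s := IBang s1) ws (menv_idtm wA')).1.
  apply: eqv_trans (eqv_sym H) => {H}.
  by apply: eqv_bang; exact: IH1 ws wA' ey.
have eM := el_ic_map ws (@mpol_true _ _) (menv_idtm wA).
apply: eqv_extT => //; first exact: el_app eM ex.
move=> W' r c m wc.
have wA' i : i < n -> wf W' ((tyr r \o A) i) by move/wA; apply: wf_ren m.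
have wA1 i : i < n.+1 -> wf W' (scons c (tyr r \o A) i) by case: i => [|i] // /wA'.
have ex' : el W' (tmr r x) (ty_sub (tyr r \o A) (ic_ty (IPi s1))).
  by rewrite -ty_ren_sub; apply: el_ren m ex.
have cE : ty_sub (scons c (TVar \o rty r)) (ty_sub (upT A) (ic_ty s1))
  = ty_sub (scons c (tyr r \o A)) (ic_ty s1) by sig.
rewrite cE.
have -> : tmr r (App (ic_map A A (idtm \o A) (IPi s1)) x)
  = App (ic_map (tyr r \o A) (tyr r \o A) (idtm \o (tyr r \o A)) (IPi s1)) (tmr r x).
  by rewrite -[ic_map (_ \o _) _ _ _](ic_map_id_ren r A ws).
have H := ic_map_pi (menv_idtm wA') ws (@mpol_true _ _) ex' wc.
apply: (eqv_trans H) => {H}.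
(* The environment extended by an identity is again a family of identities, the form required by the
   induction hypothesis. *)
have -> : ic_map (scons c (tyr r \o A)) (scons c (tyr r \o A))
    (scons (idtm c) (idtm \o (tyr r \o A))) s1
  = ic_map (scons c (tyr r \o A)) (scons c (tyr r \o A))
    (idtm \o scons c (tyr r \o A)) s1 by apply: (@ic_map_ext n.+1) ws _ => -[].
apply: (IH1 n.+1) => //.
apply: (@el_tapp _ (ty_sub (upT (tyr r \o A)) (ic_ty s1))) => //.
by sig.
Qed.

(** * Parametricity of the functorial action *)

Definition comp (a : ty) (f g : tm) : tm := Lam a (App (wkt 0 1 f) (App (wkt 0 1 g) (Var 0))).

Lemma el_comp W a b c f g : wf W a -> el W f (TLolli b c) -> el W g (TLolli a b) ->
  el W (comp a f g) (TLolli a c).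
Proof.
move=> wa ef eg; apply: el_lam => //; last by rewrite /= !occ_wk.
apply: el_app (el_wtm _ ef) _; apply: el_app (el_wtm _ eg) _; el_at.
Qed.

Lemma comp_beta W a b c f g x : wf W a -> el W f (TLolli b c) -> el W g (TLolli a b) ->
  el W x a -> eqv W c (App (comp a f g) x) (App f (App g x)).
Proof.
move=> wa ef eg ex; apply: eqv_beta => //.
- by apply: el_app (el_wtm _ ef) _; apply: el_app (el_wtm _ eg) _; el_at.
- by rewrite /= !occ_wk.
sig.
Qed.

Lemma comp_ren r a f g : tmr r (comp a f g) = comp (tyr r a) (tmr r f) (tmr r g).
Proof. rewrite /comp; sig. Qed.

Lemma letT_beta W a b c f x y : el W f (TLolli a (TLolli b c)) -> el W x a -> el W y b ->
  eqv W c (letT f (Tens x y)) (App (App f x) y).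
Proof.
move=> ef ex ey; apply: (eqv_betaT ex ey).
- by apply: (@el_app _ b); [apply: el_app (el_wk2 _ _ ef) _|]; el_at.
- by rewrite /= !occ_wk.
- by rewrite /= !occ_wk.
sig.
Qed.

Lemma letT_cong W a b c f z z' : el W f (TLolli a (TLolli b c)) ->
  eqv W (TTens a b) z z' -> eqv W c (letT f z) (letT f z').
Proof.
move=> ef ez; apply: eqv_letT ez _ _ _.
- by apply: (@el_app _ b); [apply: el_app (el_wk2 _ _ ef) _|]; el_at.
- by rewrite /= !occ_wk.
by rewrite /= !occ_wk.
Qed.

(** Pulls a two-argument eliminator back along maps of the two components; this is how a test
    against the target of the action becomes a test against its source. *)
Definition precomp2 (a b : ty) (f g h : tm) : tm :=
  Lam a (Lam b (App (App (wkt 0 2 f) (App (wkt 0 2 g) (Var 1))) (App (wkt 0 2 h) (Var 0)))).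

Section Precomp.

Variables (W : world) (a b a' b' c : ty) (f g h : tm).
Hypotheses (wa : wf W a) (wb : wf W b) (ef : el W f (TLolli a' (TLolli b' c)))
  (eg : el W g (TLolli a a')) (eh : el W h (TLolli b b')).

Lemma el_precomp2 : el W (precomp2 a b f g h) (TLolli a (TLolli b c)).
Proof.
apply: el_lam => //; last by rewrite /= !occ_wk.
apply: el_lam => //; last by rewrite /= !occ_wk.
apply: (@el_app _ b'); last by apply: el_app (el_wk2 _ _ eh) _; el_at.
by apply: el_app (el_wk2 _ _ ef) _; apply: el_app (el_wk2 _ _ eg) _; el_at.
Qed.

Lemma precomp2_beta x y : el W x a -> el W y b ->
  eqv W c (App (App (precomp2 a b f g h) x) y) (App (App f (App g x)) (App h y)).
Proof.
move=> ex ey.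
apply: (@eqv_trans _ _ _ (App (Lam b (App (App (wkt 0 1 f) (App (wkt 0 1 g) (wkt 0 1 x)))
   (App (wkt 0 1 h) (Var 0)))) y)).
  apply: eqv_app (eqv_refl ey); apply: (@eqv_beta _ a) => //; last by sig.
  - apply: el_lam => //; last by rewrite /= !occ_wk.
    apply: (@el_app _ b'); last by apply: el_app (el_wk2 _ _ eh) _; el_at.
    by apply: el_app (el_wk2 _ _ ef) _; apply: el_app (el_wk2 _ _ eg) _; el_at.
  - by rewrite /= !occ_wk.
apply: eqv_beta => //; last by sig.
- apply: (@el_app _ b'); last by apply: el_app (el_wtm _ eh) _; el_at.
  by apply: el_app (el_wtm _ ef) _; apply: el_app (el_wtm _ eg) _; exact: el_wtm.
by rewrite /= !occ_wk.
Qed.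

End Precomp.

Lemma precomp2_ren r a b f g h : tmr r (precomp2 a b f g h)
  = precomp2 (tyr r a) (tyr r b) (tmr r f) (tmr r g) (tmr r h).
Proof. rewrite /precomp2; sig. Qed.

Lemma occ_letT f : occ 0 (letT (wkt 0 1 f) (Var 0)) = 1.
Proof.
have E : wkt 0 2 (wkt 0 1 f) = wkt 0 3 f by sig.
by rewrite /letT /= E occ_wk.
Qed.

Definition letTfun (a b : ty) (f : tm) : tm := Lam (TTens a b) (letT (wkt 0 1 f) (Var 0)).

Lemma el_letTfun W a b c f : wf W a -> wf W b -> el W f (TLolli a (TLolli b c)) ->
  el W (letTfun a b f) (TLolli (TTens a b) c).
Proof.
move=> wa wb ef; apply: el_lam; first by rewrite /wf /= wa.
  by apply: el_letTapp (el_wtm _ ef) _; el_at.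
exact: occ_letT.
Qed.

Lemma letTfun_beta W a b c f z : wf W a -> wf W b -> el W f (TLolli a (TLolli b c)) ->
  el W z (TTens a b) -> eqv W c (App (letTfun a b f) z) (letT f z).
Proof.
move=> wa wb ef ez; apply: (@eqv_beta _ (TTens a b)) => //.
- by apply: el_letTapp (el_wtm _ ef) _; el_at.
- exact: occ_letT.
- by rewrite /wf /= wa.
rewrite /letT; sig.
Qed.

Lemma letTfun_ren r a b f : tmr r (letTfun a b f) = letTfun (tyr r a) (tyr r b) (tmr r f).
Proof. rewrite /letTfun /letT; sig. Qed.

(** Both sides are values at [z] of functions defined on the whole tensor, so by [tens_ext] they
    need to be computed only on a pair, where [M] acts componentwise. *)
Lemma letT_map W a b a' b' c f M g h z :
  wf W a -> wf W b -> wf W a' -> wf W b' ->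
  el W f (TLolli a' (TLolli b' c)) ->
  el W M (TLolli (TTens a b) (TTens a' b')) ->
  el W g (TLolli a a') -> el W h (TLolli b b') ->
  (forall W' r x y, morph W W' r -> el W' x (tyr r a) -> el W' y (tyr r b) ->
     eqv W' (TTens (tyr r a') (tyr r b')) (App (tmr r M) (Tens x y))
       (Tens (App (tmr r g) x) (App (tmr r h) y))) ->
  el W z (TTens a b) ->
  eqv W c (letT (precomp2 a b f g h) z) (letT f (App M z)).
Proof.
move=> wa wb wa' wb' ef eM eg eh K ez.
have ep := el_precomp2 wa wb ef eg eh.
have wab : wf W (TTens a b) by rewrite /wf /= wa.
have ef' := el_letTfun wa' wb' ef.
have ep' := el_letTfun wa wb ep.
have ec := el_comp wab ef' eM.
have e1 : eqv W c (App (letTfun a b (precomp2 a b f g h)) z)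
    (App (comp (TTens a b) (letTfun a' b' f) M) z).
  apply: (tens_ext wa wb ep' ec) ez => W' r x y m ex ey.
  rewrite letTfun_ren precomp2_ren comp_ren letTfun_ren.
  have wa1 := wf_ren m wa; have wb1 := wf_ren m wb.
  have wa1' := wf_ren m wa'; have wb1' := wf_ren m wb'.
  have ef1 := el_ren m ef; have eM1 := el_ren m eM.
  have eg1 := el_ren m eg; have eh1 := el_ren m eh.
  have ep1 := el_precomp2 wa1 wb1 ef1 eg1 eh1.
  have exy := el_tens ex ey.
  have H1 := letTfun_beta wa1 wb1 ep1 exy.
  have H2 := letT_beta ep1 ex ey.
  have H3 := precomp2_beta wa1 wb1 ef1 eg1 eh1 ex ey.
  have H4 := letT_beta ef1 (el_app eg1 ex) (el_app eh1 ey).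
  have H5 := letT_cong ef1 (K _ _ _ _ m ex ey).
  have H6 := letTfun_beta wa1' wb1' ef1 (el_app eM1 exy).
  have H7 := comp_beta (wf_ren m wab) (el_letTfun wa1' wb1' ef1) eM1 exy.
  apply: (eqv_trans H1); apply: (eqv_trans H2); apply: (eqv_trans H3).
  apply: (eqv_trans (eqv_sym H4)); apply: (eqv_trans (eqv_sym H5)).
  exact: eqv_trans (eqv_sym H6) (eqv_sym H7).
apply: eqv_trans (eqv_sym (letTfun_beta wa wb ep ez)) _; apply: (eqv_trans e1).
apply: eqv_trans (comp_beta wab ef' eM ez) _.
exact: letTfun_beta wa' wb' ef (el_app eM ez).
Qed.

Section TensHyp.

Variables (W : world) (a b a' b' c c' : ty) (h h' S : lrel).
Hypotheses (rh : rel W h a b) (rh' : rel W h' a' b') (rS : rel W S c c').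

Lemma tens_hypI f g : el W f (TLolli a (TLolli a' c)) -> el W g (TLolli b (TLolli b' c')) ->
  (forall W' r x x' y y', morph W W' r -> rl W' (rlr r h) (tyr r a) (tyr r b) x x' ->
     rl W' (rlr r h') (tyr r a') (tyr r b') y y' ->
     rl W' (rlr r S) (tyr r c) (tyr r c')
       (App (App (tmr r f) x) y) (App (App (tmr r g) x') y')) ->
  rl W (tens_hyp a b a' b' c c' h h' S) (TLolli a (TLolli a' c)) (TLolli b (TLolli b' c'))
    f g.
Proof.
move=> ef eg K; apply: rlolliI => //; first exact: rel_rlolli.
move=> W1 r1 x x' m1 hx; rewrite rlolli_ren; have [_ ex ex' _] := hx.
apply: rlolliI.
- exact: rel_ren m1 rh'.
- exact: rel_ren m1 rS.
- exact: el_app (el_ren m1 ef) ex.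
- exact: el_app (el_ren m1 eg) ex'.
move=> W2 r2 y y' m2; rewrite !rl_ren_ren !ty_ren_ren !tm_ren_app !tm_ren_ren => hy.
apply: (K _ _ _ _ _ _ (morph_comp m1 m2)) hy.
by have := rl_morph m2 hx; rewrite !rl_ren_ren !ty_ren_ren.
Qed.

Lemma tens_hypE f g x x' y y' :
  rl W (tens_hyp a b a' b' c c' h h' S) (TLolli a (TLolli a' c)) (TLolli b (TLolli b' c'))
    f g ->
  rl W h a b x x' -> rl W h' a' b' y y' ->
  rl W S c c' (App (App f x) y) (App (App g x') y').
Proof.
move=> H hx hy; have H1 := rlolliE (rel_rlolli rh' rS) H hx.
exact: rlolliE rS H1 hy.
Qed.

End TensHyp.

Lemma tens_hyp_ren r a b a' b' c c' h h' S : rlr r (tens_hyp a b a' b' c c' h h' S)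
  = tens_hyp (tyr r a) (tyr r b) (tyr r a') (tyr r b') (tyr r c) (tyr r c')
      (rlr r h) (rlr r h') (rlr r S).
Proof. by rewrite /tens_hyp !rlolli_ren. Qed.

(** The binary version of [menv]: [F i] and [F' i] carry [R i] to [S i] where positive use is
    allowed, and [S i] to [R i] where negative use is allowed. The relations are arbitrary. *)
Definition penv W n (okp okn : nat -> bool) (A A' B B' : nat -> ty) (R S : nat -> lrel)
    (F F' : nat -> tm) : Prop :=
  forall i, i < n ->
    [/\ rel W (R i) (A i) (A' i), rel W (S i) (B i) (B' i),
      okp i -> rl W (rlolli (A i) (A' i) (B i) (B' i) (R i) (S i))
        (TLolli (A i) (B i)) (TLolli (A' i) (B' i)) (F i) (F' i)
      & okn i -> rl W (rlolli (B i) (B' i) (A i) (A' i) (S i) (R i))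
        (TLolli (B i) (A i)) (TLolli (B' i) (A' i)) (F i) (F' i)].

Lemma penv_swap W n okp okn A A' B B' R S F F' :
  penv W n okp okn A A' B B' R S F F' -> penv W n okn okp B B' A A' S R F F'.
Proof. by move=> e i /e[]. Qed.

Lemma penv_menv W n okp okn A A' B B' R S F F' :
  penv W n okp okn A A' B B' R S F F' ->
  menv W n okp okn A B F /\ menv W n okp okn A' B' F'.
Proof.
move=> e; split=> i /e[[_ wA wA'] [_ wB wB'] ep en]; split=> //.
- by case/ep.
- by case/en.
- by case/ep.
by case/en.
Qed.

Lemma penv_ren W W' r n okp okn A A' B B' R S F F' : morph W W' r ->
  penv W n okp okn A A' B B' R S F F' ->
  penv W' n okp okn (tyr r \o A) (tyr r \o A') (tyr r \o B) (tyr r \o B')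
    (rlr r \o R) (rlr r \o S) (tmr r \o F) (tmr r \o F').
Proof.
move=> m e i /e[rR rS ep en]; split; [exact: rel_ren m rR|exact: rel_ren m rS| |].
  by move/ep => H; have := rl_morph m H; rewrite rlolli_ren.
by move/en => H; have := rl_morph m H; rewrite rlolli_ren.
Qed.

Lemma rl_idtm W h a b x y : rl W h a b x y -> rl W h a b (App (idtm a) x) (App (idtm b) y).
Proof.
move=> H; have [[_ wa wb] ex ey _] := H.
by apply: rl_eqv H (eqv_sym (idtm_beta ex wa)) (eqv_sym (idtm_beta ey wb)).
Qed.

Lemma rlolli_idtm W h a b : rel W h a b ->
  rl W (rlolli a b a b h h) (TLolli a a) (TLolli b b) (idtm a) (idtm b).
Proof.
move=> rh; have [_ wa wb] := rh; apply: rlolliI => //; try exact: el_idtm.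
by move=> W' r x y m; apply: rl_idtm.
Qed.

(** A variable bound by Pi is interpreted by the same relation in source and target, and the
    identities preserve it in either direction. *)
Lemma penv_cons W n okp okn A A' B B' R S F F' c c' T : adm W T c c' ->
  penv W n okp okn A A' B B' R S F F' ->
  penv W n.+1 (scons true okp) (scons true okn) (scons c A) (scons c' A')
    (scons c B) (scons c' B') (scons T R) (scons T S)
    (scons (idtm c) F) (scons (idtm c') F').
Proof.
move=> /adm_rel rT e [|i] /=; last exact: e.
by split=> // _; apply: rlolli_idtm.
Qed.

Lemma ic_rel_ren n r s A B R : wf_icty n s ->
  rlr r (ic_rel A B R s) = ic_rel (tyr r \o A) (tyr r \o B) (rlr r \o R) s.
Proof.
move=> ws; rewrite rl_renE (ic_rel_sub _ _ _ _ _ _ ws).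
by apply: ic_rel_ext ws _ => i _; split; sig.
Qed.

(** Polarities, worlds and environments are all quantified here, since the induction exchanges
    source and target at [-o] and extends the environment at Pi. *)
Definition elem_ok (s : icty) : Prop :=
  forall n W okp okn A A' B B' R S F F', wf_icty n s -> mpol n okp okn s ->
    penv W n okp okn A A' B B' R S F F' -> forall z z',
    rl W (ic_rel A A' R s) (ty_sub A (ic_ty s)) (ty_sub A' (ic_ty s)) z z' ->
    rl W (ic_rel B B' S s) (ty_sub B (ic_ty s)) (ty_sub B' (ic_ty s))
      (App (ic_map A B F s) z) (App (ic_map A' B' F' s) z').

Lemma rel_penv W n okp okn A A' B B' R S F F' s :
  penv W n okp okn A A' B B' R S F F' -> wf_icty n s ->
  rel W (ic_rel A A' R s) (ty_sub A (ic_ty s)) (ty_sub A' (ic_ty s))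
  /\ rel W (ic_rel B B' S s) (ty_sub B (ic_ty s)) (ty_sub B' (ic_ty s)).
Proof. by move=> e ws; split; apply: rel_ic_rel ws _ => i /e[]. Qed.

Lemma elem_ok_lolli s : elem_ok s ->
  forall n W okp okn A A' B B' R S F F', wf_icty n s -> mpol n okp okn s ->
    penv W n okp okn A A' B B' R S F F' ->
    rl W (rlolli (ty_sub A (ic_ty s)) (ty_sub A' (ic_ty s)) (ty_sub B (ic_ty s))
        (ty_sub B' (ic_ty s)) (ic_rel A A' R s) (ic_rel B B' S s))
      (TLolli (ty_sub A (ic_ty s)) (ty_sub B (ic_ty s)))
      (TLolli (ty_sub A' (ic_ty s)) (ty_sub B' (ic_ty s)))
      (ic_map A B F s) (ic_map A' B' F' s).
Proof.
move=> ok n W okp okn A A' B B' R S F F' ws ps e.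
have [e1 e2] := penv_menv e; have [r1 r2] := rel_penv e ws.
apply: rlolliI => //; try exact: el_ic_map ws ps _.
move=> W' r x y m; rewrite !(ic_rel_ren _ _ _ _ ws) !(ic_map_ren _ _ _ _ ws) !ty_ren_sub.
exact: ok ws ps (penv_ren m e) _ _.
Qed.

(** A test [(T, f, g)] against the target becomes a test against the source once [f] and [g] are
    precomposed with the actions on the components; the hypothesis on [z] and [z'] is then applied
    with the same admissible [T]. *)
Lemma elem_ok_tens s1 s2 : elem_ok s1 -> elem_ok s2 -> elem_ok (ITens s1 s2).
Proof.
move=> ok1 ok2 n W okp okn A A' B B' R S F F' ws ps e z z' hz.
have [e1 e2] := penv_menv e.
have /andP[w1 w2] := ws; have [p1 p2] := mpol_split ps.
have [rA1 rB1] := rel_penv e w1; have [rA2 rB2] := rel_penv e w2.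
have eM := el_ic_map ws ps e1; have eM' := el_ic_map ws ps e2.
have [_ ez ez' _] := hz.
apply: rtensI => //; [exact: el_app eM ez|exact: el_app eM' ez'|].
move=> W' r c c' T f g m aT hfg.
have {}hz := rl_morph m hz; have {}e := penv_ren m e.
rewrite !tm_ren_app !(ic_map_ren _ _ _ _ ws).
move: hz hfg; rewrite rtens_ren !(ic_rel_ren _ _ _ _ w1) !(ic_rel_ren _ _ _ _ w2) !ty_ren_sub.
(* The renamed data are generalized, so that the rest of the argument runs in the later world
   without any renaming in sight. *)
move: (tmr r z) (tmr r z') (tyr r \o A) (tyr r \o A') (tyr r \o B) (tyr r \o B')
  (rlr r \o R) (rlr r \o S) (tmr r \o F) (tmr r \o F') e.
move=> {z z' A A' B B' R S F F' e1 e2 rA1 rB1 rA2 rB2 eM eM' ez ez' m W r}.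
move=> z z' A A' B B' R S F F' e hz hfg; move: W' e aT hz hfg => W e aT hz hfg.
have [e1 e2] := penv_menv e.
have [rA1 rB1] := rel_penv e w1; have [rA2 rB2] := rel_penv e w2.
have [_ wA1 wA1'] := rA1; have [_ wA2 wA2'] := rA2.
have [_ wB1 wB1'] := rB1; have [_ wB2 wB2'] := rB2.
have [_ ef eg _] := hfg; have [_ wc wc'] := aT.
have eM := el_ic_map ws ps e1; have eM' := el_ic_map ws ps e2.
have m1 := el_ic_map w1 p1 e1; have m1' := el_ic_map w1 p1 e2.
have m2 := el_ic_map w2 p2 e1; have m2' := el_ic_map w2 p2 e2.
have rT := adm_rel aT.
have K : rl W (tens_hyp (ty_sub A (ic_ty s1)) (ty_sub A' (ic_ty s1))
    (ty_sub A (ic_ty s2)) (ty_sub A' (ic_ty s2)) c c'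
    (ic_rel A A' R s1) (ic_rel A A' R s2) T)
   (TLolli (ty_sub A (ic_ty s1)) (TLolli (ty_sub A (ic_ty s2)) c))
   (TLolli (ty_sub A' (ic_ty s1)) (TLolli (ty_sub A' (ic_ty s2)) c'))
   (precomp2 (ty_sub A (ic_ty s1)) (ty_sub A (ic_ty s2)) f
      (ic_map A B F s1) (ic_map A B F s2))
   (precomp2 (ty_sub A' (ic_ty s1)) (ty_sub A' (ic_ty s2)) g
      (ic_map A' B' F' s1) (ic_map A' B' F' s2)).
  apply: tens_hypI => //; [exact: el_precomp2 wA1 wA2 ef m1 m2|exact: el_precomp2 wA1' wA2' eg m1' m2'|].
  move=> W' r x x' y y' m hx hy; rewrite !precomp2_ren.
  have [_ ex ex' _] := hx; have [_ ey ey' _] := hy.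
  have H := precomp2_beta (wf_ren m wA1) (wf_ren m wA2) (el_ren m ef) (el_ren m m1)
    (el_ren m m2) ex ey.
  have H' := precomp2_beta (wf_ren m wA1') (wf_ren m wA2') (el_ren m eg) (el_ren m m1')
    (el_ren m m2') ex' ey'.
  refine (rl_eqv _ (eqv_sym H) (eqv_sym H')).
  have hM1 := rl_morph m (elem_ok_lolli ok1 w1 p1 e).
  have hM2 := rl_morph m (elem_ok_lolli ok2 w2 p2 e).
  rewrite rlolli_ren in hM1; rewrite rlolli_ren in hM2.
  have h1 := rlolliE (rel_ren m rB1) hM1 hx; have h2 := rlolliE (rel_ren m rB2) hM2 hy.
  have hfg' := rl_morph m hfg; rewrite tens_hyp_ren in hfg'.
  refine (tens_hypE (rel_ren m rB2) (rel_ren m rT) hfg' h1 h2).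
have [_ ez ez' _] := hz.
apply: rl_eqv (rtensE hz aT K) _ _.
  apply: (letT_map wA1 wA2 wB1 wB2 ef eM m1 m2) => // W' r x y m ex ey.
  move: ex ey; rewrite !(ic_map_ren _ _ _ _ ws) !(ic_map_ren _ _ _ _ w1)
    !(ic_map_ren _ _ _ _ w2) !ty_ren_sub => ex ey.
  exact (ic_map_tens (menv_ren m e1) ws ps ex ey).
apply: (letT_map wA1' wA2' wB1' wB2' eg eM' m1' m2') => // W' r x y m ex ey.
move: ex ey; rewrite !(ic_map_ren _ _ _ _ ws) !(ic_map_ren _ _ _ _ w1)
  !(ic_map_ren _ _ _ _ w2) !ty_ren_sub => ex ey.
exact (ic_map_tens (menv_ren m e2) ws ps ex ey).
Qed.

(** As for the tensor, a test against the target is composed with the action; on a promoted element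
    the composite applies the test to [!] of the mapped element, where the induction hypothesis is
    available. *)
Lemma elem_ok_bang s1 : elem_ok s1 -> elem_ok (IBang s1).
Proof.
move=> ok1 n W okp okn A A' B B' R S F F' ws ps e z z' hz.
have [e1 e2] := penv_menv e; have w1 : wf_icty n s1 := ws.
have p1 : mpol n okp okn s1 := ps.
have [rA1 rB1] := rel_penv e w1.
have eM := el_ic_map ws ps e1; have eM' := el_ic_map ws ps e2.
have [_ ez ez' _] := hz.
apply: rbangI => //; [exact: el_app eM ez|exact: el_app eM' ez'|].
move=> W' r c c' T f g m aT hfg.
have {}hz := rl_morph m hz; have {}e := penv_ren m e.
rewrite !tm_ren_app !(ic_map_ren _ _ _ _ ws).
move: hz hfg; rewrite rbang_ren !(ic_rel_ren _ _ _ _ w1) !ty_ren_sub.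
move: (tmr r z) (tmr r z') (tyr r \o A) (tyr r \o A') (tyr r \o B) (tyr r \o B')
  (rlr r \o R) (rlr r \o S) (tmr r \o F) (tmr r \o F') e.
move=> {z z' A A' B B' R S F F' e1 e2 rA1 rB1 eM eM' ez ez' m W r}.
move=> z z' A A' B B' R S F F' e hz hfg; move: W' e aT hz hfg => W e aT hz hfg.
have [e1 e2] := penv_menv e; have [rA1 rB1] := rel_penv e w1.
have [_ wA1 wA1'] := rA1; have [_ wB1 wB1'] := rB1.
have [_ ef eg _] := hfg; have [_ wc wc'] := aT; have rT := adm_rel aT.
have eM := el_ic_map ws ps e1; have eM' := el_ic_map ws ps e2.
have [_ ez ez' _] := hz.
have wS : wf W (TBang (ty_sub A (ic_ty s1))) := wA1.
have wS' : wf W (TBang (ty_sub A' (ic_ty s1))) := wA1'.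
(* The test applied to the mapped element is rewritten as one function applied to [z], which is the
   form that [rbangE] accepts. *)
apply: (@rl_eqv _ _ _ _ (App (comp (TBang (ty_sub A (ic_ty s1))) f (ic_map A B F (IBang s1))) z)
  _ (App (comp (TBang (ty_sub A' (ic_ty s1))) g (ic_map A' B' F' (IBang s1))) z'));
  [|exact: comp_beta wS ef eM ez|exact: comp_beta wS' eg eM' ez'].
apply: (rbangE hz aT); apply: rarrI => //; [exact: el_comp wS ef eM|exact: el_comp wS' eg eM'|].
move=> W' r x x' m hx; rewrite !comp_ren; have [_ ex ex' _] := hx.
have bx := el_bang ex; have bx' := el_bang ex'.
have H := comp_beta (wf_ren m wS) (el_ren m ef) (el_ren m eM) bx.
have H' := comp_beta (wf_ren m wS') (el_ren m eg) (el_ren m eM') bx'.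
refine (rl_eqv _ (eqv_sym H) (eqv_sym H')).
have TE d0 d1 : tyr r (TArr d0 d1) = TArr (tyr r d0) (tyr r d1) by [].
have hfg' := rl_morph m hfg; rewrite rarr_ren !TE in hfg'.
have ok := ok1 _ _ _ _ _ _ _ _ _ _ _ _ w1 p1 (penv_ren m e).
move: hx ex ex' hfg'.
rewrite !(ic_rel_ren _ _ _ _ w1) !(ic_map_ren _ _ _ _ ws) !ty_ren_sub => hx ex ex' hfg'.
have hM := ok _ _ hx.
have rT' := rel_ren m rT.
refine (rl_eqv (rarrE rT' hfg' hM) _ _).
  have ef1 := el_ren m ef; rewrite TE ty_ren_sub in ef1.
  apply: eqv_app (eqv_refl ef1) _; apply: eqv_sym.
  exact (ic_map_bang (menv_ren m e1) w1 p1 ex).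
have eg1 := el_ren m eg; rewrite TE ty_ren_sub in eg1.
apply: eqv_app (eqv_refl eg1) _; apply: eqv_sym.
exact (ic_map_bang (menv_ren m e2) w1 p1 ex').
Qed.

Lemma elem_ok_arrow s1 s2 : elem_ok s1 -> elem_ok s2 -> elem_ok (ILolli s1 s2).
Proof.
move=> ok1 ok2 n W okp okn A A' B B' R S F F' ws ps e z z' hz.
have [e1 e2] := penv_menv e.
have /andP[w1 w2] := ws; have [p1 p2] := mpol_lolli ps.
have [rA1 rB1] := rel_penv e w1; have [rA2 rB2] := rel_penv e w2.
have eM := el_ic_map ws ps e1; have eM' := el_ic_map ws ps e2.
have [_ ez ez' _] := hz.
apply: rlolliI => //; [exact: el_app eM ez|exact: el_app eM' ez'|].
move=> W' r x x' m hx; rewrite !tm_ren_app.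
have hz' := rl_morph m hz; move: hz' hx; rewrite [ic_rel _ _ _ _]/= rlolli_ren.
rewrite !(ic_rel_ren _ _ _ _ w1) !(ic_rel_ren _ _ _ _ w2) !(ic_map_ren _ _ _ _ ws).
rewrite !ty_ren_sub => hz' hx.
have e' := penv_ren m e; have [e1' e2'] := penv_menv e'.
have [_ ex ex' _] := hx; have [_ ez1 ez1' _] := hz'.
have H := ic_map_lolli e1' ws ps ez1 ex; have H' := ic_map_lolli e2' ws ps ez1' ex'.
refine (rl_eqv _ (eqv_sym H) (eqv_sym H')).
apply: (ok2 _ _ _ _ _ _ _ _ _ _ _ _ w2 p2 e').
apply: rlolliE (rel_penv e' w2).1 _ (ok1 _ _ _ _ _ _ _ _ _ _ _ _ w1 p1 (penv_swap e') _ _ hx).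
exact: hz'.
Qed.

Lemma elem_ok_pi s1 : elem_ok s1 -> elem_ok (IPi s1).
Proof.
move=> ok1 n W okp okn A A' B B' R S F F' ws ps e z z' hz.
have w1 : wf_icty n.+1 s1 := ws; have p1 := mpol_pi ps.
have [e1 e2] := penv_menv e.
have [rA rB] := rel_penv e ws.
have eM := el_ic_map ws ps e1; have eM' := el_ic_map ws ps e2.
have [_ ez ez' _] := hz.
apply: rpiI rB (el_app eM ez) (el_app eM' ez') _ => W' r c c' T m aT.
rewrite (piinst_ic_rel _ _ _ _ _ _ _ w1) !pity_upT !tm_ren_app !(ic_map_ren _ _ _ _ ws).
have e' := penv_ren m e; have [e1' e2'] := penv_menv e'.
have [_ wc wc'] := aT.
have {}ez := el_ren m ez; have {}ez' := el_ren m ez'; rewrite !ty_ren_sub in ez ez'.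
have H := ic_map_pi e1' ws ps ez wc; have H' := ic_map_pi e2' ws ps ez' wc'.
refine (rl_eqv _ (eqv_sym H) (eqv_sym H')).
have ec := penv_cons aT e'.
apply: (ok1 _ _ _ _ _ _ _ _ _ _ _ _ w1 p1 ec).
have hz' := rl_morph m hz; rewrite [ic_rel _ _ _ _]/= rpi_ren [ic_ty _]/= [ty_sub _ _]/= [tyr r _]/= in hz'.
have Ep d A0 : pity TVar d (ty_ren (upr (rty r)) (ty_sub (upT A0) (ic_ty s1)))
   = ty_sub (scons d (tyr r \o A0)) (ic_ty s1) by rewrite /pity; sig.
have := rpiE hz' aT; rewrite !Ep piinst_ren (piinst_ic_rel _ _ _ _ _ _ _ w1) => K.
exact: K (rel_penv ec w1).1.
Qed.

Lemma elem_okP s : elem_ok s.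
Proof.
elim: s => [i|c||s1 IH1 s2 IH2|s1 IH1 s2 IH2|s1 IH1|s1 IH1].
- move=> n W okp okn A A' B B' R S F F' ws ps e z z' hz.
  have [rR rS ep _] := e _ ws; apply: rlolliE rS (ep _) hz.
  by have := ps _ ws; rewrite /= eqxx /= orbF; case/andP.
- move=> n W okp okn A A' B B' R S F F' ws _ _ z z' /=.
  by rewrite !wf_ty0_sub //; apply: rl_idtm.
- by move=> n W okp okn A A' B B' R S F F' _ _ _ z z'; apply: rl_idtm.
- exact: elem_ok_tens.
- exact: elem_ok_arrow.
- exact: elem_ok_bang.
exact: elem_ok_pi.
Qed.

(** * Graphs, reindexing and admissible closure *)

Lemma rl_tens W a b a' b' h h' x y x' y' : rl W h a b x x' -> rl W h' a' b' y y' ->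
  rl W (rtens a b a' b' h h') (TTens a a') (TTens b b') (Tens x y) (Tens x' y').
Proof.
move=> hx hy; have [rh ex ex' _] := hx; have [rh' ey ey' _] := hy.
apply: rtensI => //; [exact: el_tens|exact: el_tens|].
move=> W' r c c' S f g m aS hfg.
have hx1 := rl_morph m hx; have hy1 := rl_morph m hy.
have [_ ef eg _] := hfg.
have [_ ex1 ex1' _] := hx1; have [_ ey1 ey1' _] := hy1.
have H := tens_hypE (rel_ren m rh') (adm_rel aS) hfg hx1 hy1.
exact: rl_eqv H (eqv_sym (letT_beta ef ex1 ey1)) (eqv_sym (letT_beta eg ex1' ey1')).
Qed.

Lemma rl_bang W a b h x x' : rl W h a b x x' ->
  rl W (rbang a b h) (TBang a) (TBang b) (Bang x) (Bang x').
Proof.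
move=> hx; have [rh ex ex' _] := hx.
apply: rbangI => //; [exact: el_bang|exact: el_bang|].
move=> W' r c c' S f g m aS hfg.
exact: rarrE (adm_rel aS) hfg (rl_morph m hx).
Qed.

(** The nested weakenings reproduce the literal form demanded by [adm_graph], the linear term being
    [h] applied to variable 0. [reindexR] below matches [adm_reindex] in the same way. *)
Definition graphR (c c' : ty) (h : tm) : lrel :=
  RAbs c c' (PEq c' (wkt 0 1 (App (wkt 0 1 h) (Var 0))) (Var 0)).

Lemma graphR_ren r c c' h : rlr r (graphR c c' h) = graphR (tyr r c) (tyr r c') (tmr r h).
Proof. rewrite /graphR; sig. Qed.

Lemma adm_graphR W c c' h : wf W c -> wf W c' -> el W h (TLolli c c') ->
  adm W (graphR c c' h) c c'.
Proof.
move=> wc wc' eh; split=> //; apply: adm_graph => //; apply/typed_lin; split.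
  by apply: (@el_app (wtm c W)); [exact: el_wtm eh|el_at].
by rewrite /= occ_wk.
Qed.

Lemma rl_graphR W c c' h x y : wf W c -> wf W c' -> el W h (TLolli c c') -> el W x c ->
  rl W (graphR c c' h) c c' x y <-> eqv W c' (App h x) y.
Proof.
move=> wc wc' eh ex; have rG := adm_rel (adm_graphR wc wc' eh).
have E t : pinst2 (PEq c' (wkt 0 1 (App (wkt 0 1 h) (Var 0))) (Var 0)) x t
  = PEq c' (App h x) t by sig.
split=> -[].
  by move=> _ _ ey /(relbeta rG ex ey); rewrite E; split=> //; apply: el_app eh ex.
by move=> _ ey H; split=> //; apply/(relbeta rG ex ey); rewrite E.
Qed.

Definition reindexR (a b : ty) (h : lrel) (f g : tm) : lrel :=
  RAbs a b (PRel (wkr 0 2 0 h) (wkt 0 1 (App (wkt 0 1 f) (Var 0)))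
                 (tm_ren id (upr succn) (App (wkt 0 1 g) (Var 0)))).

Lemma reindexR_ren r a b h f g : rlr r (reindexR a b h f g)
  = reindexR (tyr r a) (tyr r b) (rlr r h) (tmr r f) (tmr r g).
Proof. rewrite /reindexR; sig. Qed.

Lemma adm_reindexR W a b a' b' h f g : wf W a -> wf W b -> adm W h a' b' ->
  el W f (TLolli a a') -> el W g (TLolli b b') -> adm W (reindexR a b h f g) a b.
Proof.
move=> wa wb [ah _ _] ef eg; split=> //.
apply: adm_reindex ah _ _ => //; apply/typed_lin; split; try by rewrite /= occ_wk.
  by apply: (@el_app (wtm a W)); [exact: el_wtm ef|el_at].
by apply: (@el_app (wtm b W)); [exact: el_wtm eg|el_at].
Qed.

Lemma rl_reindexR W a b a' b' h f g x y : wf W a -> wf W b -> adm W h a' b' ->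
  el W f (TLolli a a') -> el W g (TLolli b b') -> el W x a -> el W y b ->
  rl W (reindexR a b h f g) a b x y <-> rl W h a' b' (App f x) (App g y).
Proof.
move=> wa wb ah ef eg ex ey.
have rG := adm_rel (adm_reindexR wa wb ah ef eg).
have E : pinst2 (PRel (wkr 0 2 0 h) (wkt 0 1 (App (wkt 0 1 f) (Var 0)))
    (tm_ren id (upr succn) (App (wkt 0 1 g) (Var 0)))) x y
  = PRel h (App f x) (App g y) by sig.
split=> -[].
  move=> _ _ _ /(relbeta rG ex ey); rewrite E => H.
  by split=> //; [exact: adm_rel|exact: el_app ef ex|exact: el_app eg ey].
by move=> _ _ _ H; split=> //; apply/(relbeta rG ex ey); rewrite E.
Qed.

(** The relation [k], guarded by the inclusion of [h] in [k]. The inclusion is expressed by [h -o k]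
    relating the identities, a form on which the functorial action can operate; an implication from
    an arbitrary proposition preserves admissibility. *)
Definition closR_imp (a b : ty) (h k : lrel) : lrel :=
  RAbs a b (PImp (wkp 0 2 0 (PRel (rlolli a b a b h k) (idtm a) (idtm b)))
                 (PRel (wkr 0 2 0 k) (Var 1) (Var 0))).

(* The smallest admissible relation containing [h]. *)
Definition closR (a b : ty) (h : lrel) : lrel :=
  RAbs a b (PAllRel true a b
    (PRel (wkr 0 2 0 (closR_imp a b (wkr 0 0 1 h) (RVar 0))) (Var 1) (Var 0))).

Lemma closR_ren r a b h : rlr r (closR a b h) = closR (tyr r a) (tyr r b) (rlr r h).
Proof. rewrite /closR /closR_imp; sig. Qed.

Lemma adm_closR_imp W a b h k : rel W h a b -> adm W k a b -> adm W (closR_imp a b h k) a b.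
Proof.
move=> rh ak; have [_ wa wb] := rh; split=> //; apply: adm_imp; last by case: ak.
apply: (@prp_rel W); first exact: rel_rlolli (adm_rel ak).
  exact: el_idtm.
exact: el_idtm.
Qed.

Lemma adm_closR W a b h : rel W h a b -> adm W (closR a b h) a b.
Proof.
move=> rh; have [_ wa wb] := rh; split=> //; apply: adm_allRel => //.
have rh1 : rel (wrl true a b W) (wkr 0 0 1 h) a b.
  by have := rel_ren (morph_wrl true a b W) rh; rewrite /= !ty_ren0.
have ak : adm (wrl true a b W) (RVar 0) a b by split=> //; apply: adm_var.
by case: (adm_closR_imp rh1 ak).
Qed.

Lemma closR_imp_body a b h k x y :
  pinst2 (PImp (wkp 0 2 0 (PRel (rlolli a b a b h k) (idtm a) (idtm b)))
               (PRel (wkr 0 2 0 k) (Var 1) (Var 0))) x y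
  = PImp (PRel (rlolli a b a b h k) (idtm a) (idtm b)) (PRel k x y).
Proof. sig. Qed.

Lemma closRE W a b h k x y : rel W h a b -> adm W k a b ->
  rl W (closR a b h) a b x y ->
  rl W (rlolli a b a b h k) (TLolli a a) (TLolli b b) (idtm a) (idtm b) ->
  rl W k a b x y.
Proof.
move=> rh ak [rC ex ey hC] [_ _ _ hk]; split=> //; first exact: adm_rel.
have /(relbeta rC ex ey) H := hC.
have {}H := holds_allRel H (_ : _ = a) (_ : _ = b) ak.
have {}H : holds W (PRel (closR_imp a b h k) x y).
  by apply: holds_eq (H _ _) _; rewrite /closR_imp; sig.
have rI := adm_rel (adm_closR_imp rh ak).
have {H}/(relbeta rI ex ey) H := H.
by rewrite closR_imp_body in H; apply: holds_impE H _.
Qed.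

Lemma morph_uprl W W' r b a a' : morph W W' r ->
  morph (wrl b a a' W) (wrl b (tyr r a) (tyr r a') W') (Ren (rty r) (rtm r) (upr (rrl r))).
Proof.
case=> -[eX eG eT] eP; split; first by split=> //; apply: ren_rl_up.
move=> i p ei; have [q eq ->] := onth_map_inv ei; have [j ej] := eP _ _ eq.
by exists j; rewrite (onth_map_some _ ej) /wkp !pr_ren_ren.
Qed.

Lemma holds_allRelI W a a' p : wf W a -> wf W a' ->
  holds (wrl true a a' W) p -> holds W (PAllRel true a a' p).
Proof.
move=> wa wa' H W' r m; apply: d_allRelI; [exact: wf_ren m wa|exact: wf_ren m wa'|].
exact: H (morph_uprl true a a' m).
Qed.

Lemma closRI W a b h x y : rl W h a b x y -> rl W (closR a b h) a b x y.
Proof.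
move=> hx; have [rh ex ey _] := hx; have [_ wa wb] := rh.
have rC := adm_rel (adm_closR rh); split=> //; apply/(relbeta rC ex ey).
have -> : pinst2 (PAllRel true a b
    (PRel (wkr 0 2 0 (closR_imp a b (wkr 0 0 1 h) (RVar 0))) (Var 1) (Var 0))) x y
  = PAllRel true a b (PRel (closR_imp a b (wkr 0 0 1 h) (RVar 0))
      (tmr (rwk 0 0 1) x) (tmr (rwk 0 0 1) y)) by rewrite /closR_imp; sig.
apply: holds_allRelI => //; set W1 := wrl true a b W.
have ak : adm W1 (RVar 0) a b by split=> //; apply: adm_var.
have m1 := morph_wrl true a b W.
have hx1 := rl_morph m1 hx; rewrite /= !ty_ren0 in hx1; have [rh1 ex1 ey1 _] := hx1.
have rI := adm_rel (adm_closR_imp rh1 ak).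
apply/(relbeta rI ex1 ey1); rewrite closR_imp_body.
have rL := rel_rlolli rh1 (adm_rel ak).
apply: holds_impI; first exact: prp_rel rL (el_idtm wa) (el_idtm wb).
move=> W' r m hP.
have ra := rel_ren m (adm_rel ak).
have hL : rl W' (rlolli (tyr r a) (tyr r b) (tyr r a) (tyr r b) (rlr r (wkr 0 0 1 h))
    (rlr r (RVar 0))) (TLolli (tyr r a) (tyr r a)) (TLolli (tyr r b) (tyr r b))
    (idtm (tyr r a)) (idtm (tyr r b)).
  rewrite -rlolli_ren; split; last exact: hP.
  - exact: rel_ren m rL.
  - exact: el_idtm (wf_ren m wa).
  - exact: el_idtm (wf_ren m wb).
have hx2 := rl_morph m hx1; have [_ ex2 ey2 _] := hx2.
have H := rlolliE ra hL hx2.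
have [_ _ _] := rl_eqv H (idtm_beta ex2 (wf_ren m wa)) (idtm_beta ey2 (wf_ren m wb)).
by [].
Qed.

(** * The coalgebra [nu] *)

(* The functor enters only through its substitution, typing and parametricity
   properties, so that [nu] is treated here for an opaque constructor [sg] with
   action [mp] on terms and [rs] on relations. *)
Section Nu.

Variables (sg : ty -> ty) (mp : ty -> ty -> tm -> tm).
Hypotheses
  (sg_sub : forall st a, ty_sub st (sg a) = sg (ty_sub st a))
  (sg_wf : forall n a, wf_ty n a -> wf_ty n (sg a))
  (mp_sub : forall st sb a b f,
     tm_sub st sb (mp a b f) = mp (ty_sub st a) (ty_sub st b) (tm_sub st sb f))
  (el_mp : forall W a b f, wf W a -> wf W b -> el W f (TLolli a b) ->
     el W (mp a b f) (TLolli (sg a) (sg b))).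

Definition coT (a : ty) : ty := TTens (TBang (TLolli a (sg a))) a.
Definition gT (b : ty) : ty := TPi (TLolli (coT (TVar 0)) (wkT 1 b)).
Definition nuT : ty := TPi (TLolli (gT (TVar 0)) (TVar 0)).

Definition packT : tm :=
  TLam (Lam (coT (TVar 0)) (TLam (Lam (gT (TVar 0)) (App (TApp (Var 0) (TVar 1)) (Var 1))))).

Definition unfT : tm :=
  TLam (Lam (TBang (TLolli (TVar 0) (sg (TVar 0)))) (Lam (TVar 0)
    (App (TApp packT (TVar 0)) (Tens (Var 1) (Var 0))))).

Definition argT : tm :=
  TLam (Lam (coT (TVar 0)) (LetT (Var 0) (LetB (Var 1)
    (App (mp (TVar 0) nuT (App (TApp unfT (TVar 0)) (Bang (Var 0))))
         (App (Var 0) (Var 1)))))).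

Definition outT : tm := Lam nuT (App (TApp (Var 0) (sg nuT)) argT).

Ltac sig_hook ::=
  unfold outT, argT, unfT, packT, nuT, gT, coT;
  rewrite /= ?sg_sub ?mp_sub /=; sig_norm0; rewrite ?sg_sub ?mp_sub /=.

Ltac sig_cong ::=
  lazymatch goal with
  | |- sg _ = sg _ => idtac
  | |- mp _ _ _ = mp _ _ _ => idtac
  end.

Lemma sg_ren r a : ty_ren r (sg a) = sg (ty_ren r a).
Proof. by rewrite !ty_renE sg_sub. Qed.

Lemma mp_ren rt r a b f : tm_ren rt r (mp a b f) = mp (ty_ren rt a) (ty_ren rt b) (tm_ren rt r f).
Proof. by rewrite tm_renE mp_sub -!ty_renE -tm_renE. Qed.

Lemma coT_ren r a : ty_ren r (coT a) = coT (ty_ren r a).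
Proof. by rewrite /coT /= sg_ren. Qed.

Lemma gT_sub st b : ty_sub st (gT b) = gT (ty_sub st b).
Proof. sig. Qed.

Lemma gT_ren r b : ty_ren r (gT b) = gT (ty_ren r b).
Proof. by rewrite !ty_renE gT_sub. Qed.

Lemma nuT_sub st : ty_sub st nuT = nuT.
Proof. sig. Qed.

Lemma nuT_ren r : ty_ren r nuT = nuT.
Proof. by rewrite ty_renE nuT_sub. Qed.

Lemma packT_sub st sb : tm_sub st sb packT = packT.
Proof. sig. Qed.

Lemma unfT_sub st sb : tm_sub st sb unfT = unfT.
Proof. sig. Qed.

Lemma outT_sub st sb : tm_sub st sb outT = outT.
Proof. sig. Qed.

Lemma packT_ren rt r : tm_ren rt r packT = packT.
Proof. by rewrite tm_renE packT_sub. Qed.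

Lemma unfT_ren rt r : tm_ren rt r unfT = unfT.
Proof. by rewrite tm_renE unfT_sub. Qed.

Lemma outT_ren rt r : tm_ren rt r outT = outT.
Proof. by rewrite tm_renE outT_sub. Qed.

Lemma wf_sg W a : wf W a -> wf W (sg a).
Proof. exact: sg_wf. Qed.

Lemma wf_coT W a : wf W a -> wf W (coT a).
Proof. by move=> wa; rewrite /wf /= sg_wf // andbT; apply/andP. Qed.

Lemma wf_gT W b : wf W b -> wf W (gT b).
Proof.
move=> wb; rewrite /wf /= sg_wf //=; exact: wf_ren (morph_wty W) wb.
Qed.

Lemma wf_nuT W : wf W nuT.
Proof. by rewrite /wf /= sg_wf. Qed.

Lemma el_gapp W g b c y : el W g (gT b) -> wf W c -> el W y (coT c) ->
  el W (App (TApp g c) y) b.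
Proof.
move=> eg wc ey; apply: (@el_app _ (coT c)) => //.
by apply: el_tapp eg wc _; sig.
Qed.

Lemma el_gtapp W g b c : el W g (gT b) -> wf W c -> el W (TApp g c) (TLolli (coT c) b).
Proof. by move=> eg wc; apply: el_tapp eg wc _; sig. Qed.

Lemma el_nuapp W z b g : el W z nuT -> wf W b -> el W g (gT b) ->
  el W (App (TApp z b) g) b.
Proof.
move=> ez wb eg; apply: (@el_app _ (gT b)) => //.
by apply: el_tapp ez wb _; sig.
Qed.

Lemma eqv_nuapp W z z' b g g' : eqv W nuT z z' -> wf W b -> eqv W (gT b) g g' ->
  eqv W b (App (TApp z b) g) (App (TApp z' b) g').
Proof.
move=> ez wb eg; apply: (@eqv_app _ (gT b)) => //.
by apply: eqv_tapp ez wb _; sig.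
Qed.

Lemma el_packbody W c : wf W c -> el (wtm (coT c) W)
  (TLam (Lam (gT (TVar 0)) (App (TApp (Var 0) (wkT 1 c)) (Var 1)))) nuT.
Proof.
move=> wc; apply: el_tlam; apply: el_lam => //; first by apply: wf_gT.
apply: el_gapp; last 1 first.
- by rewrite -coT_ren; el_at.
- by el_at.
exact: wf_ren (morph_wty W) wc.
Qed.

Lemma el_packT W : el W packT (gT nuT).
Proof.
apply: el_tlam; apply: el_lam => //; first exact: wf_coT.
by rewrite /wkT nuT_ren; apply: (@el_packbody (wty W) (TVar 0)).
Qed.

Lemma el_pack W c : wf W c -> el W (TApp packT c) (TLolli (coT c) nuT).
Proof. exact: el_gtapp (el_packT W). Qed.

Lemma pack_beta W c y b g : wf W c -> el W y (coT c) -> wf W b -> el W g (gT b) ->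
  eqv W b (App (TApp (App (TApp packT c) y) b) g) (App (TApp g c) y).
Proof.
move=> wc ey wb eg.
have ep := el_app (el_pack wc) ey.
have e1 : eqv W (TLolli (coT c) nuT) (TApp packT c)
    (Lam (coT c) (TLam (Lam (gT (TVar 0)) (App (TApp (Var 0) (wkT 1 c)) (Var 1))))).
  apply: (@eqv_tbeta _ (TLolli (coT (TVar 0)) nuT)) => //; [|by sig|by sig].
  apply: el_lam => //; first exact: wf_coT.
  exact: (@el_packbody (wty W) (TVar 0)).
have e2 : eqv W nuT (App (TApp packT c) y)
    (TLam (Lam (gT (TVar 0)) (App (TApp (Var 0) (wkT 1 c)) (wkt 1 1 y)))).
  apply: eqv_trans (eqv_app e1 (eqv_refl ey)) _.
  apply: eqv_beta (el_packbody wc) _ (wf_coT wc) ey _ => //; by sig.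
have ety : el (wtm (gT (TVar 0)) (wty W)) (wkt 1 1 y) (wkT 1 (coT c)).
  have := el_ren (morph_comp (morph_wty W) (morph_wtm (gT (TVar 0)) _)) ey.
  by [].
have eb : el (wtm (gT (TVar 0)) (wty W)) (App (TApp (Var 0) (wkT 1 c)) (wkt 1 1 y)) (TVar 0).
  apply: el_gapp; last 1 first.
  - by rewrite -coT_ren; exact: ety.
  - by el_at.
  exact: wf_ren (morph_wty W) wc.
have o : occ 0 (wkt 1 1 y) = 0 by apply: occ_ren0.
have e3 : eqv W (TLolli (gT b) b) (TApp (App (TApp packT c) y) b)
    (Lam (gT b) (App (TApp (Var 0) c) (wkt 0 1 y))).
  apply: eqv_trans (eqv_tapp e2 wb (_ : _ = tinst (TLolli (gT (TVar 0)) (TVar 0)) b)) _.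
    by sig.
  apply: (@eqv_tbeta _ (TLolli (gT (TVar 0)) (TVar 0))) => //; [|by sig|by sig].
  by apply: el_lam => //; [apply: wf_gT|rewrite /= o].
apply: eqv_trans (eqv_app e3 (eqv_refl eg)) _.
apply: (@eqv_beta _ (gT b)) => //; last by sig.
- apply: el_gapp; [|exact: wc|exact: el_wtm ey].
  by apply: el_var.
- by rewrite /= occ_wk.
exact: wf_gT.
Qed.

Lemma el_unfbody W c : wf W c -> el (wtm (TBang (TLolli c (sg c))) W)
  (Lam c (App (TApp packT c) (Tens (Var 1) (Var 0)))) (TLolli c nuT).
Proof.
move=> wc; apply: el_lam => //; apply: el_app; first exact: el_pack.
by apply: el_tens; el_at.
Qed.

Lemma wf_cof W c : wf W c -> wf W (TBang (TLolli c (sg c))).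
Proof. by move=> wc; rewrite /wf /= sg_wf // andbT. Qed.

Lemma el_unfT W c : wf W c ->
  el W (TApp unfT c) (TLolli (TBang (TLolli c (sg c))) (TLolli c nuT)).
Proof.
move=> wc.
apply: (@el_tapp _ (TLolli (TBang (TLolli (TVar 0) (sg (TVar 0)))) (TLolli (TVar 0) nuT))) => //.
  apply: el_tlam; apply: el_lam => //; first exact: wf_cof.
  exact: (@el_unfbody (wty W)).
sig.
Qed.

Lemma el_unf W c w : wf W c -> el W w (TBang (TLolli c (sg c))) ->
  el W (App (TApp unfT c) w) (TLolli c nuT).
Proof. by move=> wc ew; apply: el_app (el_unfT wc) ew. Qed.

Lemma unf_beta W c w x : wf W c -> el W w (TBang (TLolli c (sg c))) -> el W x c ->
  eqv W nuT (App (App (TApp unfT c) w) x) (App (TApp packT c) (Tens w x)).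
Proof.
move=> wc ew ex.
have e1 : eqv W (TLolli (TBang (TLolli c (sg c))) (TLolli c nuT)) (TApp unfT c)
    (Lam (TBang (TLolli c (sg c))) (Lam c (App (TApp packT c) (Tens (Var 1) (Var 0))))).
  apply: (@eqv_tbeta _ (TLolli (TBang (TLolli (TVar 0) (sg (TVar 0)))) (TLolli (TVar 0) nuT)))
     => //; [|by sig|by sig].
  by apply: el_lam => //; [exact: wf_cof|exact: (@el_unfbody (wty W))].
apply: (@eqv_trans _ _ _ (App (Lam c (App (TApp packT c) (Tens (wkt 0 1 w) (Var 0)))) x)).
  apply: eqv_app (eqv_refl ex); apply: eqv_trans (eqv_app e1 (eqv_refl ew)) _.
  apply: eqv_beta (el_unfbody wc) _ (wf_cof wc) ew _ => //; by sig.
apply: eqv_beta => //; last by sig.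
- apply: el_app; first exact: el_pack.
  by apply: el_tens; [exact: el_wtm|el_at].
by rewrite /= occ_wk.
Qed.

Hypothesis occ_mp : forall i a b f, occ i f = 0 -> occ i (mp a b f) = 0.

Definition argbody (c : ty) : tm :=
  LetB (Var 1) (App (mp c nuT (App (TApp unfT c) (Bang (Var 0)))) (App (Var 0) (Var 1))).

Lemma el_argtm W c f x : wf W c -> el W f (TLolli c (sg c)) -> el W x c ->
  el W (App (mp c nuT (App (TApp unfT c) (Bang f))) (App f x)) (sg nuT).
Proof.
move=> wc ef ex; apply: (@el_app _ (sg c)); last exact: el_app ef ex.
apply: el_mp => //; first exact: wf_nuT.
by apply: el_unf => //; apply: el_bang.
Qed.

(** The action may copy its map any number of times, but each copy mentions only the variable opened
    by the let, which is intuitionistic. The linear variables are thus consumed once each, outside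
    the action. *)
Lemma occ_argF i c : occ i.+1 (mp c nuT (App (TApp unfT c) (Bang (Var 0)))) = 0.
Proof. exact: occ_mp. Qed.

Lemma el_argbody W c : wf W c ->
  el (wtm c (wtm (TBang (TLolli c (sg c))) W)) (argbody c) (sg nuT).
Proof.
move=> wc; apply: (@el_letB _ (TLolli c (sg c))); first by el_at.
apply: el_argtm => //; el_at.
Qed.

Lemma el_argfun W c : wf W c -> el (wtm (coT c) W) (LetT (Var 0) (argbody c)) (sg nuT).
Proof.
move=> wc; apply: (@el_letT _ (TBang (TLolli c (sg c))) c).
- by el_at.
- exact: (@el_argbody (wtm (coT c) W)).
- by rewrite /argbody /= occ_argF.
by rewrite /argbody /= occ_argF.
Qed.

Lemma occ_argfun c : occ 0 (LetT (Var 0) (argbody c)) = 1.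
Proof. by rewrite /argbody /= !occ_argF. Qed.

Lemma el_argT W : el W argT (gT (sg nuT)).
Proof.
apply: el_tlam; apply: el_lam => //; first exact: wf_coT.
  rewrite /wkT sg_ren nuT_ren; exact: (@el_argfun (wty W) (TVar 0)).
exact: occ_argfun.
Qed.

Lemma arg_beta W c f x : wf W c -> el W f (TLolli c (sg c)) -> el W x c ->
  eqv W (sg nuT) (App (TApp argT c) (Tens (Bang f) x))
    (App (mp c nuT (App (TApp unfT c) (Bang f))) (App f x)).
Proof.
move=> wc ef ex; have eT := el_tens (el_bang ef) ex.
have e1 : eqv W (TLolli (coT c) (sg nuT)) (TApp argT c) (Lam (coT c) (LetT (Var 0) (argbody c))).
  apply: (@eqv_tbeta _ (TLolli (coT (TVar 0)) (sg nuT))) => //; [|by sig|].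
    apply: el_lam; [exact: wf_coT|exact: (@el_argfun (wty W) (TVar 0))|exact: occ_argfun].
  by rewrite /argbody; sig.
apply: eqv_trans (eqv_app e1 (eqv_refl eT)) _.
apply: (@eqv_trans _ _ _ (LetT (Tens (Bang f) x) (argbody c))).
  apply: eqv_beta (el_argfun wc) (occ_argfun c) (wf_coT wc) eT _.
  by rewrite /argbody; sig.
apply: (@eqv_trans _ _ _ (LetB (Bang f)
   (App (mp c nuT (App (TApp unfT c) (Bang (Var 0)))) (App (Var 0) (wkt 0 1 x))))).
  apply: (eqv_betaT (el_bang ef) ex (el_argbody wc)).
  - by rewrite /argbody /= occ_argF.
  - by rewrite /argbody /= occ_argF.
  by rewrite /argbody; sig.
apply: (eqv_betaB ef); last by sig.
by apply: el_argtm => //; [el_at|exact: el_wtm ex].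
Qed.

Lemma el_outbody W : el (wtm nuT W) (App (TApp (Var 0) (sg nuT)) argT) (sg nuT).
Proof.
apply: el_nuapp; [by el_at|by apply: wf_sg; apply: wf_nuT|exact: el_argT].
Qed.

Lemma occ_argT i : occ i argT = 0.
Proof. by rewrite /argT /= -/unfT -/nuT !occ_argF. Qed.

Lemma el_outT W : el W outT (TLolli nuT (sg nuT)).
Proof.
apply: el_lam; [exact: wf_nuT|exact: el_outbody|].
by have := occ_argT 0; rewrite /= => ->.
Qed.

Lemma out_beta W z : el W z nuT ->
  eqv W (sg nuT) (App outT z) (App (TApp z (sg nuT)) argT).
Proof.
move=> ez; apply: eqv_beta (el_outbody W) _ (wf_nuT W) ez _.
  by have := occ_argT 0; rewrite /= => ->.
sig.
Qed.

Lemma out_pack W c f x : wf W c -> el W f (TLolli c (sg c)) -> el W x c ->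
  eqv W (sg nuT) (App outT (App (TApp packT c) (Tens (Bang f) x)))
    (App (mp c nuT (App (TApp unfT c) (Bang f))) (App f x)).
Proof.
move=> wc ef ex; have eT := el_tens (el_bang ef) ex.
apply: eqv_trans (out_beta (el_app (el_pack wc) eT)) _.
apply: eqv_trans (arg_beta wc ef ex).
by apply: pack_beta => //; [apply: wf_sg; apply: wf_nuT|exact: el_argT].
Qed.

Definition postG (h g : tm) : tm :=
  TLam (comp (coT (TVar 0)) (wkt 1 0 h) (TApp (wkt 1 0 g) (TVar 0))).

Lemma postG_ren rt r h g : tm_ren rt r (postG h g) = postG (tm_ren rt r h) (tm_ren rt r g).
Proof. rewrite /postG /comp; sig. Qed.

Lemma el_post W b b' h g : el W h (TLolli b b') -> el W g (gT b) -> el W (postG h g) (gT b').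
Proof.
move=> eh eg; apply: el_tlam; apply: (@el_comp _ _ (wkT 1 b)).
- exact: wf_coT.
- exact: el_ren (morph_wty W) eh.
apply: el_gtapp => //; have := el_ren (morph_wty W) eg; by rewrite gT_ren.
Qed.

Lemma post_beta W b b' h g c y : el W h (TLolli b b') -> el W g (gT b) -> wf W c ->
  el W y (coT c) -> eqv W b' (App (TApp (postG h g) c) y) (App h (App (TApp g c) y)).
Proof.
move=> eh eg wc ey.
have e1 : eqv W (TLolli (coT c) b') (TApp (postG h g) c) (comp (coT c) h (TApp g c)).
  apply: (@eqv_tbeta _ (TLolli (coT (TVar 0)) (wkT 1 b'))) => //; [|by sig|].
    apply: (@el_comp _ _ (wkT 1 b)); first exact: wf_coT.
      exact: el_ren (morph_wty W) eh.
    apply: el_gtapp => //; have := el_ren (morph_wty W) eg; by rewrite gT_ren.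
  by rewrite /comp; sig.
apply: eqv_trans (eqv_app e1 (eqv_refl ey)) _.
exact: comp_beta (wf_coT wc) eh (el_gtapp eg wc) ey.
Qed.

Lemma gT_ext W b g g' : el W g (gT b) -> el W g' (gT b) ->
  (forall W' r c y, morph W W' r -> wf W' c -> el W' y (coT c) ->
     eqv W' (tyr r b) (App (TApp (tmr r g) c) y) (App (TApp (tmr r g') c) y)) ->
  eqv W (gT b) g g'.
Proof.
move=> eg eg' K; apply: eqv_extT => // W1 r1 c m1 wc.
have E : ty_sub (scons c (TVar \o rty r1)) (TLolli (coT (TVar 0)) (wkT 1 b))
  = TLolli (coT c) (tyr r1 b) by sig.
have eg1 := el_ren m1 eg; have eg1' := el_ren m1 eg'; rewrite !gT_ren in eg1 eg1'.
rewrite E; apply: eqv_ext.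
- exact: wf_coT.
- exact: el_gtapp.
- exact: el_gtapp.
move=> W2 r2 y m2; rewrite coT_ren => ey; rewrite ty_ren_ren /= !tm_ren_ren.
exact: K (morph_comp m1 m2) (wf_ren m2 wc) ey.
Qed.

Lemma nuT_ext W z z' : el W z nuT -> el W z' nuT ->
  (forall W' r b g, morph W W' r -> wf W' b -> el W' g (gT b) ->
     eqv W' b (App (TApp (tmr r z) b) g) (App (TApp (tmr r z') b) g)) ->
  eqv W nuT z z'.
Proof.
move=> ez ez' K; apply: eqv_extT => // W1 r1 b m1 wb.
have E : ty_sub (scons b (TVar \o rty r1)) (TLolli (gT (TVar 0)) (TVar 0))
  = TLolli (gT b) b by sig.
have ez1 := el_ren m1 ez; have ez1' := el_ren m1 ez'; rewrite nuT_ren in ez1 ez1'.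
have T t : el W1 t nuT -> el W1 (TApp t b) (TLolli (gT b) b).
  by move=> et; apply: el_tapp et wb _; sig.
rewrite E; apply: eqv_ext; [exact: wf_gT|exact: T|exact: T|].
move=> W2 r2 g m2; rewrite gT_ren => eg; rewrite /= !tm_ren_ren.
exact: K (morph_comp m1 m2) (wf_ren m2 wb) eg.
Qed.

Variable rs : ty -> ty -> lrel -> lrel.
Hypothesis rel_rs : forall W c c' S, rel W S c c' -> rel W (rs c c' S) (sg c) (sg c').
Hypothesis rs_ren : forall r c c' S,
  rlr r (rs c c' S) = rs (tyr r c) (tyr r c') (rlr r S).

Definition cofR (c c' : ty) (S : lrel) : lrel :=
  rlolli c c' (sg c) (sg c') S (rs c c' S).
Definition coalgR (c c' : ty) (S : lrel) : lrel :=
  rtens (TBang (TLolli c (sg c))) (TBang (TLolli c' (sg c'))) c c'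
    (rbang (TLolli c (sg c)) (TLolli c' (sg c')) (cofR c c' S)) S.

Hypothesis param : forall W b g c c' S y y', wf W b -> el W g (gT b) -> adm W S c c' ->
  rl W (coalgR c c' S) (coT c) (coT c') y y' ->
  eqv W b (App (TApp g c) y) (App (TApp g c') y').

Hypothesis natural : forall W z b b' h g, el W z nuT -> wf W b -> wf W b' ->
  el W h (TLolli b b') -> el W g (gT b) ->
  eqv W b' (App h (App (TApp z b) g)) (App (TApp z b') (postG h g)).

Hypothesis graph_map : forall W c c' h f f', wf W c -> wf W c' ->
  el W h (TLolli c c') -> el W f (TLolli c (sg c)) -> el W f' (TLolli c' (sg c')) ->
  (forall W' r x, morph W W' r -> el W' x (tyr r c) ->
     eqv W' (tyr r (sg c')) (App (tmr r f') (App (tmr r h) x))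
       (App (tmr r (mp c c' h)) (App (tmr r f) x))) ->
  rl W (cofR c c' (graphR c c' h)) (TLolli c (sg c)) (TLolli c' (sg c')) f f'.

(** * The unfolding of [outT] is the identity *)

Notation unfold_of c f := (App (TApp unfT c) (Bang f)).

Lemma unfold_of_beta W c f x : wf W c -> el W f (TLolli c (sg c)) -> el W x c ->
  eqv W nuT (App (unfold_of c f) x) (App (TApp packT c) (Tens (Bang f) x)).
Proof. by move=> wc ef ex; apply: unf_beta => //; apply: el_bang. Qed.

Lemma el_unfold_of W c f : wf W c -> el W f (TLolli c (sg c)) ->
  el W (unfold_of c f) (TLolli c nuT).
Proof. by move=> wc ef; apply: el_unf => //; apply: el_bang. Qed.

(* [unfold_of c f] is a coalgebra morphism from [f] to [outT], so its graph is
   preserved by the coalgebra structures. *)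
Lemma param_unfold W b g c f x : wf W b -> el W g (gT b) -> wf W c ->
  el W f (TLolli c (sg c)) -> el W x c ->
  eqv W b (App (TApp g c) (Tens (Bang f) x))
    (App (TApp g nuT) (Tens (Bang outT) (App (unfold_of c f) x))).
Proof.
move=> wb eg wc ef ex; have wN := wf_nuT W.
have eh := el_unfold_of wc ef; have eo := el_outT W.
apply: (param wb eg (adm_graphR wc wN eh)).
apply: rl_tens; last by apply/(rl_graphR _ wc wN eh ex); apply: eqv_refl; apply: el_app eh ex.
apply: rl_bang; apply: graph_map => // W' r y m ey.
have wc' := wf_ren m wc; have ef' := el_ren m ef.
have TE d0 d1 : tyr r (TLolli d0 d1) = TLolli (tyr r d0) (tyr r d1) by [].
rewrite TE sg_ren in ef'.
rewrite sg_ren nuT_ren outT_ren mp_ren nuT_ren.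
have -> : tmr r (unfold_of c f) = unfold_of (tyr r c) (tmr r f).
  by rewrite tm_ren_app -[tmr r (TApp _ _)]/(TApp (tmr r unfT) (tyr r c)) unfT_ren.
apply: eqv_trans (out_pack wc' ef' ey).
apply: eqv_app (eqv_refl (el_outT W')) _; exact: unfold_of_beta.
Qed.

(** Elements of [nuT] are equal when they agree on every family [g]. On packed elements this turns
    both sides into values of [g], which [param_unfold] identifies. *)
Lemma pack_unfold W c f x : wf W c -> el W f (TLolli c (sg c)) -> el W x c ->
  eqv W nuT (App (TApp packT c) (Tens (Bang f) x))
    (App (TApp packT nuT) (Tens (Bang outT) (App (unfold_of c f) x))).
Proof.
move=> wc ef ex; have wN := wf_nuT W; have eo := el_outT W.
have eY := el_tens (el_bang ef) ex.
have eY' := el_tens (el_bang eo) (el_app (el_unfold_of wc ef) ex).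
apply: nuT_ext; [exact: el_app (el_pack wc) eY|exact: el_app (el_pack wN) eY'|].
move=> W' r b g m wb eg.
have wc' := wf_ren m wc; have ef' := el_ren m ef; have ex' := el_ren m ex.
have TE d0 d1 : tyr r (TLolli d0 d1) = TLolli (tyr r d0) (tyr r d1) by [].
rewrite TE sg_ren in ef'.
have E1 : tmr r (App (TApp packT c) (Tens (Bang f) x))
    = App (TApp packT (tyr r c)) (Tens (Bang (tmr r f)) (tmr r x)).
  by rewrite -[LHS]/(App (TApp (tmr r packT) (tyr r c)) _) packT_ren.
have E2 : tmr r (App (TApp packT nuT) (Tens (Bang outT) (App (unfold_of c f) x)))
    = App (TApp packT nuT) (Tens (Bang outT) (App (unfold_of (tyr r c) (tmr r f)) (tmr r x))).
  rewrite -[LHS]/(App (TApp (tmr r packT) (tyr r nuT)) (Tens (Bang (tmr r outT))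
    (App (App (TApp (tmr r unfT) (tyr r c)) (Bang (tmr r f))) (tmr r x)))).
  by rewrite packT_ren outT_ren unfT_ren nuT_ren.
rewrite E1 E2.
have wN' := wf_nuT W'; have eo' := el_outT W'.
have eZ := el_tens (el_bang ef') ex'.
have eZ' := el_tens (el_bang eo') (el_app (el_unfold_of wc' ef') ex').
apply: eqv_trans (pack_beta wc' eZ wb eg) _.
apply: eqv_trans (eqv_sym (pack_beta wN' eZ' wb eg)).
exact: param_unfold.
Qed.

Definition unfold_out : tm := unfold_of nuT outT.

Lemma el_unfold_out W : el W unfold_out (TLolli nuT nuT).
Proof. exact: el_unfold_of (wf_nuT W) (el_outT W). Qed.

Lemma unfold_out_ren rt r : tm_ren rt r unfold_out = unfold_out.
Proof.
rewrite -[LHS]/(App (TApp (tm_ren rt r unfT) (ty_ren rt nuT)) (Bang (tm_ren rt r outT))).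
by rewrite unfT_ren nuT_ren outT_ren.
Qed.

(** Unfolding [outT] at a point [p] gives [p] packed with [outT]. When [p] is itself the packing of
    [!f] and [x], it is the unfolding of [f] at [x], and [pack_unfold] closes the circle. *)
Lemma unfold_out_pack_bang W c f x : wf W c -> el W f (TLolli c (sg c)) -> el W x c ->
  eqv W nuT (App (TApp packT c) (Tens (Bang f) x))
    (App unfold_out (App (TApp packT c) (Tens (Bang f) x))).
Proof.
move=> wc ef ex; have wN := wf_nuT W; have eo := el_outT W.
have eP := el_app (el_pack wc) (el_tens (el_bang ef) ex).
apply: eqv_trans (eqv_sym (unfold_of_beta wN eo eP)).
apply: eqv_trans (pack_unfold wc ef ex) _.
apply: eqv_app (eqv_refl (el_pack wN)) _.
apply: eqv_tens (eqv_refl (el_bang eo)) _; exact: unfold_of_beta.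
Qed.

(** Presents a pair as a function of its first component, so that [bang_ext] can be applied to that
    component alone. *)
Definition pairT (a : ty) (x : tm) : tm := Lam a (Tens (Var 0) (wkt 0 1 x)).

Lemma el_pairT W a b x : wf W a -> el W x b -> el W (pairT a x) (TLolli a (TTens a b)).
Proof.
move=> wa ex; apply: el_lam => //; last by rewrite /= occ_wk.
by apply: el_tens; [el_at|exact: el_wtm].
Qed.

Lemma pairT_beta W a b x w : wf W a -> el W x b -> el W w a ->
  eqv W (TTens a b) (App (pairT a x) w) (Tens w x).
Proof.
move=> wa ex ew; apply: eqv_beta => //.
- by apply: el_tens; [el_at|exact: el_wtm].
- by rewrite /= occ_wk.
rewrite /=; congr Tens; sig.
Qed.

Lemma pairT_ren r a x : tmr r (pairT a x) = pairT (tyr r a) (tmr r x).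
Proof. rewrite /pairT /=; congr (Lam _ (Tens _ _)); sig. Qed.

Lemma pack_ren r c : tmr r (TApp packT c) = TApp packT (tyr r c).
Proof. by rewrite -[LHS]/(TApp (tmr r packT) (tyr r c)) packT_ren. Qed.

(** With [x] fixed, both sides are functions of the component of ! type, and [bang_ext] reduces them
    to promoted coalgebras. *)
Lemma unfold_out_pack_tens W c w x : wf W c -> el W w (TBang (TLolli c (sg c))) ->
  el W x c -> eqv W nuT (App (TApp packT c) (Tens w x))
    (App unfold_out (App (TApp packT c) (Tens w x))).
Proof.
move=> wc ew ex.
have K V d : wf V d -> el V (comp (coT d) unfold_out (TApp packT d)) (TLolli (coT d) nuT).
  by move=> wd; apply: el_comp (wf_coT wd) (el_unfold_out V) (el_pack wd).
have wA : wf W (TLolli c (sg c)) := wf_cof wc.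
have wB := wf_cof wc; have eq := el_pairT wB ex.
have e1 := el_comp wB (el_pack wc) eq; have e2 := el_comp wB (K _ _ wc) eq.
have P V d v y : wf V d -> el V v (TBang (TLolli d (sg d))) -> el V y d ->
    eqv V nuT (App (comp (TBang (TLolli d (sg d))) (TApp packT d)
      (pairT (TBang (TLolli d (sg d))) y)) v) (App (TApp packT d) (Tens v y)).
  move=> wd ev ey; have wD := wf_cof wd.
  apply: eqv_trans (comp_beta wD (el_pack wd) (el_pairT wD ey) ev) _.
  apply: eqv_app (eqv_refl (el_pack wd)) _; exact: pairT_beta.
have Q V d v y : wf V d -> el V v (TBang (TLolli d (sg d))) -> el V y d ->
    eqv V nuT (App (comp (TBang (TLolli d (sg d))) (comp (coT d) unfold_out (TApp packT d))
      (pairT (TBang (TLolli d (sg d))) y)) v)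
      (App unfold_out (App (TApp packT d) (Tens v y))).
  move=> wd ev ey; have wD := wf_cof wd.
  apply: eqv_trans (comp_beta wD (K _ _ wd) (el_pairT wD ey) ev) _.
  apply: eqv_trans (eqv_app (eqv_refl (K _ _ wd)) (pairT_beta wD ey ev)) _.
  exact: comp_beta (wf_coT wd) (el_unfold_out V) (el_pack wd) (el_tens ev ey).
apply: eqv_trans (eqv_sym (P _ _ _ _ wc ew ex)) _.
apply: eqv_trans (Q _ _ _ _ wc ew ex).
apply: (bang_ext wA (wf_nuT W) e1 e2) ew => W' r f m ef.
have wc' := wf_ren m wc; have ex' := el_ren m ex.
have BE d0 d1 : tyr r (TBang (TLolli d0 d1)) = TBang (TLolli (tyr r d0) (tyr r d1)) by [].
have TE d0 d1 : tyr r (TLolli d0 d1) = TLolli (tyr r d0) (tyr r d1) by [].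
rewrite !comp_ren pairT_ren pack_ren unfold_out_ren BE nuT_ren coT_ren sg_ren.
rewrite TE sg_ren in ef; have ew' := el_bang ef.
apply: eqv_trans (P _ _ _ _ wc' ew' ex') _.
apply: eqv_trans (eqv_sym (Q _ _ _ _ wc' ew' ex')).
exact: unfold_out_pack_bang.
Qed.

(** The remaining passage, from pairs to arbitrary elements of the coalgebra type, is an instance of
    [tens_ext]. *)
Lemma unfold_out_pack W c y : wf W c -> el W y (coT c) ->
  eqv W nuT (App (TApp packT c) y) (App unfold_out (App (TApp packT c) y)).
Proof.
move=> wc ey; have wC := wf_coT wc.
have C V d v : wf V d -> el V v (coT d) ->
    eqv V nuT (App (comp (coT d) unfold_out (TApp packT d)) v)
      (App unfold_out (App (TApp packT d) v)).
  by move=> wd; apply: comp_beta (wf_coT wd) (el_unfold_out V) (el_pack wd).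
apply: eqv_trans (C _ _ _ wc ey).
have eC := el_comp wC (el_unfold_out W) (el_pack wc).
apply: (tens_ext (wf_cof wc) wc (el_pack wc) eC) ey => W' r w x m ew ex.
have BE d0 d1 : tyr r (TBang (TLolli d0 d1)) = TBang (TLolli (tyr r d0) (tyr r d1)) by [].
rewrite BE sg_ren in ew; have wc' := wf_ren m wc.
rewrite comp_ren pack_ren unfold_out_ren nuT_ren coT_ren.
apply: eqv_trans (eqv_sym (C _ _ _ wc' (el_tens ew ex))).
exact: unfold_out_pack_tens.
Qed.

(** Evaluation at [(b, g)] as a linear map out of [nuT], the form in which [natural] can be applied
    to it. *)
Definition elimT (b : ty) (g : tm) : tm := Lam nuT (App (TApp (Var 0) b) (wkt 0 1 g)).

Lemma el_elimT W b g : wf W b -> el W g (gT b) -> el W (elimT b g) (TLolli nuT b).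
Proof.
move=> wb eg; apply: el_lam; [exact: wf_nuT| |by rewrite /= occ_wk].
by apply: el_nuapp => //; [el_at|exact: el_wtm].
Qed.

Lemma elimT_beta W b g z : wf W b -> el W g (gT b) -> el W z nuT ->
  eqv W b (App (elimT b g) z) (App (TApp z b) g).
Proof.
move=> wb eg ez; apply: (@eqv_beta _ nuT) => //.
- by apply: el_nuapp => //; [el_at|exact: el_wtm].
- by rewrite /= occ_wk.
- exact: wf_nuT.
rewrite /=; congr (App (TApp _ _) _); sig.
Qed.

Lemma elimT_ren r b g : tmr r (elimT b g) = elimT (tyr r b) (tmr r g).
Proof.
rewrite -[LHS]/(Lam (tyr r nuT) (App (TApp (Var 0) (tyr r b))
  (tm_ren (rty r) (upr (rtm r)) (wkt 0 1 g)))) nuT_ren.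
congr (Lam _ (App _ _)); sig.
Qed.

Lemma post_elimT_pack W b g : wf W b -> el W g (gT b) ->
  eqv W (gT b) (postG (elimT b g) packT) g.
Proof.
move=> wb eg; apply: gT_ext => //; first exact: el_post (el_elimT wb eg) (el_packT W).
move=> W' r c y m wc ey.
have wb' := wf_ren m wb; have eg' := el_ren m eg; rewrite gT_ren in eg'.
rewrite postG_ren elimT_ren packT_ren.
apply: eqv_trans (post_beta (el_elimT wb' eg') (el_packT W') wc ey) _.
apply: eqv_trans (elimT_beta wb' eg' (el_app (el_pack wc) ey)) _.
exact: pack_beta.
Qed.

(** Evaluating the left side at [(b, g)] and moving this evaluation inside by naturality leaves [z]
    at [b], applied to [packT] followed by evaluation at [(b, g)]; by [post_elimT_pack] that family
    is [g] itself. *)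
Lemma nu_pack W z : el W z nuT -> eqv W nuT (App (TApp z nuT) packT) z.
Proof.
move=> ez; have wN := wf_nuT W.
apply: nuT_ext => //; first exact: el_nuapp wN (el_packT W).
move=> W' r b g m wb eg; have ez' := el_ren m ez; rewrite nuT_ren in ez'.
rewrite -[tmr r (App _ _)]/(App (TApp (tmr r z) (tyr r nuT)) (tmr r packT)).
rewrite nuT_ren packT_ren; have wN' := wf_nuT W'; have ep := el_packT W'.
apply: eqv_trans (eqv_sym (elimT_beta wb eg (el_nuapp ez' wN' ep))) _.
apply: eqv_trans (natural ez' wN' wb (el_elimT wb eg) ep) _.
exact: eqv_nuapp (eqv_refl ez') wb (post_elimT_pack wb eg).
Qed.

(** By [nu_pack], [z] is [z] applied to [packT]. Naturality moves [unfold_out] into the family,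
    where it acts on packed elements only and so changes nothing. *)
Lemma unfold_outP W z : el W z nuT -> eqv W nuT (App unfold_out z) z.
Proof.
move=> ez; have wN := wf_nuT W; have ep := el_packT W; have ek := el_unfold_out W.
have ezp := el_nuapp ez wN ep.
apply: eqv_trans (eqv_app (eqv_refl ek) (eqv_sym (nu_pack ez))) _.
apply: eqv_trans (natural ez wN wN ek ep) _.
apply: eqv_trans (nu_pack ez); apply: eqv_nuapp (eqv_refl ez) wN _.
apply: gT_ext => //; first exact: el_post ek ep.
move=> W' r c y m wc ey; rewrite postG_ren unfold_out_ren packT_ren nuT_ren.
apply: eqv_trans (post_beta (el_unfold_out W') (el_packT W') wc ey) _.
exact: eqv_sym (unfold_out_pack wc ey).
Qed.

Lemma adm_bisim W S x y : adm W S nuT nuT ->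
  rl W (cofR nuT nuT S) (TLolli nuT (sg nuT)) (TLolli nuT (sg nuT)) outT outT ->
  rl W S nuT nuT x y -> eqv W nuT x y.
Proof.
move=> aS ho hx; have wN := wf_nuT W; have eo := el_outT W.
have [_ ex ey _] := hx.
have U z : el W z nuT -> eqv W nuT (App (TApp packT nuT) (Tens (Bang outT) z)) z.
  move=> ez; apply: eqv_trans (unfold_outP ez); apply: eqv_sym.
  exact: unfold_of_beta.
apply: eqv_trans (eqv_sym (U _ ex)) _; apply: eqv_trans (U _ ey).
by apply: (param wN (el_packT W) aS); apply: rl_tens hx; apply: rl_bang.
Qed.

(** * From admissible to arbitrary bisimulations *)

Hypothesis rs_mono : forall W c R S, rel W R c c -> rel W S c c ->
  rl W (rlolli c c c c R S) (TLolli c c) (TLolli c c) (idtm c) (idtm c) ->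
  forall x y, rl W (rs c c R) (sg c) (sg c) x y -> rl W (rs c c S) (sg c) (sg c) x y.

(** Admissibility is not transported along equivalence, so an admissible representative [H] of the
    lifted relation is asked for instead of admissibility of [rs c c S]. *)
Hypothesis adm_rs : forall W c S, adm W S c c ->
  exists2 H, adm W H (sg c) (sg c) & requ W (sg c) (sg c) H (rs c c S).

Lemma bisim W R x y : rel W R nuT nuT ->
  rl W (cofR nuT nuT R) (TLolli nuT (sg nuT)) (TLolli nuT (sg nuT)) outT outT ->
  rl W R nuT nuT x y -> eqv W nuT x y.
Proof.
move=> rR ho hx; have wN := wf_nuT W; have eo := el_outT W.
pose P := closR nuT nuT R; have aP : adm W P nuT nuT := adm_closR rR.
have [H aH [_ _ HE]] := adm_rs aP.
(* [K], the reindexing of [rs P] along [outT], is admissible, and it contains [R]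
   because [R] is a bisimulation contained in [P]; hence it contains [P]. *)
pose K := reindexR nuT nuT H outT outT.
have aK : adm W K nuT nuT := adm_reindexR wN wN aH eo eo.
have hRP : rl W (rlolli nuT nuT nuT nuT R P) (TLolli nuT nuT) (TLolli nuT nuT)
    (idtm nuT) (idtm nuT).
  apply: rlolliI; [by []|exact: adm_rel aP|exact: el_idtm|exact: el_idtm|].
  move=> W' r u v m hu; rewrite closR_ren; apply: rl_idtm.
  exact: closRI hu.
have hRK : rl W (rlolli nuT nuT nuT nuT R K) (TLolli nuT nuT) (TLolli nuT nuT)
    (idtm nuT) (idtm nuT).
  apply: rlolliI; [by []|exact: adm_rel aK|exact: el_idtm|exact: el_idtm|].
  move=> W' r u v m hu; have [_ eu ev _] := hu.
  have aH' := adm_ren m aH; have eo' := el_ren m eo.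
  have wN' := wf_ren m wN.
  rewrite reindexR_ren; apply: rl_idtm; apply/(rl_reindexR wN' wN' aH' eo' eo' eu ev).
  apply/(HE _ _ _ _ m); rewrite rs_ren sg_ren.
  have rR' := rel_ren m rR; have rP' := rel_ren m (adm_rel aP).
  apply: (rs_mono rR' rP').
    by have := rl_morph m hRP; rewrite rlolli_ren.
  have ho' := rl_morph m ho; rewrite /cofR rlolli_ren rs_ren sg_ren in ho'.
  apply: rlolliE (rel_rs rR') _ hu.
  have -> : TLolli (tyr r nuT) (sg (tyr r nuT)) = tyr r (TLolli nuT (sg nuT)).
    by rewrite -[RHS]/(TLolli (tyr r nuT) (tyr r (sg nuT))) sg_ren.
  exact: ho'.
apply: (adm_bisim aP) (closRI hx); apply: rlolliI.
- exact: adm_rel.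
- exact: rel_rs (adm_rel aP).
- exact: eo.
- exact: eo.
move=> W' r u v m hu; have [_ eu ev _] := hu.
have aH' := adm_ren m aH; have eo' := el_ren m eo; have wN' := wf_ren m wN.
apply/(HE _ _ _ _ m); rewrite closR_ren in hu.
have hK := rl_morph m hRK; rewrite rlolli_ren in hK.
have := closRE (rel_ren m rR) (adm_ren m aK) hu hK.
by rewrite reindexR_ren => /(rl_reindexR wN' wN' aH' eo' eo' eu ev).
Qed.

End Nu.

(** * Coinduction *)

Lemma wf_icty_mono n m s : wf_icty n s -> n <= m -> wf_icty m s.
Proof.
elim: s n m => //= [i|s1 IH1 s2 IH2|s1 IH1 s2 IH2|s1 IH1] n m.
- exact: leq_trans.
- by case/andP=> w1 w2 nm; rewrite (IH1 _ _ w1 nm) (IH2 _ _ w2 nm).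
- by case/andP=> w1 w2 nm; rewrite (IH1 _ _ w1 nm) (IH2 _ _ w2 nm).
by move=> w1 nm; apply: IH1 w1 _.
Qed.

Lemma occ_ic_map s n k A B F : wf_icty n s -> (forall i, i < n -> occ k (F i) = 0) ->
  occ k (ic_map A B F s) = 0.
Proof.
have wk j t i : occ (j + i) (wkt 0 j t) = occ i t.
  by apply: occ_ren => l; rewrite eqn_add2l.
elim: s n k A B F => [i|c||s1 IH1 s2 IH2|s1 IH1 s2 IH2|s1 IH1|s1 IH1] n k A B F ws e //.
- exact: e.
- case/andP: ws => w1 w2; rewrite /= (wk 3) (wk 3).
  by rewrite (IH1 _ _ _ _ _ w1 e) (IH2 _ _ _ _ _ w2 e).
- case/andP: ws => w1 w2; rewrite /= (wk 2) (wk 2).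
  by rewrite (IH1 _ _ _ _ _ w1 e) (IH2 _ _ _ _ _ w2 e).
- by rewrite /= (wk 2) (IH1 _ _ _ _ _ ws e).
rewrite /= (wk 1) (IH1 n.+1 k _ _ _ ws) //; case=> //= i /e ei.
by rewrite -[RHS]ei; apply: occ_ren.
Qed.

Lemma ic_rel_piE n W s A B R t u c c' S : wf_icty n.+1 s ->
  (forall i, i < n -> rel W (R i) (A i) (B i)) ->
  rl W (ic_rel A B R (IPi s)) (ty_sub A (ic_ty (IPi s))) (ty_sub B (ic_ty (IPi s))) t u ->
  adm W S c c' ->
  rl W (ic_rel (scons c A) (scons c' B) (scons S R) s)
    (ty_sub (scons c A) (ic_ty s)) (ty_sub (scons c' B) (ic_ty s)) (TApp t c) (TApp u c').
Proof.
move=> ws wR H aS.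
have Ep d A0 : pity TVar d (ty_sub (upT A0) (ic_ty s)) = ty_sub (scons d A0) (ic_ty s).
  by rewrite /pity; sig.
have Er : piinst rid c c' S
    (ic_rel (scons (TVar 1) (fun i => wkT 2 (A i))) (scons (TVar 0) (fun i => wkT 2 (B i)))
       (scons (RVar 0) (fun i => wkr 2 0 1 (R i))) s)
  = ic_rel (scons c A) (scons c' B) (scons S R) s.
  rewrite (piinst_ic_rel _ _ _ _ _ _ _ ws); apply: ic_rel_ext ws _ => -[|i] _ //=.
  by rewrite !ty_ren_id rl_ren_id.
have := rpiE (a := ty_sub (upT A) (ic_ty s)) (b := ty_sub (upT B) (ic_ty s))
  (h := ic_rel (scons (TVar 1) (fun i => wkT 2 (A i))) (scons (TVar 0) (fun i => wkT 2 (B i)))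
     (scons (RVar 0) (fun i => wkr 2 0 1 (R i))) s) H aS.
rewrite Er !Ep; apply.
by apply: rel_ic_rel ws _ => -[|i] /=; [move=> _; exact: adm_rel|exact: wR].
Qed.

Lemma ic_rel_piI n W s A B R t u : wf_icty n.+1 s ->
  (forall i, i < n -> rel W (R i) (A i) (B i)) ->
  el W t (ty_sub A (ic_ty (IPi s))) -> el W u (ty_sub B (ic_ty (IPi s))) ->
  (forall W' r c c' S, morph W W' r -> adm W' S c c' ->
     rl W' (ic_rel (scons c (tyr r \o A)) (scons c' (tyr r \o B)) (scons S (rlr r \o R)) s)
       (ty_sub (scons c (tyr r \o A)) (ic_ty s)) (ty_sub (scons c' (tyr r \o B)) (ic_ty s))
       (TApp (tmr r t) c) (TApp (tmr r u) c')) ->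
  rl W (ic_rel A B R (IPi s)) (ty_sub A (ic_ty (IPi s))) (ty_sub B (ic_ty (IPi s))) t u.
Proof.
move=> ws wR et eu K.
have rI := @rel_ic_rel n (IPi s) W A B R ws wR.
apply: rpiI rI et eu _ => W' r c c' S m aS.
by rewrite (piinst_ic_rel _ _ _ _ _ _ _ ws) !pity_upT; apply: K.
Qed.

(** * The functor of an inductively constructed type *)

Section Instance.

Variables (s : icty) (ws : wf_icty 1 s) (ps : only_positive 0 (ic_ty s)).

Notation sg := (ic_app s).
Notation mp := (ic_map1 s).
Notation rs := (ic_rel1 s).
Notation N := (nuT (ic_app s)).

Lemma ic_app_sub st a : ty_sub st (sg a) = sg (ty_sub st a).
Proof. by rewrite /ic_app /tinst ty_sub_sub; apply: ty_sub_wf (wf_ic_ty ws) _ => -[]. Qed.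

Lemma ic_app_eq A : ty_sub A (ic_ty s) = sg (A 0).
Proof. by apply: ty_sub_wf (wf_ic_ty ws) _ => -[]. Qed.

Lemma wf_ic_app n a : wf_ty n a -> wf_ty n (sg a).
Proof. by move=> wa; apply: wf_ty_sub (wf_ic_ty ws) _ => -[]. Qed.

Lemma ic_map1_sub st sb a b f :
  tm_sub st sb (mp a b f) = mp (ty_sub st a) (ty_sub st b) (tm_sub st sb f).
Proof. by rewrite (ic_map_sub _ _ _ _ _ ws); apply: ic_map_ext ws _ => -[]. Qed.

(** The variable 0 may be acted on only forwards: this is the point at which positivity of [s]
    enters. *)
Lemma mpol1 : mpol 1 xpredT (fun i => i != 0) s.
Proof. by case=> //= _; exact: ps. Qed.

Lemma el_ic_map1 W a b f : wf W a -> wf W b -> el W f (TLolli a b) ->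
  el W (mp a b f) (TLolli (sg a) (sg b)).
Proof. by move=> wa wb ef; apply: el_ic_map ws mpol1 _ => -[]. Qed.

Lemma occ_ic_map1 i a b f : occ i f = 0 -> occ i (mp a b f) = 0.
Proof. by move=> o; apply: occ_ic_map ws _ => -[]. Qed.

Lemma rel_ic_rel1 W c c' S : rel W S c c' -> rel W (rs c c' S) (sg c) (sg c').
Proof. by move=> rS; apply: rel_ic_rel ws _ => -[]. Qed.

Lemma ic_rel1_eq A B R : ic_rel A B R s = rs (A 0) (B 0) (R 0).
Proof. by apply: ic_rel_ext ws _ => -[]. Qed.

Lemma ic_rel1_ren r c c' S : rlr r (rs c c' S) = rs (tyr r c) (tyr r c') (rlr r S).
Proof. by rewrite (ic_rel_ren _ _ _ _ ws) ic_rel1_eq. Qed.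

Lemma ic_rel1_req W c z : wf W c -> el W z (sg c) -> rl W (rs c c (req c)) (sg c) (sg c) z z.
Proof.
move=> wc ez; have e := idext_ic (A := scons c TVar) (R := scons (req c) RVar) ws wc erefl.
apply/(requ_id z z e); apply/reqP; first exact: wf_ic_app.
exact: eqv_refl.
Qed.

Lemma ic_map1_idtm W c z : wf W c -> el W z (sg c) ->
  eqv W (sg c) (App (mp c c (idtm c)) z) z.
Proof.
move=> wc ez.
have -> : mp c c (idtm c) = ic_map (scons c TVar) (scons c TVar) (idtm \o scons c TVar) s.
  by apply: ic_map_ext ws _ => -[].
by apply: ic_map_idtm ws _ ez => -[].
Qed.

Lemma ic_rel1_map W a a' b b' R S f f' z z' : rel W R a a' -> rel W S b b' ->
  rl W (rlolli a a' b b' R S) (TLolli a b) (TLolli a' b') f f' ->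
  rl W (rs a a' R) (sg a) (sg a') z z' ->
  rl W (rs b b' S) (sg b) (sg b') (App (mp a b f) z) (App (mp a' b' f') z').
Proof.
move=> rR rS hf; apply: (elem_okP ws mpol1 (A := scons a TVar) (A' := scons a' TVar)
  (B := scons b TVar) (B' := scons b' TVar) (R := scons R RVar) (S := scons S RVar)
  (F := scons f Var) (F' := scons f' Var)).
by case.
Qed.

(** The inclusion of [R] in [S] says that the identities carry [R] to [S]; the functorial action
    carries the lifted relations accordingly, and it preserves identities. *)
Lemma ic_rel1_mono W c R S : rel W R c c -> rel W S c c ->
  rl W (rlolli c c c c R S) (TLolli c c) (TLolli c c) (idtm c) (idtm c) ->
  forall x y, rl W (rs c c R) (sg c) (sg c) x y -> rl W (rs c c S) (sg c) (sg c) x y.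
Proof.
move=> rR rS hi x y hx; have [_ wc _] := rR; have [_ ex ey _] := hx.
exact: rl_eqv (ic_rel1_map rR rS hi hx) (ic_map1_idtm wc ex) (ic_map1_idtm wc ey).
Qed.

(** The representative is [RTy], admissible by [adm_ty]; the structural interpretation is only
    equivalent to it. *)
Lemma adm_ic_rel1 W c S : adm W S c c ->
  exists2 H, adm W H (sg c) (sg c) & requ W (sg c) (sg c) H (rs c c S).
Proof.
move=> aS; have ah := adms_cons aS (adms_nil W).
exists (RTy (ic_ty s) [:: S]).
  by have := adm_RTy ah (wf_ic_ty ws : wf_ty (size [:: S]) _); rewrite ic_app_eq.
have := requ_RTy_ic ws (erefl : size [:: S] = 1) ah.
by rewrite ic_app_eq ic_rel1_eq.
Qed.

(** The pair of the identity and [h] carries equality to the graph of [h]. Applied to [z], which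
    identity extension relates to itself, the functorial action yields the claim. *)
Lemma graph_ic_map1 W c c' h z : wf W c -> wf W c' -> el W h (TLolli c c') ->
  el W z (sg c) ->
  rl W (rs c c' (graphR c c' h)) (sg c) (sg c') z (App (mp c c' h) z).
Proof.
move=> wc wc' eh ez.
have rG := adm_rel (adm_graphR wc wc' eh).
have hi : rl W (rlolli c c c c' (req c) (graphR c c' h)) (TLolli c c) (TLolli c c') (idtm c) h.
  apply: rlolliI => //; [exact: rel_req|exact: el_idtm|].
  move=> W' r x y m; have wc1 := wf_ren m wc.
  have -> : rlr r (req c) = req (tyr r c) by sig.
  move/(reqP _ _ wc1) => exy; have [ex _ _] := exy; rewrite graphR_ren.
  have ei : el W' (App (tmr r (idtm c)) x) (tyr r c) by exact: el_app (el_idtm wc1) ex.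
  apply/(rl_graphR _ wc1 (wf_ren m wc') (el_ren m eh) ei).
  apply: eqv_app (eqv_refl (el_ren m eh)) _; exact: eqv_trans (idtm_beta ex wc1) exy.
have H := ic_rel1_map (rel_req wc) rG hi (ic_rel1_req wc ez).
exact: rl_eqv_l H (ic_map1_idtm wc ez).
Qed.

(** The premise says that [h] is a coalgebra morphism. It replaces the second component given by
    [graph_ic_map1] at [f x] by [f'] applied to the image of [x] under [h]. *)
Lemma graph_coalgebra W c c' h f f' : wf W c -> wf W c' ->
  el W h (TLolli c c') -> el W f (TLolli c (sg c)) -> el W f' (TLolli c' (sg c')) ->
  (forall W' r x, morph W W' r -> el W' x (tyr r c) ->
     eqv W' (tyr r (sg c')) (App (tmr r f') (App (tmr r h) x))
       (App (tmr r (mp c c' h)) (App (tmr r f) x))) ->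
  rl W (cofR sg rs c c' (graphR c c' h)) (TLolli c (sg c)) (TLolli c' (sg c')) f f'.
Proof.
move=> wc wc' eh ef ef' K; have rG := adm_rel (adm_graphR wc wc' eh).
apply: rlolliI => //; first exact: rel_ic_rel1.
move=> W' r x y m; rewrite ic_rel1_ren !graphR_ren !(sg_ren ic_app_sub) => hx.
have wc1 := wf_ren m wc; have wc1' := wf_ren m wc'; have eh1 := el_ren m eh.
have [_ ex ey _] := hx.
have TE d0 d1 : tyr r (TLolli d0 d1) = TLolli (tyr r d0) (tyr r d1) by [].
have ef1 := el_ren m ef; rewrite TE (sg_ren ic_app_sub) in ef1.
have ef1' := el_ren m ef'; rewrite TE (sg_ren ic_app_sub) in ef1'.
have /(rl_graphR _ wc1 wc1' eh1 ex) exy := hx.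
have H := graph_ic_map1 wc1 wc1' eh1 (el_app ef1 ex).
apply: rl_eqv_r H _; have := K _ _ _ m ex.
rewrite (sg_ren ic_app_sub) (mp_ren ic_map1_sub) => e.
apply: eqv_trans (eqv_sym e) _; exact: eqv_app (eqv_refl ef1') exy.
Qed.

(** These three present [coT], [gT] and [nuT] as inductively constructed types, so that identity
    extension for them unfolds clause by clause. In each of them the innermost binder around [s] is
    the coalgebra carrier, so [s] is used without renaming; [IVar 1] in [fam_ic] is the result
    type. *)
Definition coalg_ic : icty := ITens (IBang (ILolli (IVar 0) s)) (IVar 0).
Definition fam_ic : icty := IPi (ILolli coalg_ic (IVar 1)).
Definition nu_ic : icty := IPi (ILolli fam_ic (IVar 0)).

Lemma ty_sub_coalg A : ty_sub A (ic_ty coalg_ic) = coT sg (A 0).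
Proof. by rewrite /= ic_app_eq. Qed.

Lemma ty_sub_fam A : ty_sub A (ic_ty fam_ic) = gT sg (A 0).
Proof.
rewrite -[LHS]/(TPi (TLolli (ty_sub (upT A) (ic_ty coalg_ic)) (wkT 1 (A 0)))).
by rewrite ty_sub_coalg.
Qed.

Lemma ty_sub_nu A : ty_sub A (ic_ty nu_ic) = N.
Proof.
rewrite -[LHS]/(TPi (TLolli (ty_sub (upT A) (ic_ty fam_ic)) (TVar 0))).
by rewrite ty_sub_fam.
Qed.

Lemma ic_rel_coalg A B R :
  ic_rel A B R coalg_ic = coalgR sg rs (A 0) (B 0) (R 0).
Proof. by rewrite /= !ic_app_eq ic_rel1_eq. Qed.

Lemma wf_coalg_ic n : wf_icty n.+1 coalg_ic.
Proof. by rewrite /= (wf_icty_mono ws). Qed.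

Lemma wf_fam_ic n : wf_icty n.+1 fam_ic.
Proof. by rewrite /= (wf_icty_mono ws). Qed.

Lemma wf_nu_ic n : wf_icty n nu_ic.
Proof. by rewrite /= (wf_icty_mono ws). Qed.

(** Identity extension for [fam_ic], with equality on the result type, relates [g] to itself; the
    clauses for Pi at [S] and for [-o] at the two arguments leave exactly an equation in [b]. *)
Lemma coalg_param W b g c c' S y y' : wf W b -> el W g (gT sg b) -> adm W S c c' ->
  rl W (coalgR sg rs c c' S) (coT sg c) (coT sg c') y y' ->
  eqv W b (App (TApp g c) y) (App (TApp g c') y').
Proof.
move=> wb eg aS hy.
have e := idext_ic (A := fun=> b) (R := fun=> req b) (wf_fam_ic 0) wb erefl.
rewrite ty_sub_fam in e.
have hg : rl W (ic_rel (fun=> b) (fun=> b) (fun=> req b) fam_ic) (gT sg b) (gT sg b) g g.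
  apply/(requ_id g g e); apply/reqP; first exact: wf_gT wf_ic_app _ _ wb.
  exact: eqv_refl.
have wL : wf_icty 2 (ILolli coalg_ic (IVar 1)) by rewrite /= (wf_icty_mono ws).
rewrite -(ty_sub_fam (fun=> b)) in hg.
have rb := rel_req wb.
have := ic_rel_piE wL (fun i _ => rb) hg aS.
rewrite -[ic_rel _ _ _ (ILolli _ _)]/(rlolli _ _ _ _ (ic_rel _ _ _ coalg_ic) (req b)).
rewrite -!/(ty_sub _ _) => h1.
have := hy; rewrite -(ty_sub_coalg (scons c (fun=> b))) -(ty_sub_coalg (scons c' (fun=> b))).
have -> : coalgR sg rs c c' S
  = ic_rel (scons c (fun=> b)) (scons c' (fun=> b)) (scons S (fun=> req b)) coalg_ic.
  by rewrite ic_rel_coalg.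
move=> hy'; apply/(reqP _ _ wb); exact: rlolliE rb h1 hy'.
Qed.

Lemma rel_coalgR W c c' S : rel W S c c' ->
  rel W (coalgR sg rs c c' S) (coT sg c) (coT sg c').
Proof.
move=> rS; have := @rel_ic_rel 1 coalg_ic W (fun=> c) (fun=> c') (fun=> S).
rewrite ic_rel_coalg !ty_sub_coalg; apply; last by [].
exact: wf_coalg_ic.
Qed.

Lemma coalgR_ren r c c' S :
  rlr r (coalgR sg rs c c' S) = coalgR sg rs (tyr r c) (tyr r c') (rlr r S).
Proof.
have BE d : tyr r (TBang (TLolli d (sg d))) = TBang (TLolli (tyr r d) (sg (tyr r d))).
  by rewrite -(sg_ren ic_app_sub).
have TE d : tyr r (TLolli d (sg d)) = TLolli (tyr r d) (sg (tyr r d)).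
  by rewrite -(sg_ren ic_app_sub).
rewrite /coalgR rtens_ren rbang_ren /cofR rlolli_ren ic_rel1_ren !BE !TE.
by rewrite !(sg_ren ic_app_sub).
Qed.

(** At related arguments [g] takes equal values by [coalg_param], and applying [h] to one of these
    values is what the graph of [h] records. *)
Lemma post_graph W b b' h g c c' S : wf W b -> wf W b' ->
  el W h (TLolli b b') -> el W g (gT sg b) -> adm W S c c' ->
  rl W (rlolli (coT sg c) (coT sg c') b b' (coalgR sg rs c c' S) (graphR b b' h))
    (TLolli (coT sg c) b) (TLolli (coT sg c') b') (TApp g c) (TApp (postG sg h g) c').
Proof.
move=> wb wb' eh eg aS; have [_ wc wc'] := aS.
have ep := el_post ic_app_sub wf_ic_app eh eg.
have aG := adm_graphR wb wb' eh; have rC := rel_coalgR (adm_rel aS).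
apply: (rlolliI rC (adm_rel aG)).
- refine (el_gtapp ic_app_sub eg wc).
- refine (el_gtapp ic_app_sub ep wc').
move=> W' r y y' m; rewrite coalgR_ren graphR_ren !(coT_ren ic_app_sub) => hy.
rewrite -[tmr r (TApp g c)]/(TApp (tmr r g) (tyr r c)).
rewrite -[tmr r (TApp _ c')]/(TApp (tmr r (postG sg h g)) (tyr r c')).
rewrite (postG_ren ic_app_sub).
have wb1 := wf_ren m wb; have wb1' := wf_ren m wb'; have eh1 := el_ren m eh.
have wc1 := wf_ren m wc; have wc1' := wf_ren m wc'; have aS1 := adm_ren m aS.
have eg1 := el_ren m eg; rewrite (gT_ren ic_app_sub) in eg1.
have [_ ey ey' _] := hy.
have eA := el_gapp ic_app_sub eg1 wc1 ey.
apply/(rl_graphR _ wb1 wb1' eh1 eA).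
apply: eqv_trans (eqv_sym (post_beta ic_app_sub wf_ic_app eh1 eg1 wc1' ey')).
exact: eqv_app (eqv_refl eh1) (coalg_param wb1 eg1 aS1 hy).
Qed.

(** Identity extension relates [z] to itself; its Pi clause is taken at the graph of [h]. The
    families [g] and [postG h g] are related over that graph, hence so are the two results, which is
    the stated equation. *)
Lemma nu_natural W z b b' h g : el W z N -> wf W b -> wf W b' ->
  el W h (TLolli b b') -> el W g (gT sg b) ->
  eqv W b' (App h (App (TApp z b) g)) (App (TApp z b') (postG sg h g)).
Proof.
move=> ez wb wb' eh eg.
(* [idext_ic] expects an environment with one variable; [nu_ic] has none, so the unit type serves as
   a filler. *)
pose A : nat -> ty := fun=> TUnit; pose R : nat -> lrel := fun=> req TUnit.
have e := @idext_ic W nu_ic A R (wf_nu_ic 1) erefl erefl; rewrite ty_sub_nu in e.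
have hz : rl W (ic_rel A A R nu_ic) N N z z.
  apply/(requ_id z z e); apply/reqP; first exact: wf_nuT wf_ic_app W.
  exact: eqv_refl.
rewrite -(ty_sub_nu A) in hz.
have wL : wf_icty 1 (ILolli fam_ic (IVar 0)) by rewrite /= (wf_icty_mono ws).
have aG := adm_graphR wb wb' eh; have rG := adm_rel aG.
have h1 := @ic_rel_piE 0 _ _ _ _ _ _ _ _ _ _ wL (fun i (lt : i < 0) => match notF lt with end)
  hz aG.
have ep := el_post ic_app_sub wf_ic_app eh eg.
have hg : rl W (ic_rel (scons b A) (scons b' A) (scons (graphR b b' h) R) fam_ic)
   (gT sg b) (gT sg b') g (postG sg h g).
  rewrite -(ty_sub_fam (scons b A)) -(ty_sub_fam (scons b' A)).
  have wL' : wf_icty 2 (ILolli coalg_ic (IVar 1)) by rewrite /= (wf_icty_mono ws).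
  apply: (@ic_rel_piI 1) wL' _ _ _ _.
  - by case.
  - by rewrite ty_sub_fam.
  - by rewrite ty_sub_fam.
  move=> W' r c c' S m aS.
  have wb1 := wf_ren m wb; have wb1' := wf_ren m wb'; have eh1 := el_ren m eh.
  have eg1 := el_ren m eg; have ep1 := el_ren m ep.
  rewrite (gT_ren ic_app_sub) in eg1; rewrite (gT_ren ic_app_sub) in ep1.
  rewrite -[ic_rel _ _ _ (ILolli _ _)]/(rlolli _ _ _ _ (ic_rel _ _ _ coalg_ic)
    (rlr r (graphR b b' h))).
  rewrite ic_rel_coalg graphR_ren.
  rewrite -[ty_sub _ (ic_ty (ILolli _ _))]/(TLolli (ty_sub _ (ic_ty coalg_ic)) (tyr r b)).
  rewrite -[ty_sub (scons c' _) (ic_ty (ILolli _ _))]/(TLolli (ty_sub _ (ic_ty coalg_ic)) (tyr r b')).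
  rewrite !ty_sub_coalg (postG_ren ic_app_sub).
  exact: post_graph wb1 wb1' eh1 eg1 aS.
have rb' : rel W (graphR b b' h) b b' := adm_rel aG.
have := rlolliE (h' := graphR b b' h) rb' (h1 : rl W (rlolli _ _ b b'
  (ic_rel (scons b A) (scons b' A) (scons (graphR b b' h) R) fam_ic) (graphR b b' h))
  (TLolli _ b) (TLolli _ b') (TApp z b) (TApp z b')).
rewrite -/ic_ty !ty_sub_fam => K; have := K _ _ hg.
have eA := el_nuapp ic_app_sub ez wb eg.
by move/(rl_graphR _ wb wb' eh eA).
Qed.

Lemma ic_bisim W R x y : rel W R N N ->
  rl W (cofR sg rs N N R) (TLolli N (sg N)) (TLolli N (sg N)) (outT sg mp) (outT sg mp) ->
  rl W R N N x y -> eqv W N x y.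
Proof.
exact: (bisim ic_app_sub wf_ic_app ic_map1_sub el_ic_map1 occ_ic_map1 rel_ic_rel1
  ic_rel1_ren coalg_param nu_natural graph_coalgebra ic_rel1_mono adm_ic_rel1).
Qed.

End Instance.

Theorem theorem2p33 (s : icty) (hs : wf_icty 1 s)
    (hpos : only_positive 0 (ic_ty s))
    (Xi : nat) (G : tctx) (Th : rctx) (Phi : seq lprop)
    (hG : all (wf_ty Xi) G) (hTh : all (wf_relsort Xi) Th)
    (hPhi : forall i p, onth Phi i = Some p -> is_prop Xi G Th p)
    (R : lrel) (hR : is_rel Xi G Th R (nu s) (nu s)) :
  derives parametricity Xi G Th Phi
    (PImp
      (PRel (rlolli (nu s) (nu s) (ic_app s (nu s)) (ic_app s (nu s))
                    R (ic_rel1 s (nu s) (nu s) R))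
            (out s) (out s))
      (PAllTm (nu s) (PAllTm (nu s)
        (PImp (PRel (wkr 0 2 0 R) (Var 1) (Var 0))
              (PEq (nu s) (Var 1) (Var 0)))))).
Proof.
have S := ic_app_sub hs; have S1 := ic_map1_sub hs.
(* [nu s] and [out s] are convertible with [nuT] and [outT] at the functor of [s], so the closedness
   lemmas apply to them directly. *)
have nr r : ty_ren r (nu s) = nu s := nuT_ren S r.
have sr r : ty_ren r (ic_app s (nu s)) = ic_app s (nu s).
  by rewrite (sg_ren S) nr.
have or rt r : tm_ren rt r (out s) = out s := outT_ren S S1 rt r.
pose W := World Xi G Th Phi.
have wN V : wf V (nu s) := wf_nuT (wf_ic_app hs) V.
have rR : rel W R (nu s) (nu s) by split.
have eo V : el V (out s) (TLolli (nu s) (ic_app s (nu s))).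
  exact: (el_outT S (wf_ic_app hs) (el_ic_map1 hs hpos) (occ_ic_map1 hs)).
have rC := rel_rlolli rR (rel_ic_rel1 hs rR).
apply: (@holds_derivable W); apply: holds_impI.
  exact: prp_rel rC (eo _) (eo _).
move=> W' r m hC W1 r1 m1.
apply: (@der_allTm W1 (tyr r1 (tyr r (nu s))) (nu s)); [by rewrite !nr|exact: wN|].
apply: (@der_allTm (wtm (nu s) W1) (tyr r1 (tyr r (nu s))) (nu s));
  [by rewrite !nr|exact: wN|].
pose W2 := wtm (nu s) (wtm (nu s) W1).
pose r2 := rcomp (rcomp r r1) (rwk 0 2 0).
have m2 : morph W W2 r2 := morph_comp (morph_comp m m1) (morph_wtm2 _ _ W1).
have rR2 := rel_ren m2 rR; rewrite !nr in rR2.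
have E0 : el W2 (Var 0) (nu s) by el_at.
have E1 : el W2 (Var 1) (nu s) by el_at.
apply: (@der_imp W2 _ _ (PRel (rlr r2 R) (Var 1) (Var 0)) (PEq (nu s) (Var 1) (Var 0))).
- by rewrite /r2; sig.
- by rewrite -[LHS]/(PEq (tyr r1 (tyr r (nu s))) (Var 1) (Var 0)) !nr.
- exact: prp_rel rR2 E1 E0.
set P := PRel _ _ _ => hP.
have m3 := morph_comp m2 (morph_why P W2).
have rR3 : rel (why P W2) (rlr r2 R) (nu s) (nu s) by have := rel_ren m3 rR; rewrite !nr.
suff [_ _] : eqv (why P W2) (nu s) (Var 1) (Var 0) by [].
apply: (ic_bisim hs hpos rR3); last by split.
(* The bisimulation hypothesis was assumed at [W']; it is transported to the world that also
   contains both points and the assumption relating them. As [nu s] and [out s] are closed, only [R]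
   is renamed on the way. *)
have mm : morph W' (why P W2) (rcomp r1 (rcomp (rwk 0 2 0) rid)).
  exact: morph_comp m1 (morph_comp (morph_wtm2 _ _ W1) (morph_why P _)).
set r3 := rcomp r1 _ in mm.
have H : holds (why P W2) (PRel (rlr r3 (rlr r (rlolli (nu s) (nu s) (ic_app s (nu s))
    (ic_app s (nu s)) R (ic_rel1 s (nu s) (nu s) R))))
    (tmr r3 (tmr r (out s))) (tmr r3 (tmr r (out s)))) := holds_ren mm hC.
rewrite !rlolli_ren !nr !sr !or !(ic_rel1_ren hs) !nr rl_ren_ren in H.
by split=> //; apply: rel_rlolli rR3 (rel_ic_rel1 hs rR3).
Qed.
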